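(* Let $\Theta:[B(\mathcal H)^n]_1\to B(\mathcal E,\mathcal Y)\otimes_{min}B(\mathcal H)$ be a function. Then $\Theta$ is a free holomorphic function in $H^2_{\bf ball}(B(\mathcal E,\mathcal Y))$ with $\|\Theta\|_2\le1$ if and only if it has a representation $$\Theta(X)=L(X)\Big[I_{\mathcal E\otimes\mathcal H}-\sum_{i=1}^n(I_{\mathcal E}\otimes X_i)M_i(X)\Big]^{-1}\quad\text{for } X=(X_1,\dots,X_n)\in[B(\mathcal H)^n]_1,$$ where $\begin{bmatrix} L \\ M_1 \\ \vdots \\ M_n \end{bmatrix}$ is in the noncommutative Schur class $\mathcal S_{\bf ball}(B(\mathcal E,\mathcal Y\oplus\mathcal E^{(n)}))$.
   Context: Let $n\ge 1$; $\mathcal E,\mathcal Y$ are Hilbert spaces ($\mathcal E$ separable) and $\mathcal H$ is an infinite dimensional Hilbert space. $\mathbb F_n^+$ is the free unital semigroup on $g_1,\dots,g_n$ with identity $g_0$, $|\alpha|$ is word length; for operators $X_1,\dots,X_n$ and $\alpha=g_{i_1}\cdots g_{i_k}$, $X_\alpha=X_{i_1}\cdots X_{i_k}$, $X_{g_0}=I$. $[B(\mathcal H)^n]_1=\{(X_1,\dots,X_n)\in B(\mathcal H)^n:\|\sum_iX_iX_i^*\|^{1/2}<1\}$. $\mathcal E^{(n)}$ is the direct sum of $n$ copies of $\mathcal E$. A free holomorphic function on $[B(\mathcal H)^n]_1$ with coefficients in $B(\mathcal E,\mathcal Y)$ is a map $\Theta(X)=\sum_{k=0}^\infty\sum_{|\alpha|=k}A_{(\alpha)}\otimes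 X_\alpha$ with $A_{(\alpha)}\in B(\mathcal E,\mathcal Y)$ and $\limsup_k\|\sum_{|\alpha|=k}A_{(\alpha)}^*A_{(\alpha)}\|^{1/2k}\le1$. It is in $H^2_{\bf ball}(B(\mathcal E,\mathcal Y))$ if $\|\Theta\|_2:=\|\sum_\alpha A_{(\alpha)}^*A_{(\alpha)}\|^{1/2}<\infty$. The Schur class $\mathcal S_{\bf ball}(B(\mathcal E,\mathcal Y))$ is the set of free holomorphic functions $G$ with coefficients in $B(\mathcal E,\mathcal Y)$ and $\|G\|_\infty=\sup_{X\in[B(\mathcal H)^n]_1}\|G(X)\|\le1$. *)

(* Defs.v *)
From HB Require Import structures.
From mathcomp Require Import all_boot all_order all_algebra sesquilinear.
From mathcomp Require Import complex.
From mathcomp Require Import all_classical all_reals all_analysis.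

Set Implicit Arguments.
Unset Strict Implicit.
Unset Printing Implicit Defensive.
Import Order.TTheory GRing.Theory Num.Theory Num.Def.
Import numFieldNormedType.Exports.

Local Open Scope classical_set_scope.
Local Open Scope complex_scope.
Local Open Scope ring_scope.

Section DotProduct.
Variables (C : numClosedFieldType) (U : lmodType C) (form : {dot U for conjC}).

Lemma dot_CauchySchwarz u v :
  `|form u v| <= sqrtC (form u u) * sqrtC (form v v).
Proof.
rewrite -sqrtCM ?nnegrE ?dnorm_ge0// -(sqrCK (normr_ge0 _)).
rewrite ler_sqrtC ?nnegrE ?exprn_ge0 ?mulr_ge0 ?dnorm_ge0//.
have [-> | nz_v] := eqVneq v 0.
  by rewrite linear0r normr0 expr0n mulr_ge0 ?dnorm_ge0.
have vv_gt0 : 0 < form v v by rewrite dnorm_gt0.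
pose a := form u v / form v v; pose u1 := u - a *: v.
have ou : form u1 v = 0.
  by rewrite linearBl/= linearZl_LR/= divfK ?gt_eqF// subrr.
have uva : form u v = a * form v v by rewrite divfK ?gt_eqF.
have -> : form u u = form u1 u1 + `|a| ^+ 2 * form v v.
  rewrite -dnormZ -hnormDd ?subrK//.
  by rewrite linearZr_LR/= ou mulr0.
rewrite {}uva normrM exprMn (ger0_norm (ltW vv_gt0)) mulrDl.
by rewrite (expr2 (form v v)) mulrA lerDr mulr_ge0 ?dnorm_ge0.
Qed.

Lemma dot_triangle u v :
  sqrtC (form (u + v) (u + v)) <= sqrtC (form u u) + sqrtC (form v v).
Proof.
rewrite -ler_sqr ?nnegrE ?addr_ge0 ?sqrtC_ge0 ?dnorm_ge0//.
rewrite sqrrD !sqrtCK addrAC dnormD lerD2l.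
have := le_trans (leif_Re_Creal (form u v)) (dot_CauchySchwarz u v).
rewrite ReE ler_pdivrMr ?ltr0n// mulr_natr.
exact.
Qed.

End DotProduct.

(* Inner products are linear in the first argument. *)
HB.mixin Record NormedModule_hasInner (R : realType) V
    & NormedModule R[i] V := {
  inner : {dot V for conjC};
  inner_norm : forall x : V, inner x x = `|x| ^+ 2 }.

#[short(type="prehilbertType")]
HB.structure Definition PreHilbert (R : realType) :=
  {V of NormedModule R[i] V & NormedModule_hasInner R V}.

#[short(type="hilbertType")]
HB.structure Definition Hilbert (R : realType) :=
  {V of CompleteNormedModule R[i] V & NormedModule_hasInner R V}.

HB.factory Record Lmodule_hasDot (R : realType) V & GRing.Lmodule R[i] V := {
  dotp : {dot V for conjC} }.

HB.builders Context R V & Lmodule_hasDot R V.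

Let norm (x : V) : R[i] := sqrtC (dotp x x).

Let normZ (l : R[i]) (x : V) : norm (l *: x) = `|l| * norm x.
Proof.
rewrite /norm dnormZ sqrtCM ?nnegrE ?exprn_ge0 ?dnorm_ge0//.
by rewrite sqrCK.
Qed.

Let norm_eq0 (x : V) : norm x = 0 -> x = 0.
Proof. by move=> /eqP; rewrite sqrt_dnorm_eq0 => /eqP. Qed.

HB.instance Definition _ := Lmodule_isNormed.Build R[i] V
  (dot_triangle dotp) normZ norm_eq0.

Let dot_norm (x : V) : dotp x x = `|x| ^+ 2.
Proof. by rewrite sqrtCK. Qed.

HB.instance Definition _ := NormedModule_hasInner.Build R V dot_norm.

HB.end.

Section Bounded.
Context {R : realType} {U V : normedModType R[i]}.

Definition bounded_linear_map : {pred U -> V} := fun f =>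
  `[< linear f /\ exists M : R, forall x, `|f x| <= M%:C * `|x| >].

Lemma bounded_linear_map_submod : submod_closed bounded_linear_map.
Proof.
split.
  apply/asboolP; split; first by move=> a x y /=; rewrite scaler0 addr0.
  by exists 0 => x /=; rewrite normr0 mul0r.
move=> a f g /asboolP[lf [M Mf]] /asboolP[lg [N Ng]]; apply/asboolP; split.
  move=> b x y; rewrite !fctE/= lf lg !scalerDr !scalerA [a * b]mulrC.
  by rewrite addrACA.
exists (complex.Re `|a| * M + N) => x; rewrite !fctE/=.
have aE : `|a| = (complex.Re `|a|)%:C by rewrite RRe_real// normr_real.
rewrite rmorphD rmorphM/= -aE mulrDl -mulrA.
rewrite (le_trans (ler_normD _ _))// lerD ?Ng// normrZ.
by rewrite ler_wpM2l// Mf.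
Qed.

HB.instance Definition _ :=
  GRing.isSubmodClosed.Build R[i] (U -> V) bounded_linear_map
    bounded_linear_map_submod.

End Bounded.

Record bop (R : realType) (U V : normedModType R[i]) := Bop {
  bop_fun :> U -> V ;
  bop_subproof : bop_fun \in bounded_linear_map }.

HB.instance Definition _ R U V := [isSub for @bop_fun R U V].
HB.instance Definition _ R U V := [Choice of @bop R U V by <:].
HB.instance Definition _ R U V := [SubChoice_isSubLmodule of @bop R U V by <:].

Lemma bop_linear (R : realType) (U V : normedModType R[i]) (f : bop U V) :
  linear f.
Proof. by have /asboolP[] := bop_subproof f. Qed.

HB.instance Definition _ (R : realType) (U V : normedModType R[i])
  (f : bop U V) := GRing.isLinear.Build R[i] U V _ f (bop_linear f).

Section OperatorNorm.
Context {R : realType} {U V : normedModType R[i]}.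
Implicit Types f g : bop U V.

Definition opnorm f : R :=
  sup [set complex.Re `|f x| | x in [set x | `|x| <= 1]].

Let normRe (W : normedModType R[i]) (x : W) : `|x| = (complex.Re `|x|)%:C.
Proof. by rewrite RRe_real// normr_real. Qed.

Lemma bopD f g x : (f + g) x = f x + g x. Proof. by []. Qed.
Lemma bopZ a f x : (a *: f) x = a *: f x. Proof. by []. Qed.

Let opnorm_has_sup f :
  has_sup [set complex.Re `|f x| | x in [set x | `|x| <= 1]].
Proof.
split; first by exists (complex.Re `|f 0|), 0 => //=; rewrite normr0.
have /asboolP[_ [M fM]] := bop_subproof f.
exists `|M| => _ [x /= x1 <-].
rewrite -lecR -normRe (le_trans (fM x))//.
rewrite (@le_trans _ _ (`|M|%:C * `|x|))//.
  by rewrite ler_wpM2r// lecR ler_norm.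
by rewrite ler_piMr// lecR.
Qed.

Let opnorm_ge0 f : 0 <= opnorm f.
Proof.
apply: (le_trans _ (ub_le_sup (opnorm_has_sup f).2 _)); last first.
  by exists 0 => /=; [rewrite normr0|reflexivity].
by rewrite linear0 normr0.
Qed.

Lemma le_opnorm f x : `|f x| <= (opnorm f)%:C * `|x|.
Proof.
have [->|x0] := eqVneq x 0; first by rewrite linear0 !normr0 mulr0.
have nx0 : 0 < `|x| by rewrite normr_gt0.
rewrite -ler_pdivrMr// mulrC -[X in X * _](@ger0_norm _ `|x|^-1) ?invr_ge0//.
rewrite -normrZ -linearZ (normRe (f _)) lecR; apply: ub_le_sup; first exact: (opnorm_has_sup f).2.
by exists (`|x|^-1 *: x) => //=; rewrite normrZV// unitfE gt_eqF.
Qed.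

Lemma opnorm_le f (M : R) : 0 <= M -> (forall x, `|f x| <= M%:C * `|x|) ->
  opnorm f <= M.
Proof.
move=> M0 fM; apply: ge_sup; first exact: (opnorm_has_sup f).1.
move=> _ [x /= x1 <-]; rewrite -lecR -normRe (le_trans (fM x))//.
by rewrite ler_piMr// lecR.
Qed.

Let bop_norm f : R[i] := (opnorm f)%:C.

Let bop_ler_normD f g : bop_norm (f + g) <= bop_norm f + bop_norm g.
Proof.
rewrite /bop_norm -rmorphD/= lecR opnorm_le ?addr_ge0// => x.
rewrite bopD (le_trans (ler_normD _ _))// rmorphD mulrDl.
by rewrite lerD// le_opnorm.
Qed.

Let bop_normrZ a f : bop_norm (a *: f) = `|a| * bop_norm f.
Proof.
have le_Z b g : bop_norm (b *: g) <= `|b| * bop_norm g.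
  have [r br] : exists r : R, `|b| = r%:C by exists (Normc.normc b).
  have r0 : 0 <= r by rewrite -ler0c -br.
  rewrite /bop_norm br -rmorphM/= lecR opnorm_le ?mulr_ge0// => x.
  by rewrite bopZ normrZ br rmorphM/= -mulrA ler_wpM2l ?lecR// le_opnorm.
apply/eqP; rewrite eq_le le_Z/=.
have [->|a0] := eqVneq a 0.
  by rewrite normr0 mul0r /bop_norm ler0c.
rewrite -ler_pdivlMl ?normr_gt0//.
by rewrite -[X in bop_norm X <= _](scalerK a0) -normfV le_Z.
Qed.

Let bop_normr0_eq0 f : bop_norm f = 0 -> f = 0.
Proof.
move=> f0; apply: val_inj; apply/funext => x /=; apply/eqP.
rewrite -normr_le0 (le_trans (le_opnorm f x))//.
by rewrite -/(bop_norm f) f0 mul0r.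
Qed.

HB.instance Definition _ := Lmodule_isNormed.Build R[i] (bop U V)
  bop_ler_normD bop_normrZ bop_normr0_eq0.

Lemma bop_normE f : `|f| = (opnorm f)%:C. Proof. by []. Qed.

End OperatorNorm.

Section Composition.
Context {R : realType}.
Implicit Types U V W : normedModType R[i].

Lemma bop_id_subproof U : (@idfun U) \in (@bounded_linear_map R U U).
Proof.
by apply/asboolP; split=> //; exists 1 => x; rewrite mul1r.
Qed.
Definition bop_id U : bop U U := Bop (bop_id_subproof U).

Lemma bop_comp_subproof U V W (g : bop V W) (f : bop U V) :
  g \o f \in (@bounded_linear_map R U W).
Proof.
apply/asboolP; split; first by move=> a x y /=; rewrite !linearP.
exists (opnorm g * opnorm f) => x /=.
rewrite (le_trans (le_opnorm _ _))// rmorphM/= -mulrA.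
by rewrite ler_wpM2l// ?le_opnorm// -bop_normE.
Qed.
Definition bop_comp U V W (g : bop V W) (f : bop U V) : bop U W :=
  Bop (bop_comp_subproof g f).
End Composition.

Lemma finite_family_complete (K : numFieldType) (I : finType)
    (W : I -> completeNormedModType K) (V : normedModType K)
    (pr : forall i, {linear V -> W i}) :
  (forall x i, `|pr i x| <= `|x|) ->
  (forall x, `|x| <= \sum_i `|pr i x|) ->
  (forall w : forall i, W i, exists x, forall i, pr i x = w i) ->
  forall F : set_system V, ProperFilter F -> cauchy F -> cvg F.
Proof.
move=> pr_le le_pr pr_surj F FF /cauchy_ballP Fc.
have pr_cvg i : cvg (pr i @ F).
  apply: cauchy_cvg; apply/cauchy_ballP => e e0.
  have := Fc _ e0; rewrite !near_simpl => -[[P Q] [/= FP FQ] PQ].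
  exists (pr i @` P, pr i @` Q) => /=.
    by split; [apply: filterS FP|apply: filterS FQ] => x Px; exists x.
  move=> [_ _] [/= [x Px <-] [y Qy <-]].
  have := PQ (x, y) (conj Px Qy); rewrite -!ball_normE/= -linearB.
  by apply: le_lt_trans; exact: pr_le.
have [x xl] := pr_surj (fun i => lim (pr i @ F)).
apply/cvg_ex; exists x; apply/cvgrPdist_lt => e e0.
have d0 : 0 < e / #|I|.+1%:R by rewrite divr_gt0.
have : \forall p \near F, forall i, `|pr i x - pr i p| < e / #|I|.+1%:R.
  apply: filter_forall => i; rewrite xl.
  by have /cvgrPdist_lt/(_ _ d0) := pr_cvg i.
apply: filterS => p xp; rewrite (le_lt_trans (le_pr _))//.
rewrite (@le_lt_trans _ _ (\sum_(i : I) e / #|I|.+1%:R))//.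
  by apply: ler_sum => i _; rewrite linearB ltW.
rewrite sumr_const -[ltLHS]mulr_natr mulrAC ltr_pdivrMr// ltr_pM2l//.
by rewrite ltr_nat ltnS; apply: eq_leq; apply: eq_card.
Qed.

(* Hilbert space direct sum: the library's norm on [Y * Z] is the sup norm, so
   the l2 structure is put on an alias *)
Definition hsum (R : realType) (Y Z : hilbertType R) : Type := (Y * Z)%type.

Section HilbertSum.
Context {R : realType} (Y Z : hilbertType R).
HB.instance Definition _ := GRing.Lmodule.copy (hsum Y Z) (Y * Z)%type.

Definition hsum_dot (u v : hsum Y Z) : R[i] :=
  inner u.1 v.1 + inner u.2 v.2.

Lemma hsum_dot_bilinear :
  bilinear_for ( *%R : R[i] -> R[i] -> R[i]) (conjC \; *%R) hsum_dot.
Proof.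
split=> w a u v; rewrite /hsum_dot/=.
  by rewrite !linearPl/= mulrDr addrACA.
by rewrite !linearPr/= mulrDr addrACA.
Qed.
HB.instance Definition _ := bilinear_isBilinear.Build R[i] (hsum Y Z)
  (hsum Y Z) R[i] _ _ hsum_dot hsum_dot_bilinear.
Lemma hsum_dot_herm u v :
  hsum_dot u v = (-1) ^+ false * conjC (hsum_dot v u).
Proof.
by rewrite /hsum_dot [in LHS]hermC [X in _ + X]hermC !expr0 !mul1r rmorphD.
Qed.
HB.instance Definition _ := isHermitianSesquilinear.Build R[i] (hsum Y Z)
  false conjC hsum_dot hsum_dot_herm.
Lemma hsum_dot_gt0 u : u != 0 -> 0 < hsum_dot u u.
Proof.
move=> u0; rewrite lt_def addr_ge0 ?dnorm_ge0// andbT.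
apply: contra u0; rewrite paddr_eq0 ?dnorm_ge0// !dnorm_eq0.
by case: u => y z /= /andP[/eqP-> /eqP->].
Qed.
HB.instance Definition _ := isDotProduct.Build R[i] (hsum Y Z) hsum_dot
  hsum_dot_gt0.
HB.instance Definition _ := Lmodule_hasDot.Build R (hsum Y Z) hsum_dot.

Definition hsum_fst (u : hsum Y Z) : Y := u.1.
Definition hsum_snd (u : hsum Y Z) : Z := u.2.
HB.instance Definition _ :=
  GRing.isLinear.Build R[i] (hsum Y Z) Y _ hsum_fst (fun a u v => erefl).
HB.instance Definition _ :=
  GRing.isLinear.Build R[i] (hsum Y Z) Z _ hsum_snd (fun a u v => erefl).

Lemma hsum_normE (u : hsum Y Z) : `|u| ^+ 2 = `|u.1| ^+ 2 + `|u.2| ^+ 2.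
Proof. by rewrite -!inner_norm. Qed.

Lemma hsum_complete (F : set_system (hsum Y Z)) :
  ProperFilter F -> cauchy F -> cvg F.
Proof.
pose W (b : bool) : completeNormedModType R[i] := if b then Y else Z.
pose pr (b : bool) : {linear hsum Y Z -> W b} :=
  if b return {linear hsum Y Z -> W b} then hsum_fst else hsum_snd.
apply: (@finite_family_complete _ _ W _ pr).
- move=> x b; rewrite -ler_sqr ?nnegrE// hsum_normE.
  by case: b; rewrite ?lerDl ?lerDr exprn_ge0.
- move=> x; rewrite big_bool/= -ler_sqr ?nnegrE ?addr_ge0// hsum_normE.
  by rewrite sqrrD lerD2r lerDl mulrn_wge0// mulr_ge0.
- by move=> w; exists (w true, w false); case.
Qed.
HB.instance Definition _ :=
  Uniform_isComplete.Build (hsum Y Z) hsum_complete.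

Lemma hsum_inl_subproof :
  (fun y => (y, 0) : hsum Y Z) \in (@bounded_linear_map R Y (hsum Y Z)).
Proof.
apply/asboolP; split; first by move=> a x y; congr pair; rewrite /= scaler0 addr0.
exists 1 => x; rewrite mul1r -ler_sqr ?nnegrE// hsum_normE/= normr0 expr0n.
by rewrite addr0.
Qed.
Definition hsum_inl : bop Y (hsum Y Z) := Bop hsum_inl_subproof.

Lemma hsum_inr_subproof :
  (fun z => (0, z) : hsum Y Z) \in (@bounded_linear_map R Z (hsum Y Z)).
Proof.
apply/asboolP; split; first by move=> a x y; congr pair; rewrite /= scaler0 addr0.
exists 1 => x; rewrite mul1r -ler_sqr ?nnegrE// hsum_normE/= normr0 expr0n.
by rewrite add0r.
Qed.
Definition hsum_inr : bop Z (hsum Y Z) := Bop hsum_inr_subproof.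

End HilbertSum.

Definition hpow (R : realType) (n : nat) (E : hilbertType R) : Type :=
  {ffun 'I_n -> E}.

Section HilbertPower.
Context {R : realType} (n : nat) (E : hilbertType R).
HB.instance Definition _ := GRing.Lmodule.copy (hpow n E) {ffun 'I_n -> E}.

Definition hpow_dot (u v : hpow n E) : R[i] := \sum_i inner (u i) (v i).

Lemma hpow_dot_bilinear :
  bilinear_for ( *%R : R[i] -> R[i] -> R[i]) (conjC \; *%R) hpow_dot.
Proof.
split=> w a u v; rewrite /hpow_dot/= mulr_sumr -big_split/=;
  apply: eq_bigr => i _; rewrite !ffunE.
  by rewrite linearPl.
by rewrite linearPr.
Qed.
HB.instance Definition _ := bilinear_isBilinear.Build R[i] (hpow n E)
  (hpow n E) R[i] _ _ hpow_dot hpow_dot_bilinear.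
Lemma hpow_dot_herm u v :
  hpow_dot u v = (-1) ^+ false * conjC (hpow_dot v u).
Proof.
rewrite expr0 mul1r /hpow_dot rmorph_sum; apply: eq_bigr => i _.
by rewrite [in LHS]hermC expr0 mul1r.
Qed.
HB.instance Definition _ := isHermitianSesquilinear.Build R[i] (hpow n E)
  false conjC hpow_dot hpow_dot_herm.
Lemma hpow_dot_gt0 u : u != 0 -> 0 < hpow_dot u u.
Proof.
move=> u0; rewrite lt_def sumr_ge0 ?andbT; last by move=> i _; exact: dnorm_ge0.
apply: contra u0; rewrite psumr_eq0; last by move=> i _; exact: dnorm_ge0.
move=> /allP ui; apply/eqP/ffunP => i; rewrite ffunE; apply/eqP.
by have := ui i (mem_index_enum i); rewrite dnorm_eq0.
Qed.
HB.instance Definition _ := isDotProduct.Build R[i] (hpow n E) hpow_dot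
  hpow_dot_gt0.
HB.instance Definition _ := Lmodule_hasDot.Build R (hpow n E) hpow_dot.

Definition hpow_proj (i : 'I_n) (u : hpow n E) : E := u i.
Lemma hpow_proj_linear i : linear (hpow_proj i).
Proof. by move=> a u v; rewrite /hpow_proj !ffunE. Qed.
HB.instance Definition _ i :=
  GRing.isLinear.Build R[i] (hpow n E) E _ (hpow_proj i) (hpow_proj_linear i).

Lemma hpow_normE (u : hpow n E) : `|u| ^+ 2 = \sum_i `|u i| ^+ 2.
Proof. by rewrite -inner_norm; apply: eq_bigr => i _; rewrite inner_norm. Qed.

Lemma hpow_complete (F : set_system (hpow n E)) :
  ProperFilter F -> cauchy F -> cvg F.
Proof.
apply: (@finite_family_complete _ _ (fun=> E) _ hpow_proj).
- move=> x i; rewrite -ler_sqr ?nnegrE// hpow_normE (bigD1 i)//= lerDl.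
  by apply: sumr_ge0 => j _; rewrite exprn_ge0.
- move=> x; rewrite -ler_sqr ?nnegrE ?sumr_ge0// hpow_normE expr2.
  rewrite mulr_suml; apply: ler_sum => i _; rewrite expr2 ler_wpM2l//.
  by rewrite (bigD1 i)//= lerDl sumr_ge0.
- by move=> w; exists [ffun i => w i] => i; rewrite /= /hpow_proj ffunE.
Qed.
HB.instance Definition _ :=
  Uniform_isComplete.Build (hpow n E) hpow_complete.

Lemma hpow_in_subproof i :
  (fun x => [ffun j => if j == i then x else 0] : hpow n E)
    \in (@bounded_linear_map R E (hpow n E)).
Proof.
apply/asboolP; split.
  move=> a x y; apply/ffunP => j; rewrite !ffunE.
  by case: ifP => //; rewrite scaler0 addr0.
exists 1 => x; rewrite mul1r -ler_sqr ?nnegrE// hpow_normE (bigD1 i)//=.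
rewrite ffunE eqxx big1 ?addr0// => j /negPf ji.
by rewrite ffunE ji normr0 expr0n.
Qed.
Definition hpow_in i : bop E (hpow n E) := Bop (hpow_in_subproof i).

End HilbertPower.

Definition separable (T : topologicalType) : Prop :=
  exists D : set T, countable D /\ dense D.

Definition infinite_dimensional (K : fieldType) (V : lmodType K) : Prop :=
  ~ exists (k : nat) (b : 'I_k -> V),
      forall x, exists c : 'I_k -> K, x = \sum_i c i *: b i.

(* The set below is a singleton by the Riesz representation theorem. *)
Definition adj (R : realType) (U V : hilbertType R) (T : bop U V) : bop V U :=
  xget 0 [set S : bop V U | forall x y, inner (T x) y = inner x (S y)].

Definition bop_inverse (R : realType) (U V : normedModType R[i])
    (T : bop U V) (S : bop V U) : Prop :=
  bop_comp T S = bop_id V /\ bop_comp S T = bop_id U.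

(* A Hilbert space tensor product of E and H; any two are unitarily equivalent
   by a unitary that intertwines the maps [tens]. *)
Record hilbert_tensor (R : realType) (E H : hilbertType R) := HilbertTensor {
  tensor_space :> hilbertType R ;
  tens : {bilinear E -> H -> tensor_space} ;
  inner_tens : forall e h e' h',
    inner (tens e h) (tens e' h') = inner e e' * inner h h' ;
  dense_tens : dense [set u : tensor_space |
    exists (k : nat) (e : 'I_k -> E) (h : 'I_k -> H),
      u = \sum_i tens (e i) (h i)] }.

Section Tensor.
Context {R : realType} {E Y H K : hilbertType R}.
Variables (EH : hilbert_tensor E H) (YK : hilbert_tensor Y K).

(* [A (x) X], the only bounded operator with
   [(A (x) X) (e (x) h) = A e (x) X h] *)
Definition otens (A : bop E Y) (X : bop H K) : bop EH YK :=
  xget 0 [set T : bop EH YK |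
    forall e h, T (tens EH e h) = tens YK (A e) (X h)].

Definition min_tensor : set (bop EH YK) :=
  closure [set T : bop EH YK |
    exists (k : nat) (A : 'I_k -> bop E Y) (X : 'I_k -> bop H K),
      T = \sum_i otens (A i) (X i)].

End Tensor.
Arguments otens {R E Y H K} EH YK A X.
Arguments min_tensor {R E Y H K} EH YK.

Section Ball.
Context {R : realType} (n : nat) (H : hilbertType R).

Definition opball : set ('I_n -> bop H H) :=
  [set X | Num.sqrt (opnorm (\sum_i bop_comp (X i) (adj (X i)))) < 1].

(* Words of the free semigroup are sequences of letters. *)
Definition word_eval (X : 'I_n -> bop H H) (w : seq 'I_n) : bop H H :=
  foldr (fun i T => bop_comp (X i) T) (bop_id H) w.

End Ball.
Arguments opball {R} n H.

Section FreeHolomorphic.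
Context {R : realType} {n : nat} {E Y H : hilbertType R}.
Variables (EH : hilbert_tensor E H) (YH : hilbert_tensor Y H).
Implicit Types (A : seq 'I_n -> bop E Y) (F : opball n H -> bop EH YH).

Definition gram A (k : nat) : bop E E :=
  \sum_(w : k.-tuple 'I_n) bop_comp (adj (A w)) (A w).

Definition has_expansion A F : Prop :=
  (limn_esup (fun k => (opnorm (gram A k) `^ (2 * k%:R)^-1)%:E) <= 1)%E /\
  forall X : opball n H,
    series (fun k => \sum_(w : k.-tuple 'I_n)
      otens EH YH (A w) (word_eval (set_val X) w)) @ \oo --> F X.

Definition free_holomorphic F : Prop := exists A, has_expansion A F.

(* [\sum_w A_w^* A_w], converging in the strong operator topology *)
Definition is_gram_sum A (S : bop E E) : Prop :=
  forall x, series (fun k => gram A k x) @ \oo --> S x.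

Definition H2norm A : \bar R :=
  if `[< exists S, is_gram_sum A S >]
  then (Num.sqrt (opnorm (xget 0 (is_gram_sum A))))%:E else +oo%E.

Definition supnorm F : \bar R := ereal_sup [set (opnorm (F X))%:E | X in setT].

Definition schur_class F : Prop := free_holomorphic F /\ (supnorm F <= 1)%E.

End FreeHolomorphic.
Arguments has_expansion {R n E Y H} EH YH A F.
Arguments free_holomorphic {R n E Y H} EH YH F.
Arguments schur_class {R n E Y H} EH YH F.

(* The column [L; M_1; ...; M_n] as a function with values in
   B(E (x) H, (Y (+) E^(n)) (x) H) *)
Definition column (R : realType) (n : nat) (E Y H : hilbertType R)
    (EH : hilbert_tensor E H) (YH : hilbert_tensor Y H)
    (CH : hilbert_tensor (hsum Y (hpow n E)) H)
    (L : opball n H -> bop EH YH) (M : 'I_n -> opball n H -> bop EH EH)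
    (X : opball n H) : bop EH CH :=
  bop_comp (otens YH CH (hsum_inl Y (hpow n E)) (bop_id H)) (L X) +
  \sum_i bop_comp
    (otens EH CH (bop_comp (hsum_inr Y (hpow n E)) (hpow_in E i)) (bop_id H))
    (M i X).
Arguments column {R n E Y H} EH YH CH L M X.

(* Main.v *)
(** Coefficients [A] with [sum_w A_w^* A_w <= I] are the same as a contraction
    [V : E -> l2(words; Y)], [V x = (A_w x)_w], and then
    [Theta(X) = P (I - Z)^-1 V], where [P] evaluates at the empty word and
    [Z = sum_j T_j (x) X_j] for the backward shifts [T_j]. Closing the loop with
    [V^*] gives the solution [L = P R V], [M_j = V^* T_j R V], where
    [R = (I - Z + V V^* Z)^-1]. The column [L; M] is contractive because
    [sum_j T_j^* T_j + P^* P <= I], [X] is a row contraction and [I - V V^*] is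
    positive; tensoring the last two facts amounts to the Schur product theorem.

    Conversely, evaluating a Schur class column at truncated creation operators,
    which live on a finite dimensional subspace of [H], shows that its Toeplitz
    matrix on words is a contraction. Applied to the vectors [g_w = G_w x], where
    [G = (1 - sum_i X_i M_i)^-1] as a power series, it says that
    [sum_(|w| <= N) |A_w x|^2 + sum_(|w| <= N+1) |g_w|^2 - |x|^2] is at most
    [sum_(|w| <= N) |g_w|^2], where [A] are the coefficients of [L G]; hence
    [sum_w |A_w x|^2 <= |x|^2]. *)

Require Import Defs.
From HB Require Import structures.
From mathcomp Require Import all_boot all_order all_algebra sesquilinear.
From mathcomp Require Import complex.
From mathcomp Require Import all_classical all_reals all_analysis.
From mathcomp Require Import ring lra.
Set Implicit Arguments.
Unset Strict Implicit.
Unset Printing Implicit Defensive.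
Import Order.TTheory GRing.Theory Num.Theory.
Import numFieldNormedType.Exports.
Local Open Scope classical_set_scope.
Local Open Scope complex_scope.
Local Open Scope ring_scope.

(** * Inner products and bounded operators *)

(** The loop is classical in one variable. The numbers [V^* T^k V = sum_w conj(a_w) a_(w+k)] are the
    Fourier coefficients of [|Theta|^2]. When [V] is isometric, [1 + 2 V^* Z (I - Z)^-1 V] is the
    Herglotz transform of [|Theta|^2] and [z M] is its Cayley transform, that is,
    [(1 - z M)^-1 = 1 + V^* Z (I - Z)^-1 V]. The same formula serves for words; for a mere
    contraction [V] the constant term is kept equal to [1]. Contractivity of the column rests on the
    product of two defects, that of [V^*] on coefficients and that of the row [X] on [H]. Positivity
    is carried by sesquilinear forms on finite lists of elementary tensors, where no square root is
    needed, and it reaches the completed tensor products by density. In the converse, points of the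
    ball are strict row contractions, so the creation operators are scaled by [r < 1]. Cut at length
    [N], they turn the power series into a finite sum that displays the coefficients exactly; [r]
    then tends to [1] with [N] fixed. *)

Section ComplexParts.
Context {R : realType}.
Implicit Types a b : R[i].

Lemma ReD a b : complex.Re (a + b) = complex.Re a + complex.Re b.
Proof. by case: a b => [? ?] [? ?]. Qed.
Lemma Re_realM (r : R) a : complex.Re (r%:C * a) = r * complex.Re a.
Proof. by case: a => [? ?] /=; rewrite mul0r subr0. Qed.
Lemma Re_conj a : complex.Re (Num.conj a) = complex.Re a.
Proof. by case: a. Qed.
Lemma Im_conj a : complex.Im (Num.conj a) = - complex.Im a.
Proof. by case: a. Qed.
Lemma conj_real (r : R) : Num.conj (r%:C) = r%:C.
Proof. by rewrite /Num.conj /= oppr0. Qed.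
Lemma Re_sum I (r : seq I) (P : pred I) (F : I -> R[i]) :
  complex.Re (\sum_(i <- r | P i) F i) = \sum_(i <- r | P i) complex.Re (F i).
Proof. exact: (big_morph _ ReD). Qed.
Lemma ge0_Re a : 0 <= a -> a = (complex.Re a)%:C.
Proof. by case: a => [x y]; rewrite lecE /= => /andP[/eqP -> _]. Qed.
Lemma ge0_ReE a : 0 <= a -> 0 <= complex.Re a.
Proof. by case: a => [x y]; rewrite lecE /= => /andP[]. Qed.
Lemma complex_eq a b : complex.Re a = complex.Re b -> complex.Im a = complex.Im b -> a = b.
Proof. by case: a b => [? ?] [? ?] /= -> ->. Qed.
End ComplexParts.

Section Inner.
Context {R : realType} {V : prehilbertType R}.
Implicit Types (x y z : V) (a : R[i]).

Lemma innerDl x y z : inner (x + y) z = inner x z + inner y z.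
Proof. by rewrite linearDl. Qed.
Lemma innerDr x y z : inner x (y + z) = inner x y + inner x z.
Proof. by rewrite linearDr. Qed.
Lemma innerZl a x y : inner (a *: x) y = a * inner x y.
Proof. by rewrite linearZl_LR. Qed.
Lemma innerZr a x y : inner x (a *: y) = Num.conj a * inner x y.
Proof. by rewrite linearZr_LR. Qed.
Lemma inner_conj x y : inner x y = Num.conj (inner y x).
Proof. by rewrite hermC expr0 mul1r. Qed.
Lemma inner0l x : inner 0 x = 0. Proof. by rewrite linear0l. Qed.
Lemma inner0r x : inner x 0 = 0. Proof. by rewrite linear0r. Qed.
Lemma inner_suml I (r : seq I) (P : pred I) (F : I -> V) y :
  inner (\sum_(i <- r | P i) F i) y = \sum_(i <- r | P i) inner (F i) y.
Proof. by apply: (big_morph (fun x => inner x y)) => [? ?|]; rewrite ?innerDl ?inner0l. Qed.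
Lemma inner_sumr I (r : seq I) (P : pred I) (F : I -> V) y :
  inner y (\sum_(i <- r | P i) F i) = \sum_(i <- r | P i) inner y (F i).
Proof. by apply: (big_morph (fun x => inner y x)) => [? ?|]; rewrite ?innerDr ?inner0r. Qed.

(** Real parts suffice: the imaginary part of an inner product is the real part after a rotation by
    ['i], and inequalities between values of [rin] and [n2] live in [R], within reach of [lra]. *)
Definition rin x y : R := complex.Re (inner x y).
Definition n2 x : R := rin x x.

Lemma n2C x : inner x x = (n2 x)%:C.
Proof. by rewrite [LHS]ge0_Re// dnorm_ge0. Qed.
Lemma n2_ge0 x : 0 <= n2 x.
Proof. exact/ge0_ReE/dnorm_ge0. Qed.
Lemma n2_0 : n2 0 = 0. Proof. by rewrite /n2 /rin inner0l. Qed.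
Lemma n2_eq0 x : n2 x = 0 -> x = 0.
Proof. by move=> x0; apply/eqP; rewrite -(dnorm_eq0 (@inner R V)) n2C x0. Qed.
Lemma normE x : `|x| = (Num.sqrt (n2 x))%:C.
Proof.
apply/eqP; rewrite -(eqrXn2 (n := 2))// ?ler0c ?sqrtr_ge0//.
by rewrite -inner_norm n2C -rmorphXn/= sqr_sqrtr// n2_ge0.
Qed.
Lemma rinC x y : rin x y = rin y x.
Proof. by rewrite /rin inner_conj Re_conj. Qed.
Lemma rinDl x y z : rin (x + y) z = rin x z + rin y z.
Proof. by rewrite /rin innerDl ReD. Qed.
Lemma rinDr x y z : rin x (y + z) = rin x y + rin x z.
Proof. by rewrite /rin innerDr ReD. Qed.
Lemma rinZl (r : R) x y : rin (r%:C *: x) y = r * rin x y.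
Proof. by rewrite /rin innerZl Re_realM. Qed.
Lemma rinZr (r : R) x y : rin x (r%:C *: y) = r * rin x y.
Proof. by rewrite rinC rinZl rinC. Qed.
Lemma rinNl x y : rin (- x) y = - rin x y.
Proof. by rewrite /rin linearNl/= raddfN. Qed.
Lemma rinNr x y : rin x (- y) = - rin x y.
Proof. by rewrite rinC rinNl rinC. Qed.
Lemma rinBl x y z : rin (x - y) z = rin x z - rin y z.
Proof. by rewrite rinDl rinNl. Qed.
Lemma rinBr x y z : rin x (y - z) = rin x y - rin x z.
Proof. by rewrite rinDr rinNr. Qed.
Lemma rin0l x : rin 0 x = 0. Proof. by rewrite /rin inner0l. Qed.
Lemma rin0r x : rin x 0 = 0. Proof. by rewrite /rin inner0r. Qed.
Lemma n2D x y : n2 (x + y) = n2 x + n2 y + 2 * rin x y.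
Proof. by rewrite /n2 rinDl !rinDr (rinC y x); ring. Qed.
Lemma n2N x : n2 (- x) = n2 x.
Proof. by rewrite /n2 rinNl rinNr opprK. Qed.
Lemma n2B x y : n2 (x - y) = n2 x + n2 y - 2 * rin x y.
Proof. by rewrite n2D n2N rinNr; ring. Qed.
Lemma n2ZR (r : R) x : n2 (r%:C *: x) = r ^+ 2 * n2 x.
Proof. by rewrite /n2 rinZl rinZr; ring. Qed.
Lemma n2D_le x y : n2 (x + y) <= 2 * (n2 x + n2 y).
Proof. by move: (n2_ge0 (x - y)); rewrite n2B n2D; lra. Qed.
Lemma rin_suml I (r : seq I) (P : pred I) (F : I -> V) y :
  rin (\sum_(i <- r | P i) F i) y = \sum_(i <- r | P i) rin (F i) y.
Proof. by rewrite /rin inner_suml Re_sum. Qed.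
Lemma rin_sumr I (r : seq I) (P : pred I) (F : I -> V) y :
  rin y (\sum_(i <- r | P i) F i) = \sum_(i <- r | P i) rin y (F i).
Proof. by rewrite /rin inner_sumr Re_sum. Qed.

Lemma rin_ext x y : (forall z, rin z x = rin z y) -> x = y.
Proof.
move=> h; apply/eqP; rewrite -subr_eq0; apply/eqP/n2_eq0.
by rewrite /n2 rinBr h subrr.
Qed.

Lemma Im_inner x y : complex.Im (inner x y) = rin x ('i *: y).
Proof.
rewrite /rin innerZr conjCi; case: (inner x y) => a b.
by rewrite -complexiE /=; ring.
Qed.

Lemma norm_leP x (M : R) : 0 <= M -> (`|x| <= M%:C) <-> (n2 x <= M ^+ 2).
Proof.
move=> M0; rewrite normE lecR; split => h.
  by rewrite -(sqr_sqrtr (n2_ge0 x)) ler_sqr// ?nnegrE ?sqrtr_ge0.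
by rewrite -(ger0_norm M0) -sqrtr_sqr ler_sqrt// exprn_ge0.
Qed.

Lemma rin_CS x y : rin x y ^+ 2 <= n2 x * n2 y.
Proof.
have [y0|y0] := eqVneq (n2 y) 0.
  by rewrite (n2_eq0 y0) rin0r n2_0 expr0n mulr0.
have yp : 0 < n2 y by rewrite lt_def y0 n2_ge0.
have := n2_ge0 (x - (rin x y / n2 y)%:C *: y).
rewrite n2B n2ZR rinZr => h.
have e : (rin x y / n2 y) ^+ 2 * n2 y = rin x y ^+ 2 / n2 y by field.
rewrite e in h.
have e2 : rin x y / n2 y * rin x y = rin x y ^+ 2 / n2 y by field.
rewrite e2 in h.
have : rin x y ^+ 2 / n2 y <= n2 x by lra.
by rewrite ler_pdivrMr.
Qed.

Lemma rin_le x y (a b : R) : 0 <= a -> 0 <= b -> n2 x <= a ^+ 2 -> n2 y <= b ^+ 2 ->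
  rin x y <= a * b.
Proof.
move=> a0 b0 xa yb.
apply: le_trans (ler_norm _) _.
rewrite -ler_sqr ?nnegrE ?mulr_ge0// real_normK ?num_real// exprMn.
by rewrite (le_trans (rin_CS x y))// ler_pM// n2_ge0.
Qed.

End Inner.

Lemma inner_rinP (R : realType) (U V : prehilbertType R) (x y : U) (x' y' : V) :
  (rin x y = rin x' y') -> (rin x ('i *: y) = rin x' ('i *: y')) ->
  inner x y = inner x' y'.
Proof. by move=> h1 h2; apply: complex_eq; rewrite ?Im_inner. Qed.


Section Bops.
Context {R : realType}.

Lemma bop_ext (U V : normedModType R[i]) (f g : bop U V) : f =1 g -> f = g.
Proof. by move=> fg; apply: val_inj; apply/funext. Qed.

Lemma opnorm_ge0 (U V : normedModType R[i]) (f : bop U V) : 0 <= opnorm f.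
Proof. by rewrite -lecR -bop_normE normr_ge0. Qed.

Lemma opnormD (U V : normedModType R[i]) (f g : bop U V) :
  opnorm (f + g) <= opnorm f + opnorm g.
Proof. by rewrite -lecR rmorphD/= -!bop_normE ler_normD. Qed.

Lemma opnormN (U V : normedModType R[i]) (f : bop U V) : opnorm (- f) = opnorm f.
Proof. by apply: complexI; rewrite -!bop_normE normrN. Qed.

Lemma opnorm0 (U V : normedModType R[i]) : opnorm (0 : bop U V) = 0.
Proof. by apply: complexI; rewrite -!bop_normE normr0. Qed.

Lemma opnorm_comp (U V W : normedModType R[i]) (g : bop V W) (f : bop U V) :
  opnorm (bop_comp g f) <= opnorm g * opnorm f.
Proof.
apply: opnorm_le; first by rewrite mulr_ge0 ?opnorm_ge0.
move=> x; rewrite /= (le_trans (le_opnorm _ _))// rmorphM/= -mulrA.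
by rewrite ler_wpM2l// ?le_opnorm// -bop_normE.
Qed.

Variables U V W : hilbertType R.
Implicit Types (f g : bop U V).

Lemma n2_bop f x : n2 (f x) <= opnorm f ^+ 2 * n2 x.
Proof.
have := le_opnorm f x; rewrite [X in _ * X]normE -rmorphM/=.
move/(norm_leP _ (mulr_ge0 (opnorm_ge0 f) (sqrtr_ge0 _))).
by rewrite exprMn sqr_sqrtr ?n2_ge0.
Qed.

Lemma opnorm_le_n2 f (c : R) : 0 <= c -> (forall x, n2 (f x) <= c ^+ 2 * n2 x) ->
  opnorm f <= c.
Proof.
move=> c0 h; apply: opnorm_le => // x; rewrite [X in _ * X]normE -rmorphM/=.
apply/norm_leP; first by rewrite mulr_ge0 ?sqrtr_ge0.
by rewrite exprMn sqr_sqrtr ?n2_ge0.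
Qed.

Lemma bop_exists (f : U -> V) (c : R) : linear f -> 0 <= c ->
  (forall x, n2 (f x) <= c ^+ 2 * n2 x) -> {T : bop U V | T =1 f}.
Proof.
move=> lf c0 h.
have fP : f \in @bounded_linear_map R U V.
  apply/asboolP; split => //; exists c => x.
  rewrite [X in _ * X]normE -rmorphM/=.
  apply/norm_leP; first by rewrite mulr_ge0 ?sqrtr_ge0.
  by rewrite exprMn sqr_sqrtr ?n2_ge0.
by exists (Bop fP).
Qed.

Lemma bopB f g x : (f - g) x = f x - g x. Proof. by []. Qed.
Lemma bop0 x : (0 : bop U V) x = 0. Proof. by []. Qed.
Lemma bop_sum I (r : seq I) (P : pred I) (F : I -> bop U V) x :
  (\sum_(i <- r | P i) F i) x = \sum_(i <- r | P i) F i x.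
Proof. by elim/big_rec2: _ => // i y1 y2 _ <-. Qed.

Lemma n2_bop1 f x : opnorm f <= 1 -> n2 (f x) <= n2 x.
Proof.
move=> f1; apply: le_trans (n2_bop f x) _; rewrite ler_piMl ?n2_ge0//.
by rewrite exprn_ile1// opnorm_ge0.
Qed.
End Bops.

Section CompAlg.
Context {R : realType} {U V W Z : hilbertType R}.
Lemma bop_compA (h : bop W Z) (g : bop V W) (f : bop U V) :
  bop_comp h (bop_comp g f) = bop_comp (bop_comp h g) f.
Proof. exact: bop_ext. Qed.
Lemma bop_comp1l (f : bop U V) : bop_comp (bop_id V) f = f.
Proof. exact: bop_ext. Qed.
Lemma bop_comp1r (f : bop U V) : bop_comp f (bop_id U) = f.
Proof. exact: bop_ext. Qed.
Lemma bop_compDl (g g' : bop V W) (f : bop U V) :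
  bop_comp (g + g') f = bop_comp g f + bop_comp g' f.
Proof. exact: bop_ext. Qed.
Lemma bop_compDr (g : bop V W) (f f' : bop U V) :
  bop_comp g (f + f') = bop_comp g f + bop_comp g f'.
Proof. by apply: bop_ext => x; rewrite /= !linearD. Qed.
Lemma bop_compNr (g : bop V W) (f : bop U V) : bop_comp g (- f) = - bop_comp g f.
Proof. by apply: bop_ext => x; rewrite /= !linearN. Qed.
Lemma bop_compBl (g g' : bop V W) (f : bop U V) :
  bop_comp (g - g') f = bop_comp g f - bop_comp g' f.
Proof. exact: bop_ext. Qed.
Lemma bop_compBr (g : bop V W) (f f' : bop U V) :
  bop_comp g (f - f') = bop_comp g f - bop_comp g f'.
Proof. by rewrite bop_compDr bop_compNr. Qed.
Lemma bop_comp0l (f : bop U V) : bop_comp (0 : bop V W) f = 0.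
Proof. exact: bop_ext. Qed.
Lemma bop_comp0r (g : bop V W) : bop_comp g (0 : bop U V) = 0.
Proof. by apply: bop_ext => x; rewrite /= linear0. Qed.
Lemma bop_comp_suml I (r : seq I) (P : pred I) (F : I -> bop V W) (f : bop U V) :
  bop_comp (\sum_(i <- r | P i) F i) f = \sum_(i <- r | P i) bop_comp (F i) f.
Proof. by apply: (big_morph (fun g => bop_comp g f)) => [? ?|]; rewrite ?bop_compDl ?bop_comp0l. Qed.
Lemma bop_comp_sumr I (r : seq I) (P : pred I) (F : I -> bop U V) (g : bop V W) :
  bop_comp g (\sum_(i <- r | P i) F i) = \sum_(i <- r | P i) bop_comp g (F i).
Proof. by apply: (big_morph (fun f => bop_comp g f)) => [? ?|]; rewrite ?bop_compDr ?bop_comp0r. Qed.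
End CompAlg.

(** * Convergence and adjoints *)

Section Convergence.
Context {R : realType}.

Lemma norm_ltP (V : prehilbertType R) (x : V) (M : R) : 0 <= M ->
  (`|x| < M%:C) <-> (n2 x < M ^+ 2).
Proof.
move=> M0; rewrite normE ltcR; split => h.
  by rewrite -(sqr_sqrtr (n2_ge0 x)) ltr_sqr// ?nnegrE ?sqrtr_ge0.
rewrite -(ger0_norm M0) -sqrtr_sqr ltr_sqrt//.
exact: le_lt_trans (n2_ge0 x) h.
Qed.

Lemma gt0_complex (e : R[i]) : 0 < e -> exists2 r : R, 0 < r & e = r%:C.
Proof.
move=> e0; have ee := ge0_Re (ltW e0).
by exists (complex.Re e) => //; rewrite -ltcR -ee.
Qed.

(** Trades the [R[i]]-valued norm for a real sequence, to which squeezing applies without square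
    roots. *)
Lemma cvg_n2 (V : prehilbertType R) (T : Type) (F : set_system T) {FF : Filter F}
  (u : T -> V) (l : V) :
  u @ F --> l <-> (fun k => n2 (u k - l)) @ F --> (0 : R).
Proof.
split.
  move=> /cvgrPdist_lt ul; apply/cvgrPdist_lt => e e0.
  have s0 : 0 < (Num.sqrt e)%:C by rewrite ltcR sqrtr_gt0.
  apply: filterS (ul _ s0) => k /(norm_ltP _ (sqrtr_ge0 _)).
  by rewrite sqr_sqrtr ?ltW// sub0r normrN ger0_norm ?n2_ge0// -n2N opprB.
move=> /cvgrPdist_lt ul; apply/cvgrPdist_lt => e /gt0_complex[r r0 ->].
have s0 : 0 < r ^+ 2 by rewrite exprn_gt0.
apply: filterS (ul _ s0) => k.
rewrite sub0r normrN ger0_norm ?n2_ge0// => h.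
by apply/(norm_ltP _ (ltW r0)); rewrite -n2N opprB.
Qed.

Lemma squeeze0 (T : Type) (F : set_system T) {FF : Filter F} (d e : T -> R) (c : R) :
  d @ F --> 0 -> (\forall k \near F, 0 <= e k <= c * d k) -> e @ F --> 0.
Proof.
move=> d0 h.
have cd : (fun k => c * d k) @ F --> 0.
  by rewrite -[X in _ --> X](mulr0 c); apply: cvgM => //; exact: cvg_cst.
exact: (squeeze_cvgr h (cvg_cst _) cd).
Qed.

(** Cauchy-Schwarz bounds squares of real parts, hence a criterion on squares. *)
Lemma sq_cvg (T : Type) (F : set_system T) {FF : Filter F} (d a : T -> R) (l c : R) :
  d @ F --> 0 -> (\forall k \near F, (a k - l) ^+ 2 <= c * d k) -> a @ F --> l.
Proof.
move=> d0 h.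
have : (fun k => (a k - l) ^+ 2) @ F --> (0:R).
  by apply: (squeeze0 d0 (c := c)); apply: filterS h => k ->; rewrite sqr_ge0.
move=> /cvgrPdist_lt sl; apply/cvgrPdist_lt => e e0.
have s0 : 0 < e ^+ 2 by rewrite exprn_gt0.
apply: filterS (sl _ s0) => k.
rewrite sub0r normrN ger0_norm ?sqr_ge0// => h2.
by rewrite distrC ltr_norml; apply/andP; split; nra.
Qed.

Lemma rin_cvg (V : prehilbertType R) (T : Type) (F : set_system T) {FF : Filter F}
  (u : T -> V) (l y : V) : u @ F --> l -> (fun k => rin (u k) y) @ F --> rin l y.
Proof.
move=> /cvg_n2 ul; apply: (sq_cvg ul (c := n2 y)); apply: nearW => k.
by rewrite -rinBl (le_trans (rin_CS _ _))// mulrC.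
Qed.

Lemma n2_cvg (V : prehilbertType R) (T : Type) (F : set_system T) {FF : Filter F}
  (u : T -> V) (l : V) : u @ F --> l -> (fun k => n2 (u k)) @ F --> n2 l.
Proof.
move=> ul.
have -> : (fun k => n2 (u k)) = (fun k => n2 (u k - l) + 2 * rin (u k) l - n2 l).
  by apply/funext => k; rewrite n2B; ring.
have e : n2 l = 0 + 2 * rin l l - n2 l by rewrite /n2; ring.
rewrite [X in _ --> X]e; apply: cvgB; last exact: cvg_cst.
apply: cvgD; first exact/cvg_n2.
by apply: cvgM; [exact: cvg_cst|exact: rin_cvg].
Qed.

Lemma bop_cvg (U V : hilbertType R) (f : bop U V) (T : Type) (F : set_system T)
  {FF : Filter F} (u : T -> U) (l : U) : u @ F --> l -> (fun k => f (u k)) @ F --> f l.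
Proof.
move=> /cvg_n2 ul; apply/cvg_n2; apply: (squeeze0 ul (c := opnorm f ^+ 2)).
by apply: nearW => k; rewrite -linearB n2_ge0 n2_bop.
Qed.

Lemma n2_lim_le (V : prehilbertType R) (T : Type) (F : set_system T)
  {FF : ProperFilter F} (u : T -> V) (l : V) (c : R) :
  u @ F --> l -> (\forall k \near F, n2 (u k) <= c) -> n2 l <= c.
Proof. by move=> /n2_cvg ul h; exact: (cvgr_to_le ul h). Qed.

Lemma cvg_uniq (K : numFieldType) (V : normedModType K) (T : Type) (F : set_system T)
  {FF : ProperFilter F} (u : T -> V) (l l' : V) :
  u @ F --> l -> u @ F --> l' -> l = l'.
Proof.
move=> h h'; apply: (@close_eq _ _ l l').
  exact: norm_hausdorff.
by apply: (@cvg_close _ (u @ F)).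
Qed.

Lemma cvg_bigsum (K : numFieldType) (V : pseudoMetricNormedZmodType K) (T : Type)
  (F : set_system T) {FF : Filter F} (I : Type) (r : seq I) (f : I -> T -> V) (l : I -> V) :
  (forall i, f i @ F --> l i) ->
  (fun k => \sum_(i <- r) f i k) @ F --> \sum_(i <- r) l i.
Proof.
move=> fl; elim: r => [|i r IH].
  rewrite big_nil; have -> : (fun k => \sum_(i <- [::]) f i k) = (fun=> 0).
    by apply/funext => k; rewrite big_nil.
  exact: cvg_cst.
rewrite big_cons.
have -> : (fun k => \sum_(j <- i :: r) f j k) = (fun k => f i k + \sum_(j <- r) f j k).
  by apply/funext => k; rewrite big_cons.
by apply: cvgD.
Qed.

(** Since [d] is evaluated at the smaller index, [u m] can be the centre of a ball containing the
    whole tail. *)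
Lemma cauchy_cvgn (V : hilbertType R) (u : nat -> V) (d : nat -> R) :
  d @ \oo --> (0 : R) ->
  (forall m k, (m <= k)%N -> n2 (u k - u m) <= d m) -> exists l : V, u @ \oo --> l.
Proof.
move=> d0 h; apply/cvg_ex; apply: cauchy_cvg.
apply/cauchyP => _ /gt0_complex[r r0 ->].
have s0 : 0 < r ^+ 2 by rewrite exprn_gt0.
move/cvgrPdist_lt : d0 => /(_ _ s0) [m _ mP].
exists (u m); exists m => // k /= mk.
rewrite -ball_normE /=; apply/norm_ltP; first exact: ltW.
rewrite -n2N opprB; apply: le_lt_trans (h _ _ mk) _.
have := mP m (leqnn m); rewrite /= sub0r normrN; exact: le_lt_trans (ler_norm _).
Qed.

Lemma cvg_invS (c : R) : (fun k => c / k.+1%:R) @ \oo --> (0 : R).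
Proof.
rewrite -[X in _ --> X](mulr0 c); apply: cvgM; first exact: cvg_cst.
exact: cvg_harmonic.
Qed.
End Convergence.

Section Riesz.
Context {R : realType}.

Lemma rin_i (V : prehilbertType R) (x y : V) : rin x ('i *: y) = - rin ('i *: x) y.
Proof.
by rewrite -Im_inner /rin innerZl; case: (inner x y) => a b; rewrite -complexiE /=; ring.
Qed.

(** The representing vector minimises [J x = |x|^2 - 2 phi x]. The parallelogram law makes
    minimising sequences Cauchy, so a minimiser exists, and the vanishing of the first variation
    there is the claim. *)
Lemma riesz_real (V : hilbertType R) (phi : V -> R) (c : R) :
  0 <= c -> (forall x y, phi (x + y) = phi x + phi y) ->
  (forall (t : R) x, phi (t%:C *: x) = t * phi x) ->
  (forall x, phi x ^+ 2 <= c * n2 x) ->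
  exists z, forall x, phi x = rin x z.
Proof.
move=> c0 phiD phiZ phic.
pose J x := n2 x - 2 * phi x.
have phiB x y : phi (x - y) = phi x - phi y.
  have -> : x - y = x + (-1)%:C *: y by rewrite rmorphN rmorph1 scaleN1r.
  by rewrite phiD phiZ mulN1r.
have Jlb x : - c <= J x.
  have := phic x; rewrite /J; have := n2_ge0 x; move: (n2 x) (phi x) => a b.
  (* Otherwise [a + c < 2 b], hence [(a + c)^2 < 4 b^2 <= 4 c a], against [(a - c)^2 >= 0]. *)
  move=> a0 h; rewrite lerNl opprB leNgt; apply/negP => h2.
  have := sqr_ge0 (a - c); nra.
have Jinf : has_inf (range J).
  by split; [exists (J 0), 0|exists (- c) => _ [x _ <-]].
pose m := inf (range J).
have Jm x : m <= J x by apply: ge_inf; [exact: Jinf.2|exists x].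
have seqx k : exists x, J x < m + k.+1%:R^-1.
  have e0 : 0 < k.+1%:R^-1 :> R by rewrite invr_gt0 ltr0n.
  by have [_ [x _ <-] ?] := inf_adherent e0 Jinf; exists x.
have [u uP] := choice seqx.
(* The parallelogram law reads [n2 (x - y) = 2 J x + 2 J y - 4 J ((x + y) / 2)], and [J] at the
   midpoint is at least [m]. *)
have mid x y : n2 (x - y) <= 2 * (J x - m) + 2 * (J y - m).
  have := Jm (2^-1%:C *: (x + y)); rewrite /J n2ZR phiZ n2D phiD n2B => h.
  have : m <= 4^-1 * (n2 x + n2 y + 2 * rin x y) - (phi x + phi y).
    by apply: le_trans h _; lra.
  by lra.
have [z uz] : exists z : V, u @ \oo --> z.
  apply: (@cauchy_cvgn _ _ u (fun k => 4 / k.+1%:R)); first exact: cvg_invS.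
  move=> i k ik; apply: le_trans (mid _ _) _.
  have := uP k; have := uP i.
  have : k.+1%:R^-1 <= i.+1%:R^-1 :> R by rewrite lef_pV2 ?posrE ?ltr0n// ler_nat.
  by move: (k.+1%:R^-1) (i.+1%:R^-1) => a b; lra.
have Jz : J z <= m.
  have h1 : (fun k => J (u k)) @ \oo --> J z.
    apply: cvgB; first exact: n2_cvg.
    apply: cvgM; first exact: cvg_cst.
    move/cvg_n2 : uz => uz; apply: (sq_cvg uz (c := c)); apply: nearW => k.
    by rewrite -phiB.
  have h2 : (fun k => m + k.+1%:R^-1) @ \oo --> m.
    rewrite -[X in _ --> X]addr0; apply: cvgD; first exact: cvg_cst.
    exact: cvg_harmonic.
  apply: (ler_cvg_to h1 h2); apply: nearW => k; exact/ltW/uP.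
exists z => x.
have key t : 0 <= t ^+ 2 * n2 x + 2 * t * (rin x z - phi x).
  have := le_trans Jz (Jm (z + t%:C *: x)).
  by rewrite /J n2D n2ZR rinZr phiD phiZ (rinC z); lra.
apply/eqP; rewrite eq_sym -subr_eq0; apply/eqP.
move: key; have := n2_ge0 x; move: (n2 x) (rin x z - phi x) => a b a0 key.
have a1 : 0 < a + 1 by lra.
(* The optimal [t] is [- b / a]; the denominator [a + 1] avoids the case [a = 0] and still gives a
   negative multiple of [b ^+ 2]. *)
have := key (- b / (a + 1)).
have -> : (- b / (a + 1)) ^+ 2 * a + 2 * (- b / (a + 1)) * b =
  - (b ^+ 2 * ((a + 2) / (a + 1) ^+ 2)) by field; lra.
rewrite oppr_ge0 => h.
have p : 0 < (a + 2) / (a + 1) ^+ 2 by rewrite divr_gt0 ?exprn_gt0//; lra.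
rewrite pmulr_lle0// in h.
by apply/eqP; rewrite -sqrf_eq0 eq_le h sqr_ge0.
Qed.

(** The real Riesz vector of [x |-> rin (T x) y] already represents the complex form, because a
    factor ['i] can be moved to the first argument, where [T] is linear. *)
Lemma adj_exists (U V : hilbertType R) (T : bop U V) :
  exists S : bop V U, forall x y, inner (T x) y = inner x (S y).
Proof.
have /choice[s sP] y : exists z, forall x, rin (T x) y = rin x z.
  apply: (@riesz_real _ _ (opnorm T ^+ 2 * n2 y)).
  - by rewrite mulr_ge0 ?n2_ge0// exprn_ge0// opnorm_ge0.
  - by move=> x x'; rewrite linearD rinDl.
  - by move=> t x; rewrite linearZ rinZl.
  - move=> x; rewrite (le_trans (rin_CS _ _))// mulrAC ler_wpM2r ?n2_ge0//.
    exact: n2_bop.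
have sI x y : inner (T x) y = inner x (s y).
  by apply: inner_rinP => //; rewrite !rin_i -linearZ/= sP.
have sl : linear s.
  move=> a y y'; apply: rin_ext => x; congr complex.Re.
  by rewrite -sI innerDr innerZr !sI innerDr innerZr.
suff sb y : n2 (s y) <= opnorm T ^+ 2 * n2 y.
  have [S SE] := bop_exists sl (opnorm_ge0 T) sb.
  by exists S => x y; rewrite SE.
have h : n2 (s y) ^+ 2 <= (opnorm T ^+ 2 * n2 y) * n2 (s y).
  rewrite {1}/n2 -sP (le_trans (rin_CS _ _))// mulrAC ler_wpM2r ?n2_ge0//.
  exact: n2_bop.
have [s0|s0] := eqVneq (n2 (s y)) 0.
  by rewrite s0 mulr_ge0 ?n2_ge0// exprn_ge0// opnorm_ge0.
by move: h; rewrite expr2 ler_pM2r// lt_def s0 n2_ge0.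
Qed.

Lemma adjE (U V : hilbertType R) (T : bop U V) x y : inner (T x) y = inner x (adj T y).
Proof.
move: x y; rewrite /adj; case: xgetP => [S _ //|h].
by have [S SP] := adj_exists T; have := h S.
Qed.

Lemma rin_adj (U V : hilbertType R) (T : bop U V) x y : rin (T x) y = rin x (adj T y).
Proof. by rewrite /rin adjE. Qed.

Lemma n2_adj (U V : hilbertType R) (T : bop U V) (c : R) : 0 <= c ->
  (forall x, n2 (T x) <= c * n2 x) -> forall y, n2 (adj T y) <= c * n2 y.
Proof.
move=> c0 h y.
have k : n2 (adj T y) ^+ 2 <= (c * n2 y) * n2 (adj T y).
  rewrite {1}/n2 -rin_adj (le_trans (rin_CS _ _))// mulrAC ler_wpM2r ?n2_ge0//.
have [s0|s0] := eqVneq (n2 (adj T y)) 0.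
  by rewrite s0 mulr_ge0 ?n2_ge0.
by move: k; rewrite expr2 ler_pM2r// lt_def s0 n2_ge0.
Qed.

End Riesz.

(** * Tensor products of operators *)

Section PositiveForms.
Context {R : realType}.

(** Positivity is kept at the level of forms so that a defect such as [c - F^* F] can be tensored
    without taking its square root. *)
Definition psd (V : lmodType R[i]) (p : V -> V -> R[i]) :=
  [/\ forall a x y z, p (a *: x + y) z = a * p x z + p y z,
      forall x y, p x y = Num.conj (p y x) & forall x, 0 <= p x x].

(** The value of the tensor product of the forms [p] and [q] at the formal sum of the elementary
    tensors listed in [s], paired with itself. *)
Definition gsum (V W : lmodType R[i]) (p : V -> V -> R[i]) (q : W -> W -> R[i])
  (s : seq (V * W)) : R[i] := \sum_(x <- s) \sum_(y <- s) p x.1 y.1 * q x.2 y.2.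

Section PsdTheory.
Variables (V : lmodType R[i]) (p : V -> V -> R[i]).
Hypothesis p_psd : psd p.

Lemma psdPl a x y z : p (a *: x + y) z = a * p x z + p y z.
Proof. by have [h _ _] := p_psd. Qed.
Lemma psdC x y : p x y = Num.conj (p y x).
Proof. by have [_ h _] := p_psd. Qed.
Lemma psd_ge0 x : 0 <= p x x.
Proof. by have [_ _ h] := p_psd. Qed.
Lemma psd0l x : p 0 x = 0.
Proof.
have := psdPl 1 0 0 x; rewrite scale1r addr0 mul1r => /eqP.
by rewrite -subr_eq0 opprD addNKr oppr_eq0 => /eqP.
Qed.
Lemma psdDl x y z : p (x + y) z = p x z + p y z.
Proof. by rewrite -[x]scale1r psdPl mul1r scale1r. Qed.
Lemma psdZl a x z : p (a *: x) z = a * p x z.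
Proof. by rewrite -[a *: x]addr0 psdPl psd0l addr0. Qed.
Lemma psdDr x y z : p z (x + y) = p z x + p z y.
Proof. by rewrite psdC psdDl rmorphD (psdC z x) (psdC z y). Qed.
Lemma psdZr a x z : p z (a *: x) = Num.conj a * p z x.
Proof. by rewrite psdC psdZl rmorphM (psdC z x). Qed.
Lemma psd_suml I (r : seq I) (F : I -> V) z :
  p (\sum_(i <- r) F i) z = \sum_(i <- r) p (F i) z.
Proof. by apply: (big_morph (fun x => p x z)) => [? ?|]; rewrite ?psdDl ?psd0l. Qed.
Lemma psd_sumr I (r : seq I) (F : I -> V) z :
  p z (\sum_(i <- r) F i) = \sum_(i <- r) p z (F i).
Proof.
by rewrite psdC psd_suml rmorph_sum; apply: eq_bigr => i _; rewrite (psdC z).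
Qed.

(** Degenerate Cauchy-Schwarz: with [p x x = 0], moving [y] along [x] changes [p y y] affinely,
    which stays nonnegative only if the slope vanishes. *)
Lemma psd_null x y : p x x = 0 -> p y x = 0.
Proof.
move=> x0; apply/eqP; apply: contraT => n0.
have key (t : R) : 0 <= p y y - (2 * t)%:C * (p y x * Num.conj (p y x)).
  have := psd_ge0 (y + (- t%:C * p y x) *: x).
  rewrite psdDl !psdDr !psdZl !psdZr x0 !mulr0 addr0 (psdC x y) rmorphM rmorphN /=.
  by rewrite conj_real rmorphM /= => h; apply: le_trans h _; rewrite le_eqVlt; apply/orP; left; apply/eqP; ring.
rewrite -normCK in key.
have np : 0 < `|p y x| ^+ 2 by rewrite exprn_gt0// normr_gt0.
have [r r0 re] := gt0_complex np.
have yy := ge0_Re (psd_ge0 y).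
(* [t] is tuned so that the subtracted term is [p y y + 1]. *)
have := key ((complex.Re (p y y) + 1) / (2 * r)).
rewrite re yy -rmorphM -rmorphB /= lecR.
have -> : 2 * ((complex.Re (p y y) + 1) / (2 * r)) * r = complex.Re (p y y) + 1.
  by field; rewrite gt_eqF.
by rewrite opprD addNKr oppr_ge0 ler10.
Qed.
End PsdTheory.

Lemma gsum_cons0 (V W : lmodType R[i]) p (q : W -> W -> R[i]) (z : V * W) s :
  psd p -> (forall y, p z.1 y = 0) -> gsum p q (z :: s) = gsum p q s.
Proof.
move=> pp z0; rewrite /gsum big_cons big1 ?add0r; last by move=> y _; rewrite z0 mul0r.
by apply: eq_bigr => x _; rewrite big_cons (psdC pp) z0 rmorph0 mul0r add0r.
Qed.

(* Schur product theorem for Gram matrices, by Gaussian elimination on [p]. *)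
Lemma gsum_ge0 (V W : lmodType R[i]) (p : V -> V -> R[i]) (q : W -> W -> R[i]) s :
  psd p -> psd q -> 0 <= gsum p q s.
Proof.
move=> pp qq; have [k] := ubnP (size s); elim: k s => // k IH [|x0 s] /= sk.
  by rewrite /gsum big_nil.
have [p0|p0] := eqVneq (p x0.1 x0.1) 0.
  rewrite gsum_cons0 ?IH// => y.
  by rewrite (psdC pp) (psd_null pp y p0) rmorph0.
pose c x := p x x0.1 / p x0.1 x0.1.
pose f (x : V * W) := (x.1 - c x.1 *: x0.1, x.2).
have pc : Num.conj (p x0.1 x0.1) = p x0.1 x0.1 by rewrite -(psdC pp).
have fE x y : p x y = p (x - c x *: x0.1) (y - c y *: x0.1) +
    p x0.1 x0.1 * (c x * Num.conj (c y)).
  rewrite -(scaleNr (c x)) -(scaleNr (c y)) !(psdDl pp, psdDr pp, psdZl pp, psdZr pp) (rmorphN _ (c y)) /c !rmorphM !fmorphV /=.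
  by rewrite pc (psdC pp x0.1 y); field.
(* The rank one part of [p] splits off and contributes [p x0 x0] times one value of [q]; in what
   remains the pivot is null and drops out, so the list gets shorter. *)
have -> : gsum p q (x0 :: s) = gsum p q (map f (x0 :: s)) +
    p x0.1 x0.1 * q (\sum_(x <- x0 :: s) c x.1 *: x.2) (\sum_(x <- x0 :: s) c x.1 *: x.2).
  rewrite (psd_suml qq) mulr_sumr /gsum big_map -big_split; apply: eq_bigr => x _.
  rewrite (psd_sumr qq) mulr_sumr big_map -big_split; apply: eq_bigr => y _ /=.
  by rewrite (psdZl qq) (psdZr qq) {1}fE; ring.
rewrite addr_ge0 ?mulr_ge0 ?psd_ge0//.
rewrite [map _ _]/= gsum_cons0 ?IH ?size_map// => y.
by rewrite /= /c divff// scale1r subrr psd0l.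
Qed.
End PositiveForms.

Section DefectForms.
Context {R : realType}.
Implicit Types V W : hilbertType R.

Definition pullback V W (F : bop V W) (x y : V) : R[i] := inner (F x) (F y).
Definition defect V W (F : bop V W) (c : R) (x y : V) : R[i] :=
  c%:C * inner x y - inner (F x) (F y).

Lemma psd_inner V : psd (@inner R V).
Proof.
split=> [a x y z|x y|x]; first by rewrite innerDl innerZl.
  exact: inner_conj.
exact: dnorm_ge0.
Qed.

Lemma psd_pullback V W (F : bop V W) : psd (pullback F).
Proof.
split=> [a x y z|x y|x]; rewrite /pullback; first by rewrite linearP innerDl innerZl.
  exact: inner_conj.
exact: dnorm_ge0.
Qed.

Lemma psd_defect V W (F : bop V W) c : (forall x, n2 (F x) <= c * n2 x) ->
  psd (defect F c).
Proof.
move=> Fc; split=> [a x y z|x y|x]; rewrite /defect.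
- by rewrite linearP !innerDl !innerZl; ring.
- by rewrite rmorphB rmorphM /= conj_real -!inner_conj.
- by rewrite !n2C -rmorphM -rmorphB /= ler0c subr_ge0.
Qed.

Lemma gsum_defectl V W V' (F : bop V W) c (q : V' -> V' -> R[i]) s :
  gsum (defect F c) q s = c%:C * gsum (@inner R V) q s - gsum (pullback F) q s.
Proof.
rewrite /gsum mulr_sumr -sumrB; apply: eq_bigr => x _.
rewrite mulr_sumr -sumrB; apply: eq_bigr => y _.
by rewrite /defect /pullback; ring.
Qed.

Lemma gsum_defectr V W V' (F : bop V W) c (p : V' -> V' -> R[i]) s :
  gsum p (defect F c) s = c%:C * gsum p (@inner R V) s - gsum p (pullback F) s.
Proof.
rewrite /gsum mulr_sumr -sumrB; apply: eq_bigr => x _.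
rewrite mulr_sumr -sumrB; apply: eq_bigr => y _.
by rewrite /defect /pullback; ring.
Qed.
End DefectForms.

Section GraphExtension.
Context {R : realType} {U V : hilbertType R}.

Lemma cvg_seq_exists (u : U) (P : U -> V -> Prop) :
  (forall e : R, 0 < e -> exists u' v', P u' v' /\ n2 (u - u') < e) ->
  exists (a : nat -> U) (b : nat -> V), (forall k, P (a k) (b k)) /\
    (forall k, n2 (u - a k) <= k.+1%:R^-1) /\ a @ \oo --> u.
Proof.
move=> h.
have [ab abP] := choice (fun k : nat => (fun e0 => let: ex_intro u' (ex_intro v' H) := h _ e0 in
  ex_intro (fun w : U * V => P w.1 w.2 /\ n2 (u - w.1) < k.+1%:R^-1) (u', v') H)
  (ltac:(by rewrite invr_gt0 ltr0n) : 0 < k.+1%:R^-1 :> R)).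
exists (fun k => (ab k).1), (fun k => (ab k).2); split; first by move=> k; have [] := abP k.
have le1 k : n2 (u - (ab k).1) <= k.+1%:R^-1 by have [_ /ltW] := abP k.
split => //; apply/cvg_n2; apply: (squeeze0 (cvg_invS 1) (c := 1)).
by apply: nearW => k; rewrite n2_ge0 !mul1r -n2N opprB le1.
Qed.

(** A graph rather than a function: on sums of elementary tensors a value is only known through a
    chosen representation. Applied to differences, the bound makes the closure of the graph
    single-valued, and density with completeness makes it total. *)
Lemma graph_extension (G : U -> V -> Prop) (c : R) : 0 <= c ->
  (forall a u v u' v', G u v -> G u' v' -> G (a *: u + u') (a *: v + v')) ->
  (forall u v, G u v -> n2 v <= c ^+ 2 * n2 u) ->
  (forall u (e : R), 0 < e -> exists u' v', G u' v' /\ n2 (u - u') < e) ->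
  exists T : bop U V, (forall u v, G u v -> T u = v) /\
    (forall u, n2 (T u) <= c ^+ 2 * n2 u).
Proof.
move=> c0 Glin Gbd Gdense.
pose Rel (u : U) (v : V) := exists (a : nat -> U) (b : nat -> V),
  [/\ forall k, G (a k) (b k), a @ \oo --> u & b @ \oo --> v].
have GB u v u' v' : G u v -> G u' v' -> G (u - u') (v - v').
  by move=> h h'; have := Glin (-1) _ _ _ _ h' h; rewrite !scaleN1r ![- _ + _]addrC.
have Rlin t u v u' v' : Rel u v -> Rel u' v' -> Rel (t *: u + u') (t *: v + v').
  move=> [a [b [Gab au bv]]] [a' [b' [Gab' au' bv']]].
  exists (fun k => t *: a k + a' k), (fun k => t *: b k + b' k).
  split; first by move=> k; exact: Glin.
    by apply: cvgD => //; apply: cvgZr.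
  by apply: cvgD => //; apply: cvgZr.
have Rbd u v : Rel u v -> n2 v <= c ^+ 2 * n2 u.
  move=> [a [b [Gab au bv]]].
  have h1 : (fun k => n2 (b k)) @ \oo --> n2 v by exact: n2_cvg.
  have h2 : (fun k => c ^+ 2 * n2 (a k)) @ \oo --> c ^+ 2 * n2 u.
    by apply: cvgM; [exact: cvg_cst|exact: n2_cvg].
  by apply: (ler_cvg_to h1 h2); apply: nearW => k; exact: Gbd.
have Rfun u v v' : Rel u v -> Rel u v' -> v = v'.
  move=> h h'; have /Rbd := Rlin (-1) _ _ _ _ h' h.
  rewrite !scaleN1r addNr n2_0 mulr0 => h0; apply/eqP; rewrite -subr_eq0 addrC.
  by apply/eqP/n2_eq0/eqP; rewrite eq_le h0 n2_ge0.
have Gtot u : exists v, Rel u v.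
  have [a [b [Gab [ale au]]]] := cvg_seq_exists (Gdense u).
  have [v bv] : exists v : V, b @ \oo --> v.
    (* [n2 (a k - a m)] is at most [2 (1 / (k + 1) + 1 / (m + 1))], hence at most [4 / (m + 1)]. *)
    apply: (@cauchy_cvgn _ _ b (fun k => (4 * c ^+ 2) / k.+1%:R)); first exact: cvg_invS.
    move=> m k mk; apply: le_trans (Gbd _ _ (GB _ _ _ _ (Gab k) (Gab m))) _.
    have -> : a k - a m = (u - a m) + - (u - a k) by rewrite opprB [RHS]addrC addrA subrK.
    have := n2D_le (u - a m) (- (u - a k)); rewrite n2N.
    have := ale m; have := ale k.
    have : k.+1%:R^-1 <= m.+1%:R^-1 :> R by rewrite lef_pV2 ?posrE ?ltr0n// ler_nat.
    have : 0 <= c ^+ 2 by rewrite exprn_ge0.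
    by move: (n2 _) (n2 _) (n2 _) (k.+1%:R^-1) (m.+1%:R^-1) => x y z s t; nra.
  by exists v, a, b.
have [f fP] := choice Gtot.
have fl : linear f.
  by move=> t u u'; apply: (Rfun (t *: u + u')) => //; apply: Rlin.
have [T TE] := bop_exists fl c0 (fun u => Rbd _ _ (fP u)).
exists T; split; last by move=> u; rewrite TE; exact: Rbd.
move=> u v Guv; rewrite TE; apply: (Rfun u) => //.
by exists (fun=> u), (fun=> v); split => //; exact: cvg_cst.
Qed.
End GraphExtension.

Section TensorSums.
Context {R : realType} {E H : hilbertType R} (EH : hilbert_tensor E H).

Definition tsum (s : seq (E * H)) : EH := \sum_(x <- s) tens EH x.1 x.2.

Lemma inner_tsum s : inner (tsum s) (tsum s) = gsum (@inner R E) (@inner R H) s.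
Proof.
rewrite /tsum inner_suml; apply: eq_bigr => x _.
by rewrite inner_sumr; apply: eq_bigr => y _; rewrite inner_tens.
Qed.

Lemma tsum_dense (u : EH) (e : R) : 0 < e -> exists s, n2 (u - tsum s) < e.
Proof.
move=> e0; have s0 : 0 < (Num.sqrt e)%:C by rewrite ltcR sqrtr_gt0.
have := @dense_tens _ _ _ EH (ball u (Num.sqrt e)%:C).
case.
- by exists u; exact: ballxx.
- exact: ball_open.
move=> v [+ [k [a [b vE]]]]; rewrite -ball_normE /= => /(norm_ltP _ (sqrtr_ge0 _)).
rewrite sqr_sqrtr ?ltW// => h.
exists [seq (a i, b i) | i <- index_enum 'I_k].
by rewrite /tsum big_map -vE.
Qed.

Lemma tsum_seq (u : EH) : exists s : nat -> seq (E * H), (fun k => tsum (s k)) @ \oo --> u.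
Proof.
(* The second component is a dummy; only the approximating vectors matter. *)
have [a [b [aP [_ au]]]] := @cvg_seq_exists _ EH EH u (fun u' _ => exists s, u' = tsum s)
  (fun e e0 => let: ex_intro s h := tsum_dense u e0 in
   ex_intro _ (tsum s) (ex_intro _ 0 (conj (ex_intro _ s erefl) h))).
have [s sP] := choice aP; exists s.
by have -> : (fun k => tsum (s k)) = a by apply/funext.
Qed.

Lemma bop_tens_ext (V : hilbertType R) (S T : bop EH V) :
  (forall e h, S (tens EH e h) = T (tens EH e h)) -> S = T.
Proof.
move=> ST; apply: bop_ext => u; have [s su] := tsum_seq u.
apply: (cvg_uniq (F := \oo) (u := fun k => S (tsum (s k)))); first exact: bop_cvg.
have -> : (fun k => S (tsum (s k))) = (fun k => T (tsum (s k))).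
  by apply/funext => k; rewrite /tsum !raddf_sum; apply: eq_bigr => x _; exact: ST.
exact: bop_cvg.
Qed.
End TensorSums.

Section OtensExists.
Context {R : realType} {E H Y K : hilbertType R}.
Variables (EH : hilbert_tensor E H) (YK : hilbert_tensor Y K).

Definition tmap (A : bop E Y) (X : bop H K) (s : seq (E * H)) : seq (Y * K) :=
  [seq (A x.1, X x.2) | x <- s].

Lemma inner_tmap A X s : inner (tsum YK (tmap A X s)) (tsum YK (tmap A X s)) =
  gsum (pullback A) (pullback X) s.
Proof.
rewrite inner_tsum /gsum /tmap big_map; apply: eq_bigr => x _.
by rewrite big_map.
Qed.

(** With [a] and [b] the norms of [A] and [X], the defect [a^2 b^2 - A^* A (x) X^* X] is the sum of
    [b^2 (a^2 - A^* A) (x) I] and [A^* A (x) (b^2 - X^* X)], both nonnegative by the Schur product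
    theorem. *)
Lemma n2_tmap A X s :
  n2 (tsum YK (tmap A X s)) <= (opnorm A * opnorm X) ^+ 2 * n2 (tsum EH s).
Proof.
have := gsum_ge0 s (psd_defect (n2_bop A)) (@psd_inner _ H).
have := gsum_ge0 s (psd_pullback A) (psd_defect (n2_bop X)).
rewrite gsum_defectr gsum_defectl -inner_tmap -(inner_tsum EH) !n2C.
have := gsum_ge0 s (psd_pullback A) (@psd_inner _ H).
move=> /ge0_Re ->; move: (complex.Re _) => m.
rewrite -!rmorphM -!rmorphB /= !ler0c => h1 h2.
have : 0 <= opnorm X ^+ 2 by rewrite exprn_ge0 ?opnorm_ge0.
by move: h1 h2; rewrite exprMn; nra.
Qed.

Lemma otens_spec (A : bop E Y) (X : bop H K) : exists T : bop EH YK,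
  (forall e h, T (tens EH e h) = tens YK (A e) (X h)) /\
  forall u, n2 (T u) <= (opnorm A * opnorm X) ^+ 2 * n2 u.
Proof.
pose G u v := exists s, u = tsum EH s /\ v = tsum YK (tmap A X s).
have [||||T [TG Tb]] := @graph_extension _ EH YK G (opnorm A * opnorm X).
- by rewrite mulr_ge0 ?opnorm_ge0.
- move=> a _ _ _ _ [s [-> ->]] [t [-> ->]].
  exists ([seq (a *: x.1, x.2) | x <- s] ++ t).
  rewrite /tsum /tmap !map_cat !big_cat !big_map /= !scaler_sumr; split; congr (_ + _).
    by apply: eq_bigr => x _; rewrite linearZl_LR.
  by apply: eq_bigr => x _; rewrite linearZ linearZl_LR.
- by move=> _ _ [s [-> ->]]; exact: n2_tmap.
- move=> u e e0; have [s h] := tsum_dense u e0.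
  by exists (tsum EH s), (tsum YK (tmap A X s)); split => //; exists s.
exists T; split => // e h; apply: TG; exists [:: (e, h)].
by rewrite /tsum /tmap /= !big_seq1.
Qed.

Lemma otensE (A : bop E Y) (X : bop H K) e h :
  otens EH YK A X (tens EH e h) = tens YK (A e) (X h).
Proof.
move: e h; rewrite /otens; case: xgetP => [T _ //|n].
by have [T [TP _]] := otens_spec A X; case: (n T).
Qed.

Lemma otens_uniq (A : bop E Y) (X : bop H K) (T : bop EH YK) :
  (forall e h, T (tens EH e h) = tens YK (A e) (X h)) -> otens EH YK A X = T.
Proof. by move=> h; apply: bop_tens_ext => e x; rewrite otensE h. Qed.

Lemma otens_tsum A X s : otens EH YK A X (tsum EH s) = tsum YK (tmap A X s).
Proof.
rewrite /tsum raddf_sum /tmap big_map; apply: eq_bigr => x _; exact: otensE.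
Qed.

Lemma otensDl A A' X : otens EH YK (A + A') X = otens EH YK A X + otens EH YK A' X.
Proof. by apply: otens_uniq => e h; rewrite bopD !otensE bopD linearDl. Qed.
Lemma otens0l X : otens EH YK 0 X = 0.
Proof. by apply: otens_uniq => e h; rewrite !bop0 linear0l. Qed.
Lemma otensBl A A' X : otens EH YK (A - A') X = otens EH YK A X - otens EH YK A' X.
Proof. by apply: otens_uniq => e h; rewrite bopB !otensE bopB linearBl. Qed.
Lemma otens_suml I (r : seq I) (P : pred I) (F : I -> bop E Y) X :
  otens EH YK (\sum_(i <- r | P i) F i) X = \sum_(i <- r | P i) otens EH YK (F i) X.
Proof.
by apply: (big_morph (fun A => otens EH YK A X)) => [? ?|]; rewrite ?otensDl ?otens0l.
Qed.
End OtensExists.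

Section OtensAlgebra.
Context {R : realType}.

Lemma otens_id (E H : hilbertType R) (EH : hilbert_tensor E H) :
  otens EH EH (bop_id E) (bop_id H) = bop_id EH.
Proof. exact: otens_uniq. Qed.

Lemma otens_comp (E Y Z H K L : hilbertType R) (EH : hilbert_tensor E H)
  (YK : hilbert_tensor Y K) (ZL : hilbert_tensor Z L)
  (B : bop Y Z) (A : bop E Y) (X' : bop K L) (X : bop H K) :
  bop_comp (otens YK ZL B X') (otens EH YK A X) =
  otens EH ZL (bop_comp B A) (bop_comp X' X).
Proof. by apply/esym/otens_uniq => e h; rewrite /= !otensE. Qed.

(** Immediate on sums of elementary tensors, then extended by continuity in one argument at a
    time. *)
Lemma otens_adj (E Y H : hilbertType R) (EH : hilbert_tensor E H)
  (YH : hilbert_tensor Y H) (A : bop E Y) u v :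
  rin (otens EH YH A (bop_id H) u) v = rin u (otens YH EH (adj A) (bop_id H) v).
Proof.
have [s su] := tsum_seq u; have [t tv] := tsum_seq v.
set T := otens EH YH A _; set T' := otens YH EH _ _.
have tt k x : rin (T (tsum EH (s k))) (tsum YH x) = rin (tsum EH (s k)) (T' (tsum YH x)).
  rewrite !otens_tsum /rin /tsum /tmap !big_map !inner_suml; congr complex.Re.
  apply: eq_bigr => y _; rewrite !inner_sumr; apply: eq_bigr => z _.
  by rewrite !inner_tens adjE.
have tx x : rin (T u) (tsum YH x) = rin u (T' (tsum YH x)).
  apply: (cvg_uniq (V := R^o) (F := \oo) (u := fun k => rin (T (tsum EH (s k))) (tsum YH x))).
    by apply: rin_cvg; apply: bop_cvg.
  have -> : (fun k => rin (T (tsum EH (s k))) (tsum YH x)) =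
    (fun k => rin (tsum EH (s k)) (T' (tsum YH x))) by apply/funext => k.
  exact: rin_cvg.
rewrite [LHS]rinC [RHS]rinC.
apply: (cvg_uniq (V := R^o) (F := \oo) (u := fun k => rin (tsum YH (t k)) (T u))).
  exact: rin_cvg.
have -> : (fun k => rin (tsum YH (t k)) (T u)) =
    (fun k => rin (T' (tsum YH (t k))) u) by apply/funext => k; rewrite rinC tx rinC.
by apply: rin_cvg; apply: bop_cvg.
Qed.
End OtensAlgebra.

(** * Operator series *)

Section OperatorSeries.
Context {R : realType}.
Implicit Types U V W : hilbertType R.

Lemma cvg_opnorm U V (T : Type) (F : set_system T) {FF : Filter F}
  (u : T -> bop U V) (l : bop U V) :
  u @ F --> l <-> (fun k => opnorm (u k - l)) @ F --> (0 : R).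
Proof.
split.
  move=> /cvgrPdist_lt ul; apply/cvgrPdist_lt => e e0.
  have s0 : 0 < e%:C by rewrite ltcR.
  apply: filterS (ul _ s0) => k; rewrite bop_normE ltcR sub0r normrN ger0_norm ?opnorm_ge0//.
  by rewrite -opnormN opprB.
move=> /cvgrPdist_lt ul; apply/cvgrPdist_lt => e /gt0_complex[r r0 ->].
apply: filterS (ul _ r0) => k.
by rewrite bop_normE ltcR sub0r normrN ger0_norm ?opnorm_ge0// -opnormN opprB.
Qed.

Lemma opnorm_cvg_pt U V (T : Type) (F : set_system T) {FF : Filter F}
  (u : T -> bop U V) (l : bop U V) x : u @ F --> l -> (fun k => u k x) @ F --> l x.
Proof.
move=> /cvg_opnorm ul; apply/cvg_n2.
have ul2 : (fun k => opnorm (u k - l) * opnorm (u k - l)) @ F --> (0 : R).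
  by rewrite -[X in _ --> X](mulr0 0); apply: cvgM.
apply: (squeeze0 ul2 (c := n2 x)); apply: nearW => k.
by rewrite n2_ge0 -bopB mulrC -expr2 n2_bop.
Qed.

Lemma bop_cvg_comp U V W (T : Type) (F : set_system T) {FF : Filter F}
  (u : T -> bop U V) (l : bop U V) (g : bop V W) :
  u @ F --> l -> (fun k => bop_comp g (u k)) @ F --> bop_comp g l.
Proof.
move=> /cvg_opnorm ul; apply/cvg_opnorm; apply: (squeeze0 ul (c := opnorm g)).
by apply: nearW => k; rewrite opnorm_ge0 -bop_compBr opnorm_comp.
Qed.

Lemma bop_cvg_compr U V W (T : Type) (F : set_system T) {FF : Filter F}
  (u : T -> bop V W) (l : bop V W) (g : bop U V) :
  u @ F --> l -> (fun k => bop_comp (u k) g) @ F --> bop_comp l g.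
Proof.
move=> /cvg_opnorm ul; apply/cvg_opnorm; apply: (squeeze0 ul (c := opnorm g)).
by apply: nearW => k; rewrite opnorm_ge0 -bop_compBl mulrC opnorm_comp.
Qed.

Lemma cvg_expr0 (rho c : R) : 0 <= rho < 1 -> (fun k => c * rho ^+ k) @ \oo --> (0 : R).
Proof.
move=> /andP[r0 r1]; rewrite -[X in _ --> X](mulr0 c); apply: cvgM; first exact: cvg_cst.
by apply: cvg_expr; rewrite ger0_norm.
Qed.

Section Geometric.
Variables (U V : hilbertType R) (a : nat -> bop U V) (C rho : R).
Hypotheses (C0 : 0 <= C) (rho01 : 0 <= rho < 1).
Hypothesis (a_le : forall k, opnorm (a k) <= C * rho ^+ k).

Lemma geo_cauchy m k : (m <= k)%N ->
  opnorm (series a k - series a m) <= C * rho ^+ m / (1 - rho).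
Proof.
have [r0 r1] := andP rho01; have r1' : 0 < 1 - rho by rewrite subr_gt0.
(* The stated bound is not stable under adding a term; the exact geometric sum between [m] and [k]
   is. *)
move=> mk; apply: (@le_trans _ _ (C * (rho ^+ m - rho ^+ k) / (1 - rho))); last first.
  rewrite ler_pM2r ?invr_gt0// ler_wpM2l// gerBl exprn_ge0//.
rewrite -(subnK mk); elim: (k - m)%N => [|i IH].
  by rewrite add0n !subrr mulr0 mul0r opnorm0.
rewrite addSn seriesSr addrAC.
apply: le_trans (opnormD _ _) _.
have e : C * (rho ^+ m - rho ^+ (i + m).+1) / (1 - rho) =
  C * (rho ^+ m - rho ^+ (i + m)) / (1 - rho) + C * rho ^+ (i + m).
  by rewrite exprS; field; rewrite gt_eqF.
by rewrite e; apply: lerD.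
Qed.

Lemma geo_tail (l : bop U V) m : series a @ \oo --> l ->
  opnorm (l - series a m) <= C * rho ^+ m / (1 - rho).
Proof.
move=> /cvg_opnorm sl.
have h1 : (fun k => opnorm (series a k - l) + C * rho ^+ m / (1 - rho)) @ \oo -->
   (0 + C * rho ^+ m / (1 - rho)) by apply: cvgD => //; exact: cvg_cst.
rewrite -[leRHS]add0r; apply: (cvgr_to_ge h1); exists m => // k /= mk.
have -> : l - series a m = - (series a k - l) + (series a k - series a m).
  by rewrite opprB addrA subrK.
by apply: le_trans (opnormD _ _) _; rewrite opnormN lerD2l geo_cauchy.
Qed.

(** The limit is built pointwise; the tail bound, uniform in the vector, upgrades pointwise
    convergence to convergence in norm. *)
Lemma geo_series_cvg : exists l : bop U V, series a @ \oo --> l.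
Proof.
have [r0 r1] := andP rho01; have r1' : 0 < 1 - rho by rewrite subr_gt0.
pose B m := C * rho ^+ m / (1 - rho).
have B0 m : 0 <= B m by rewrite divr_ge0 ?mulr_ge0 ?exprn_ge0// ltW.
have Bc : B @ \oo --> (0 : R).
  have -> : B = (fun m => (C / (1 - rho)) * rho ^+ m).
    by apply/funext => m; rewrite /B mulrAC.
  exact: cvg_expr0.
have Bc2 (x : U) : (fun m => B m ^+ 2 * n2 x) @ \oo --> (0 : R) .
  rewrite -[X in _ --> X](mul0r (n2 x)); apply: cvgM; last exact: cvg_cst.
  have -> : (fun m => B m ^+ 2) = (fun m => B m * B m) by apply/funext => m; rewrite expr2.
  by rewrite -[X in _ --> X](mulr0 0); apply: cvgM.
have bd x m k : (m <= k)%N -> n2 (series a k x - series a m x) <= B m ^+ 2 * n2 x.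
  move=> mk; rewrite -bopB (le_trans (n2_bop _ _))// ler_wpM2r ?n2_ge0//.
  by rewrite ler_sqr ?nnegrE ?opnorm_ge0 ?B0// geo_cauchy.
have fex x : exists l : V, (fun k => series a k x) @ \oo --> l.
  by apply: (cauchy_cvgn (Bc2 x)) => m k; exact: bd.
have [f fP] := choice fex.
have fl : linear f.
  move=> t x y; apply: (cvg_uniq (F := \oo) (u := fun k => series a k (t *: x + y))) => //.
  have -> : (fun k => series a k (t *: x + y)) =
    (fun k => t *: series a k x + series a k y) by apply/funext => k; rewrite linearP.
  by apply: cvgD => //; apply: cvgZr.
have fb x m : n2 (f x - series a m x) <= B m ^+ 2 * n2 x.
  apply: (n2_lim_le (F := \oo) (u := fun k => series a k x - series a m x)).
    by apply: cvgB => //; exact: cvg_cst.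
  by exists m => // k /= mk; exact: bd.
have fb0 x : n2 (f x) <= B 0 ^+ 2 * n2 x.
  by have := fb x 0; rewrite /series /= big_geq// bop0 subr0.
have [l lE] := bop_exists fl (B0 0) fb0.
exists l; apply/cvg_opnorm; apply: (squeeze0 Bc (c := 1)); apply: nearW => m.
rewrite opnorm_ge0 mul1r -opnormN opprB; apply: opnorm_le_n2 => // x.
by rewrite bopB lE fb.
Qed.
End Geometric.

(** Each of the [N] terms of [1 + s + ... + s^(N-1)] is at least [s^N]; multiplying by [1 - s]
    closes the geometric sum. *)
Lemma mul_expr_le (s : R) N : 0 <= s <= 1 -> N%:R * s ^+ N * (1 - s) <= 1 - s ^+ N.
Proof.
move=> /andP[s0 s1]; elim: N => [|N IH]; first by rewrite !mul0r expr0 subrr.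
have e0 : 0 <= s ^+ N by rewrite exprn_ge0.
have e1 : s ^+ N <= 1 by rewrite exprn_ile1.
rewrite exprS -[N.+1%:R]natr1; move: IH e0 e1; move: (N%:R : R) (s ^+ N) => t x IH x0 x1.
have : s * (t * x * (1 - s)) <= s * (1 - x) by rewrite ler_wpM2l.
have : 0 <= (1 - s) * (1 - s * x).
  by rewrite mulr_ge0 ?subr_ge0// mulr_ile1.
by lra.
Qed.

Lemma cvg_mul_expr (rho c : R) : 0 <= rho < 1 ->
  (fun k => c * (k%:R * rho ^+ k)) @ \oo --> (0 : R).
Proof.
move=> /andP[r0 r1]; rewrite -[X in _ --> X](mulr0 c); apply: cvgM; first exact: cvg_cst.
(* [rho^k] is split into two factors [sqrt(rho)^k]: one absorbs [k], the other tends to [0]. *)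
have s0 := sqrtr_ge0 rho.
have s1 : Num.sqrt rho < 1 by rewrite -sqrtr1 ltr_sqrt.
have s01 : 0 <= Num.sqrt rho < 1 by rewrite s0.
apply: (squeeze0 (cvg_expr0 1 s01) (c := (1 - Num.sqrt rho)^-1)).
have p1 : 0 < 1 - Num.sqrt rho by rewrite subr_gt0.
apply: nearW => k; rewrite mulr_ge0 ?exprn_ge0//= mul1r.
rewrite -{1}(sqr_sqrtr r0) -exprM mulnC exprM expr2 mulrA ler_wpM2r ?exprn_ge0//.
rewrite -[leRHS]mul1r ler_pdivlMr//.
apply: le_trans (mul_expr_le k _) _; first by rewrite s0 ltW.
by rewrite gerBl exprn_ge0.
Qed.

(** The triangle [k + j < N], read by diagonals and by columns. *)
Lemma triangle_sum (V : zmodType) (F : nat -> nat -> V) N :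
  \sum_(0 <= m < N) \sum_(k < m.+1) F k (m - k)%N =
  \sum_(j < N) \sum_(0 <= k < N - j) F k j.
Proof.
elim: N => [|N IH]; first by rewrite big_geq// big_ord0.
rewrite big_nat_recr//= IH [RHS]big_ord_recr/= subSn// subnn big_nat1.
have -> : \sum_(i < N) \sum_(0 <= k < N.+1 - i) F k i =
  \sum_(i < N) (\sum_(0 <= k < N - i) F k i + F (N - i)%N i).
  by apply: eq_bigr => i _; rewrite (subSn (ltnW (ltn_ord i))) big_nat_recr.
rewrite big_split/= -addrA; congr (_ + _).
rewrite (reindex_inj rev_ord_inj)/= big_ord_recr/= subnn subn0; congr (_ + _).
  by apply: eq_bigr => i _; rewrite subSS subKn// ltnW.
Qed.

(** The partial sum of order [N] is the sum over [j < N] of [series a (N - j)] times [b j].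
    Replacing [series a (N - j)] by [la] costs at most [C D rho^N / (1 - rho)] for each [j], and
    [N rho^N] tends to [0]. *)
Lemma cauchy_product U V W (a : nat -> bop V W) (b : nat -> bop U V) C D rho la lb :
  0 <= C -> 0 <= D -> 0 <= rho < 1 ->
  (forall k, opnorm (a k) <= C * rho ^+ k) -> (forall k, opnorm (b k) <= D * rho ^+ k) ->
  series a @ \oo --> la -> series b @ \oo --> lb ->
  series (fun m => \sum_(k < m.+1) bop_comp (a k) (b (m - k)%N)) @ \oo --> bop_comp la lb.
Proof.
move=> C0 D0 r01 aC bD al bl.
have [r0 r1] := andP r01; have r1' : 0 < 1 - rho by rewrite subr_gt0.
set c := series _.
have h1 : (fun N => bop_comp la (series b N)) @ \oo --> bop_comp la lb by exact: bop_cvg_comp.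
have h2 : (fun N => c N - bop_comp la (series b N)) @ \oo --> (0 : bop U W).
  apply/cvg_opnorm; apply: (squeeze0 (cvg_mul_expr 1 r01) (c := C * D / (1 - rho))).
  apply: nearW => N; rewrite opnorm_ge0 subr0 mul1r /= -opnormN opprB.
  rewrite /c /series /= (triangle_sum (fun k j => bop_comp (a k) (b j))).
  rewrite [X in bop_comp la X]big_mkord bop_comp_sumr -sumrB.
  apply: (@le_trans _ _ (\sum_(i < N) C * D / (1 - rho) * rho ^+ N)).
    apply: (big_rec2 (fun x y => opnorm x <= y)); first by rewrite opnorm0.
    move=> i y1 y2 _ h; apply: le_trans (opnormD _ _) _; apply: lerD => //.
    rewrite -bop_comp_suml -bop_compBl (le_trans (opnorm_comp _ _))//.
    have := geo_tail C0 r01 aC (N - i) al; rewrite /series /= => h3.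
    apply: le_trans (ler_pM _ _ h3 (bD i)) _; rewrite ?opnorm_ge0//.
    have e : rho ^+ N = rho ^+ (N - i) * rho ^+ i by rewrite -exprD subnK// ltnW.
    rewrite e le_eqVlt; apply/orP; left; apply/eqP.
    by field; rewrite gt_eqF.
  by rewrite sumr_const card_ord -[leLHS]mulr_natr mulrAC mulrA.
have -> : c = (fun N => c N - bop_comp la (series b N) + bop_comp la (series b N)).
  by apply/funext => N; rewrite subrK.
by rewrite -[X in _ --> X]add0r; apply: cvgD.
Qed.

Fixpoint bop_pow (U : hilbertType R) (T : bop U U) (k : nat) : bop U U :=
  if k is k'.+1 then bop_comp T (bop_pow T k') else bop_id U.

Lemma opnorm_id (U : hilbertType R) : opnorm (bop_id U) <= 1.
Proof. by apply: opnorm_le_n2 => // x; rewrite expr1n mul1r. Qed.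

Lemma opnorm_pow (U : hilbertType R) (T : bop U U) rho k : 0 <= rho ->
  opnorm T <= rho -> opnorm (bop_pow T k) <= 1 * rho ^+ k.
Proof.
move=> r0 Tr; elim: k => [|k IH] /=; first by rewrite expr0 mul1r opnorm_id.
rewrite mul1r exprS (le_trans (opnorm_comp _ _))// ler_pM ?opnorm_ge0//.
by move: IH; rewrite mul1r.
Qed.

(** The convergence of the series is kept along with the inverse: it is what links resolvents to
    power series coefficients. *)
Lemma neumann (U : hilbertType R) (T : bop U U) rho : 0 <= rho < 1 -> opnorm T <= rho ->
  exists S : bop U U, bop_inverse (bop_id U - T) S /\ series (bop_pow T) @ \oo --> S.
Proof.
move=> r01 Tr; have [r0 r1] := andP r01.
have bd k := @opnorm_pow U T rho k r0 Tr.
have [S SP] := geo_series_cvg ler01 r01 bd.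
exists S; split=> //.
have powC k : bop_comp (bop_pow T k) T = bop_comp T (bop_pow T k).
  by elim: k => [|k IH] /=; rewrite ?bop_comp1l ?bop_comp1r// -bop_compA IH.
have tel N : series (bop_pow T) N - bop_comp T (series (bop_pow T) N) = bop_id U - bop_pow T N.
  elim: N => [|N IH]; first by rewrite /series /= big_geq// bop_comp0r subr0 subrr.
  rewrite seriesSr bop_compDr opprD addrACA IH /=.
  by rewrite addrA subrK.
have telr N : series (bop_pow T) N - bop_comp (series (bop_pow T) N) T = bop_id U - bop_pow T N.
  rewrite -tel; congr (_ - _); rewrite /series /= bop_comp_suml bop_comp_sumr.
  by apply: eq_bigr => i _; exact: powC.
have lim1 : (fun N => bop_id U - bop_pow T N) @ \oo --> bop_id U.
  rewrite -[X in _ --> X]subr0; apply: cvgB; first exact: cvg_cst.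
  apply/cvg_opnorm; apply: (squeeze0 (cvg_expr0 1 r01) (c := 1)); apply: nearW => k.
  by rewrite opnorm_ge0 subr0 mul1r bd.
split; apply: (cvg_uniq (F := \oo) (u := fun N => bop_id U - bop_pow T N)) => //.
  have -> : (fun N => bop_id U - bop_pow T N) =
    (fun N => bop_comp (bop_id U - T) (series (bop_pow T) N)).
    by apply/funext => N; rewrite bop_compBl bop_comp1l tel.
  exact: bop_cvg_comp.
have -> : (fun N => bop_id U - bop_pow T N) =
  (fun N => bop_comp (series (bop_pow T) N) (bop_id U - T)).
  by apply/funext => N; rewrite bop_compBr bop_comp1r telr.
exact: bop_cvg_compr.
Qed.
End OperatorSeries.

(** * Row and column inequalities *)

Section SumProjections.
Context {R : realType}.

Section Hpow.
Variables (n : nat) (E : hilbertType R).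
Implicit Types u v : hpow n E.

Lemma inner_hpow u v : inner u v = \sum_i inner (u i) (v i).
Proof. by []. Qed.
Lemma rin_hpow u v : rin u v = \sum_i rin (u i) (v i).
Proof. by rewrite /rin inner_hpow Re_sum. Qed.
Lemma n2_hpow u : n2 u = \sum_i n2 (u i).
Proof. exact: rin_hpow. Qed.

Lemma hpow_projb_subproof i : @hpow_proj R n E i \in @bounded_linear_map R (hpow n E) E.
Proof.
apply/asboolP; split; first exact: hpow_proj_linear.
exists 1 => x; rewrite mul1r normE [X in _ <= X]normE lecR ler_sqrt ?n2_ge0//.
by rewrite [leRHS]n2_hpow (bigD1 i)//= lerDl sumr_ge0// => j _; exact: n2_ge0.
Qed.
Definition hpow_projb i : bop (hpow n E) E := Bop (hpow_projb_subproof i).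
Lemma hpow_inE i x j : @hpow_in R n E i x j = if j == i then x else 0 :> E.
Proof. by rewrite /hpow_in /= ffunE. Qed.
End Hpow.

Section Hsum.
Variables (Y Z : hilbertType R).
Implicit Types u : hsum Y Z.
Lemma n2_hsum u : n2 u = n2 u.1 + n2 u.2.
Proof. by rewrite /n2 /rin -ReD. Qed.

Lemma hsum_fstb_subproof : @hsum_fst R Y Z \in @bounded_linear_map R (hsum Y Z) Y.
Proof.
apply/asboolP; split; first by [].
exists 1 => x; rewrite mul1r normE [X in _ <= X]normE lecR ler_sqrt ?n2_ge0//.
by rewrite [leRHS]n2_hsum lerDl n2_ge0.
Qed.
Definition hsum_fstb : bop (hsum Y Z) Y := Bop hsum_fstb_subproof.
Lemma hsum_sndb_subproof : @hsum_snd R Y Z \in @bounded_linear_map R (hsum Y Z) Z.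
Proof.
apply/asboolP; split; first by [].
exists 1 => x; rewrite mul1r normE [X in _ <= X]normE lecR ler_sqrt ?n2_ge0//.
by rewrite [leRHS]n2_hsum lerDr n2_ge0.
Qed.
Definition hsum_sndb : bop (hsum Y Z) Z := Bop hsum_sndb_subproof.
End Hsum.
End SumProjections.

(** Carries a bound across a formal duality of functions; it serves to pass between the row of the
    [X i] and the column of their adjoints. *)
Lemma n2_dual (R : realType) (U V : hilbertType R) (T : U -> V) (S : V -> U) (c : R) :
  0 <= c -> (forall x y, rin (T x) y = rin x (S y)) ->
  (forall y, n2 (S y) <= c * n2 y) -> forall x, n2 (T x) <= c * n2 x.
Proof.
move=> c0 TS h x.
have k : n2 (T x) ^+ 2 <= (c * n2 x) * n2 (T x).
  rewrite {1}/n2 TS (le_trans (rin_CS _ _))// mulrC -mulrA (mulrC (n2 x)) mulrA.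
  by rewrite ler_wpM2r ?n2_ge0.
have [s0|s0] := eqVneq (n2 (T x)) 0.
  by rewrite s0 mulr_ge0 ?n2_ge0.
by move: k; rewrite expr2 ler_pM2r// lt_def s0 n2_ge0.
Qed.

Section RowOperators.
Context {R : realType} {n : nat} {H : hilbertType R}.
Implicit Types X : 'I_n -> bop H H.

Definition rowop X : bop (hpow n H) H := \sum_i bop_comp (X i) (hpow_projb H i).
Definition colop X : bop H (hpow n H) := \sum_i bop_comp (hpow_in H i) (X i).

Lemma rowopE X u : rowop X u = \sum_i X i (u i).
Proof. by rewrite bop_sum. Qed.
Lemma colopE X x i : colop X x i = X i x.
Proof.
rewrite bop_sum -[LHS]/(hpow_projb H i _) raddf_sum (bigD1 i)//= big1 ?addr0.
  by rewrite /hpow_proj ffunE eqxx.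
by move=> j ji; rewrite /hpow_proj ffunE eq_sym (negPf ji).
Qed.

Lemma rowop_dual X u y : rin (rowop X u) y = rin u (colop (fun i => adj (X i)) y).
Proof.
rewrite rowopE rin_suml rin_hpow; apply: eq_bigr => i _.
by rewrite rin_adj colopE.
Qed.

Lemma row_colE X y : (\sum_i bop_comp (X i) (adj (X i))) y =
  rowop X (colop (fun i => adj (X i)) y).
Proof. by rewrite rowopE bop_sum; apply: eq_bigr => i _; rewrite colopE. Qed.

Definition row_bound X (c : R) := forall u, n2 (rowop X u) <= c * n2 u.

(** [sum X_i X_i^*] is the row after its adjoint column, so its norm bounds the column, and the row
    by duality. The strict bound [rho < 1] is the source of all geometric convergence at [X]. *)
Lemma opball_row_bound X : opball n H X ->
  exists2 rho : R, 0 <= rho < 1 & row_bound X (rho ^+ 2).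
Proof.
rewrite /opball /=; set S := \sum_i _; set c := opnorm S => c1.
have c0 : 0 <= c by exact: opnorm_ge0.
exists (Num.sqrt c); first by rewrite sqrtr_ge0.
rewrite sqr_sqrtr//; apply: (n2_dual c0 (rowop_dual X)) => y.
have -> : n2 (colop (fun i => adj (X i)) y) = rin (S y) y.
  by rewrite /n2 -rowop_dual -row_colE.
rewrite -(sqr_sqrtr (n2_ge0 y)) expr2 mulrA; apply: rin_le.
- by rewrite mulr_ge0 ?sqrtr_ge0.
- exact: sqrtr_ge0.
- by rewrite exprMn sqr_sqrtr ?n2_ge0// n2_bop.
- by rewrite sqr_sqrtr ?n2_ge0.
Qed.

Lemma row_bound_opball X (r : R) : 0 <= r < 1 -> row_bound X (r ^+ 2) -> opball n H X.
Proof.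
move=> /andP[r0 r1] Xr; rewrite /opball /=.
have r20 : 0 <= r ^+ 2 by rewrite exprn_ge0.
have cb : forall y, n2 (colop (fun i => adj (X i)) y) <= r ^+ 2 * n2 y.
  by apply: (n2_dual r20 (S := rowop X)) => [x y|]; [rewrite rinC -rowop_dual rinC|].
apply: (@le_lt_trans _ _ r) => //; rewrite -[leRHS](ger0_norm r0) -sqrtr_sqr ler_sqrt//.
apply: opnorm_le_n2 => // x; rewrite row_colE (le_trans (Xr _))//.
by rewrite (expr2 (r ^+ 2)) -mulrA; exact: ler_wpM2l.
Qed.
End RowOperators.

Section TensorInequalities.
Context {R : realType} {H : hilbertType R}.

Lemma re_gsum_ge0 (V W : lmodType R[i]) (p : V -> V -> R[i]) (q : W -> W -> R[i]) s :
  psd p -> psd q -> 0 <= complex.Re (gsum p q s).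
Proof. by move=> pp qq; apply/ge0_ReE/gsum_ge0. Qed.

(** The form of [c - sum F_i^* F_i - P^* P] is positive, hence so is its tensor product with the
    inner product of [H]. The inequality is treated jointly because separate bounds on the [F i] and
    [P] do not add up to [c]. *)
Lemma column_tensor (I : finType) (K V Y : hilbertType R) (KH : hilbert_tensor K H)
  (VH : hilbert_tensor V H) (YH : hilbert_tensor Y H)
  (F : I -> bop K V) (P : bop K Y) (c : R) :
  (forall x, \sum_i n2 (F i x) + n2 (P x) <= c * n2 x) ->
  forall u, \sum_i n2 (otens KH VH (F i) (bop_id H) u) +
            n2 (otens KH YH P (bop_id H) u) <= c * n2 u.
Proof.
move=> Fc.
pose p x y := c%:C * inner x y - (\sum_i inner (F i x) (F i y) + inner (P x) (P y)).
have pp : psd p.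
  split=> [a x y z|x y|x]; rewrite /p.
  - have -> : \sum_i inner (F i (a *: x + y)) (F i z) =
      a * \sum_i inner (F i x) (F i z) + \sum_i inner (F i y) (F i z).
      rewrite mulr_sumr -big_split; apply: eq_bigr => i _.
      by rewrite linearP innerDl innerZl.
    by rewrite linearP !innerDl !innerZl; ring.
  - rewrite rmorphB rmorphD rmorphM rmorph_sum /= conj_real -!inner_conj.
    by congr (_ - (_ + _)); apply: eq_bigr => i _; rewrite -inner_conj.
  - have -> : \sum_i inner (F i x) (F i x) = (\sum_i n2 (F i x))%:C.
      by rewrite rmorph_sum; apply: eq_bigr => i _; rewrite n2C.
    by rewrite !n2C -rmorphM -rmorphD -rmorphB /= ler0c subr_ge0.
have base s : \sum_i n2 (otens KH VH (F i) (bop_id H) (tsum KH s)) +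
            n2 (otens KH YH P (bop_id H) (tsum KH s)) <= c * n2 (tsum KH s).
  have := re_gsum_ge0 s pp (@psd_inner _ H).
  have -> : gsum p (@inner R H) s = (c * n2 (tsum KH s) -
    (\sum_i n2 (otens KH VH (F i) (bop_id H) (tsum KH s)) +
            n2 (otens KH YH P (bop_id H) (tsum KH s))))%:C.
    rewrite rmorphB rmorphM rmorphD rmorph_sum /= -!n2C otens_tsum inner_tmap inner_tsum.
    under eq_bigr do rewrite -n2C otens_tsum inner_tmap.
    have -> : \sum_i gsum (pullback (F i)) (@inner R H) s =
      \sum_(x <- s) \sum_(y <- s) (\sum_i pullback (F i) x.1 y.1) * inner x.2 y.2.
      rewrite exchange_big; apply: eq_bigr => x _.
      by rewrite exchange_big; apply: eq_bigr => y _; rewrite mulr_suml.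
    rewrite /gsum mulr_sumr -big_split -sumrB; apply: eq_bigr => x _ /=.
    rewrite mulr_sumr -big_split -sumrB; apply: eq_bigr => y _ /=.
    by rewrite /p /pullback; ring.
  by rewrite /= subr_ge0.
move=> u; have [s su] := tsum_seq u.
have h1 : (fun k => \sum_i n2 (otens KH VH (F i) (bop_id H) (tsum KH (s k))) +
            n2 (otens KH YH P (bop_id H) (tsum KH (s k)))) @ \oo -->
   \sum_i n2 (otens KH VH (F i) (bop_id H) u) + n2 (otens KH YH P (bop_id H) u).
  apply: cvgD; last by apply: n2_cvg; exact: bop_cvg.
  apply: (cvg_bigsum (f := fun i k => n2 (otens KH VH (F i) (bop_id H) (tsum KH (s k)))) (l := fun i => n2 (otens KH VH (F i) (bop_id H) u))).
  by move=> i; apply: n2_cvg; exact: bop_cvg.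
have h2 : (fun k => c * n2 (tsum KH (s k))) @ \oo --> c * n2 u.
  by apply: cvgM; [exact: cvg_cst|exact: n2_cvg].
by apply: (ler_cvg_to h1 h2); apply: nearW => k; exact: base.
Qed.

Lemma contraction_tensor (K V : hilbertType R) (KH : hilbert_tensor K H)
  (VH : hilbert_tensor V H) (P : bop K V) (c : R) :
  (forall x, n2 (P x) <= c * n2 x) ->
  forall u, n2 (otens KH VH P (bop_id H) u) <= c * n2 u.
Proof.
move=> Pc u.
have Pc0 x : \sum_(i < 0) n2 ((0 : bop K V) x) + n2 (P x) <= c * n2 x.
  by rewrite big_ord0 add0r.
by have := @column_tensor _ _ _ _ KH VH VH _ _ _ Pc0 u; rewrite big_ord0 add0r.
Qed.

(** Schur product of the defect [I - F^* F] on [K] with the defect [c - X^* X] of the row operator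
    on [H^n], evaluated at the element of [K (x) H^n] whose components are the [v j]. *)
Lemma row_tensor (n : nat) (K V : hilbertType R) (KH : hilbert_tensor K H)
  (VH : hilbert_tensor V H) (X : 'I_n -> bop H H) (F : bop K V) (c : R) :
  (forall x, n2 (F x) <= n2 x) -> row_bound X c ->
  forall (v : 'I_n -> KH) (y : KH),
  y = \sum_j otens KH KH (bop_id K) (X j) (v j) ->
  n2 y - n2 (otens KH VH F (bop_id H) y) <=
  c * \sum_j (n2 (v j) - n2 (otens KH VH F (bop_id H) (v j))).
Proof.
move=> Fc Xc.
set FI := otens KH VH F (bop_id H).
have Fc1 x : n2 (F x) <= 1 * n2 x by rewrite mul1r.
(* Elements of [K (x) H^n] are handled as lists only; [part s j] is the list of the component of
   index [j] in [K (x) H]. *)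
pose part (s : seq (K * hpow n H)) (j : 'I_n) := map (fun x : K * hpow n H => (x.1, x.2 j)) s.
have base s (y : KH) : y = \sum_j otens KH KH (bop_id K) (X j) (tsum KH (part s j)) ->
  n2 y - n2 (FI y) <= c * \sum_j (n2 (tsum KH (part s j)) - n2 (FI (tsum KH (part s j)))).
  move=> yD.
  have yE : y = tsum KH [seq (x.1, rowop X x.2) | x <- s].
    rewrite yD; under eq_bigr do rewrite otens_tsum /tsum /tmap /part !big_map.
    rewrite /tsum big_map.
    rewrite exchange_big; apply: eq_bigr => x _ /=.
    by rewrite rowopE raddf_sum.
  have := re_gsum_ge0 s (psd_defect Fc1) (psd_defect Xc).
  rewrite gsum_defectr !gsum_defectl.
  have e1 : gsum (@inner R K) (@inner R (hpow n H)) s =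
      (\sum_j n2 (tsum KH (part s j)))%:C.
    rewrite rmorph_sum /gsum /=.
    under [RHS]eq_bigr do rewrite -n2C inner_tsum /gsum big_map.
    rewrite [RHS]exchange_big; apply: eq_bigr => x _.
    under [RHS]eq_bigr do rewrite big_map.
    rewrite [RHS]exchange_big; apply: eq_bigr => z _ /=.
    by rewrite inner_hpow mulr_sumr.
  have e2 : gsum (pullback F) (@inner R (hpow n H)) s =
      (\sum_j n2 (FI (tsum KH (part s j))))%:C.
    rewrite rmorph_sum /gsum /=.
    under [RHS]eq_bigr do rewrite -n2C otens_tsum inner_tmap /gsum big_map.
    rewrite [RHS]exchange_big; apply: eq_bigr => x _.
    under [RHS]eq_bigr do rewrite big_map.
    rewrite [RHS]exchange_big; apply: eq_bigr => z _ /=.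
    by rewrite inner_hpow mulr_sumr.
  have e3 : gsum (@inner R K) (pullback (rowop X)) s = (n2 y)%:C.
    rewrite -n2C yE inner_tsum /gsum big_map; apply: eq_bigr => x _.
    by rewrite big_map.
  have e4 : gsum (pullback F) (pullback (rowop X)) s = (n2 (FI y))%:C.
    rewrite -n2C yE otens_tsum inner_tmap /gsum big_map; apply: eq_bigr => x _.
    by rewrite big_map.
  rewrite e1 e2 e3 e4 rmorph1 !mul1r -rmorphB -rmorphM -!rmorphB /= sumrB. lra.
(* Independent approximations of the components [v j] are assembled into a single list over [K] and
   [H^n]. *)
pose flat (t : 'I_n -> seq (K * H)) : seq (K * hpow n H) :=
  flatten [seq [seq (x.1, hpow_in H j x.2) | x <- t j] | j <- index_enum 'I_n].
have flatE t j : tsum KH (part (flat t) j) = tsum KH (t j).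
  rewrite /tsum /part big_map /flat big_flatten /= big_map (bigD1 j)//= [X in _ + X]big1 ?addr0.
    by rewrite big_map; apply: eq_bigr => x _; rewrite hpow_inE eqxx.
  move=> i ij; rewrite big_map big1// => x _.
  by rewrite hpow_inE eq_sym (negPf ij) linear0r.
move=> v y yD.
have [t tv] := choice (fun j => tsum_seq (v j)).
pose yk k := \sum_j otens KH KH (bop_id K) (X j) (tsum KH (t j k)).
have yc : yk @ \oo --> y.
  rewrite yD.
  apply: (cvg_bigsum (f := fun j k => otens KH KH (bop_id K) (X j) (tsum KH (t j k))) (l := fun j => otens KH KH (bop_id K) (X j) (v j))).
  by move=> j; apply: bop_cvg; exact: tv.
have h1 : (fun k => n2 (yk k) - n2 (FI (yk k))) @ \oo --> n2 y - n2 (FI y).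
  by apply: cvgB; apply: n2_cvg => //; exact: bop_cvg.
have h2 : (fun k => c * \sum_j (n2 (tsum KH (t j k)) - n2 (FI (tsum KH (t j k))))) @ \oo -->
   c * \sum_j (n2 (v j) - n2 (FI (v j))).
  apply: cvgM; first exact: cvg_cst.
  apply: (cvg_bigsum (f := fun j k => n2 (tsum KH (t j k)) - n2 (FI (tsum KH (t j k)))) (l := fun j => n2 (v j) - n2 (FI (v j)))).
  by move=> j; apply: cvgB; apply: n2_cvg; [exact: tv|apply: bop_cvg; exact: tv].
apply: (ler_cvg_to h1 h2); apply: nearW => k.
have := base (flat (fun j => t j k)) (yk k).
rewrite (eq_bigr (fun j => n2 (tsum KH (t j k)) - n2 (FI (tsum KH (t j k))))) => [|j _].
  by apply; apply: eq_bigr => j _; rewrite flatE.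
by rewrite flatE.
Qed.

Lemma row_tensor_le (n : nat) (K : hilbertType R) (KH : hilbert_tensor K H)
  (X : 'I_n -> bop H H) (c : R) : row_bound X c ->
  forall v : 'I_n -> KH,
  n2 (\sum_j otens KH KH (bop_id K) (X j) (v j)) <= c * \sum_j n2 (v j).
Proof.
move=> Xc v.
have F0 (x : K) : n2 ((0 : bop K K) x) <= n2 x by rewrite bop0 n2_0 n2_ge0.
have := @row_tensor _ _ _ KH KH _ _ _ F0 Xc v _ erefl; rewrite otens0l /=.
have h0 (x : KH) : n2 x - n2 ((0 : bop KH KH) x) = n2 x by rewrite bop0 n2_0 subr0.
by rewrite h0 (eq_bigr (fun j => n2 (v j))) => [|j _]; last by rewrite h0.
Qed.
End TensorInequalities.

(** * Square-summable families indexed by words *)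

Section WordSums.
Variables (n : nat) (V : nmodType).
Implicit Types (F : seq 'I_n -> V) (k m : nat).

Definition wsum k F : V := \sum_(w : k.-tuple 'I_n) F w.
(** Only lengths strictly below [N] are included, so degree at most [N] corresponds to
    [psum N.+1]. *)
Definition psum N F : V := \sum_(0 <= k < N) wsum k F.

Lemma eq_wsum k F G : (forall w, size w = k -> F w = G w) -> wsum k F = wsum k G.
Proof. by move=> FG; apply: eq_bigr => w _; rewrite FG ?size_tuple. Qed.

Lemma eq_psum N F G : (forall w, (size w < N)%N -> F w = G w) -> psum N F = psum N G.
Proof.
by move=> FG; apply: eq_big_nat => k /= kN; apply: eq_wsum => w wk; rewrite FG ?wk.
Qed.

Lemma wsum0 F : wsum 0 F = F [::].
Proof.
rewrite /wsum (big_pred1 [tuple])//= => w.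
by apply/esym/eqP; exact: tuple0.
Qed.

Lemma wsumS k F : wsum k.+1 F = \sum_(i < n) wsum k (fun w => F (i :: w)).
Proof.
rewrite /wsum pair_big /=.
rewrite (reindex (fun p : 'I_n * k.-tuple 'I_n => [tuple of p.1 :: p.2]))//=.
exists (fun w : k.+1.-tuple 'I_n => (thead w, [tuple of behead w])).
  by move=> [i w] _ /=; rewrite theadE; congr pair; apply: val_inj.
by move=> w _ /=; rewrite [RHS]tuple_eta; apply: val_inj.
Qed.

Lemma wsum_big k (I : Type) (r : seq I) (F : I -> seq 'I_n -> V) :
  wsum k (fun w => \sum_(i <- r) F i w) = \sum_(i <- r) wsum k (F i).
Proof. by rewrite /wsum exchange_big. Qed.

Lemma wsumD k F G : wsum k (fun w => F w + G w) = wsum k F + wsum k G.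
Proof. by rewrite /wsum big_split. Qed.

Lemma psumD N F G : psum N (fun w => F w + G w) = psum N F + psum N G.
Proof. by rewrite /psum -big_split; apply: eq_bigr => k _; rewrite wsumD. Qed.

Lemma psum_big N (I : Type) (r : seq I) (F : I -> seq 'I_n -> V) :
  psum N (fun w => \sum_(i <- r) F i w) = \sum_(i <- r) psum N (F i).
Proof. by rewrite /psum exchange_big; apply: eq_bigr => k _; rewrite wsum_big. Qed.

Lemma psumS N F : psum N.+1 F = psum N F + wsum N F.
Proof. by rewrite /psum big_nat_recr. Qed.

Lemma psum0 F : psum 0 F = 0. Proof. by rewrite /psum big_geq. Qed.

Lemma psumSl N F : psum N.+1 F = F [::] + \sum_(i < n) psum N (fun w => F (i :: w)).
Proof.
rewrite /psum big_nat_recl// wsum0; congr (_ + _).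
by rewrite exchange_big; apply: eq_bigr => k _; rewrite wsumS.
Qed.

Lemma wsum_split k m (F : seq 'I_n -> seq 'I_n -> V) : (k <= m)%N ->
  wsum m (fun w => F (take k w) (drop k w)) =
  wsum k (fun a => wsum (m - k) (fun b => F a b)).
Proof.
elim: k m F => [|k IH] m F km.
  by rewrite wsum0 subn0; apply: eq_wsum => w _; rewrite take0 drop0.
case: m km => // m km; rewrite !wsumS; apply: eq_bigr => i _.
by rewrite (IH m (fun a b => F (i :: a) b)).
Qed.

End WordSums.

Lemma wsumSr n (V : nmodType) k (F : seq 'I_n -> V) :
  wsum k.+1 F = \sum_(i < n) wsum k (fun w => F (rcons w i)).
Proof.
elim: k F => [|k IH] F.
  by rewrite wsumS; apply: eq_bigr => i _; rewrite !wsum0.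
rewrite wsumS; under eq_bigr do rewrite IH.
rewrite exchange_big; apply: eq_bigr => j _.
by rewrite wsumS.
Qed.

Lemma psumSr n (V : nmodType) N (F : seq 'I_n -> V) :
  psum N.+1 F = F [::] + \sum_(i < n) psum N (fun w => F (rcons w i)).
Proof.
rewrite /psum big_nat_recl// wsum0; congr (_ + _).
by rewrite exchange_big; apply: eq_bigr => k _; rewrite wsumSr.
Qed.

Lemma psum_pick n (V : nmodType) M (F : seq 'I_n -> V) (w : seq 'I_n) :
  psum M (fun w' => if w' == w then F w' else 0) = if (size w < M)%N then F w else 0.
Proof.
have wk k : wsum k (fun w' => if w' == w then F w' else 0) =
    if k == size w then F w else 0.
  case: eqP => [->|kw].
    rewrite /wsum (bigD1 (in_tuple w))//= eqxx big1 ?addr0// => t tw.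
    rewrite ifN//; apply: contra tw => /eqP tw; apply/eqP; exact: val_inj.
  rewrite (eq_wsum (G := fun=> 0)) /wsum ?big1// => t tk.
  by rewrite ifN//; apply/eqP => h; apply: kw; rewrite -tk h.
rewrite /psum (eq_bigr (fun k => if k == size w then F w else 0)) => [|k _]; last exact: wk.
rewrite -big_mkcond /=.
case: ltnP => wN; first by rewrite big_mkord (big_pred1 (Ordinal wN)).
rewrite big_nat_cond big1// => k /andP[/andP[_ kN] /eqP kw].
by move: kN; rewrite kw ltnNge wN.
Qed.

Lemma raddf_wsum n (U V : zmodType) (f : {additive U -> V}) k (F : seq 'I_n -> U) :
  f (wsum k F) = wsum k (fun w => f (F w)).
Proof. by rewrite /wsum raddf_sum. Qed.

Lemma raddf_psum n (U V : zmodType) (f : {additive U -> V}) k (F : seq 'I_n -> U) :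
  f (psum k F) = psum k (fun w => f (F w)).
Proof. by rewrite /psum raddf_sum; apply: eq_bigr => i _; rewrite raddf_wsum. Qed.

Section RealWordSums.
Variables (n : nat) (R : realType).
Implicit Types F G : seq 'I_n -> R.

Lemma wsum_ge0 k F : (forall w, 0 <= F w) -> 0 <= wsum k F.
Proof. by move=> F0; apply: sumr_ge0. Qed.
Lemma psum_ge0 N F : (forall w, 0 <= F w) -> 0 <= psum N F.
Proof. by move=> F0; apply: sumr_ge0 => k _; exact: wsum_ge0. Qed.
Lemma psum_le N F G : (forall w, F w <= G w) -> psum N F <= psum N G.
Proof. by move=> FG; apply: ler_sum => k _; apply: ler_sum. Qed.
Lemma wsumZ k c F : wsum k (fun w => c * F w) = c * wsum k F.
Proof. by rewrite /wsum mulr_sumr. Qed.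
Lemma psumZ N c F : psum N (fun w => c * F w) = c * psum N F.
Proof. by rewrite /psum mulr_sumr; apply: eq_bigr => k _; rewrite wsumZ. Qed.
Lemma psum_mono F : (forall w, 0 <= F w) ->
  {homo (fun N => psum N F) : m k / (m <= k)%N >-> m <= k}.
Proof.
move=> F0 m k mk; rewrite /psum [leRHS](big_cat_nat (n := m))//= lerDl.
by apply: sumr_ge0 => i _; exact: wsum_ge0.
Qed.
Lemma wsum_le_psum k F : (forall w, 0 <= F w) -> wsum k F <= psum k.+1 F.
Proof. by move=> F0; rewrite psumS lerDr psum_ge0. Qed.
Lemma le_wsum F (w : seq 'I_n) : (forall w, 0 <= F w) -> F w <= wsum (size w) F.
Proof.
move=> F0; rewrite /wsum (bigD1 (in_tuple w))//= lerDl.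
by apply: sumr_ge0 => i _.
Qed.
Lemma le_psum F (w : seq 'I_n) N : (size w < N)%N -> (forall w, 0 <= F w) -> F w <= psum N F.
Proof.
move=> wN F0; apply: le_trans (le_wsum w F0) _.
by apply: le_trans (wsum_le_psum _ F0) _; exact: psum_mono.
Qed.
End RealWordSums.

Section EllTwo.
Context {R : realType} (n : nat) (V : hilbertType R).
Implicit Types f g : seq 'I_n -> V.

Definition sqsummable : {pred seq 'I_n -> V} := fun f =>
  `[< exists M : R, forall N, psum N (fun w => n2 (f w)) <= M >].

Lemma sqsummable_submod : submod_closed sqsummable.
Proof.
split.
  apply/asboolP; exists 0 => N; rewrite (eq_psum (G := fun=> 0)).
    by rewrite /psum big1// => k _; rewrite /wsum big1.
  by move=> w _; rewrite n2_0.
move=> a f g /asboolP[M fM] /asboolP[M' gM]; apply/asboolP.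
have aE x : n2 (a *: x : V) = complex.Re (a * Num.conj a) * n2 x.
  rewrite /n2 /rin innerZl innerZr n2C mulrA.
  by rewrite mulrC Re_realM mulrC.
have a0 : 0 <= complex.Re (a * Num.conj a).
  by rewrite -normCK; apply: ge0_ReE; rewrite exprn_ge0.
exists (2 * (complex.Re (a * Num.conj a) * M) + 2 * M') => N.
apply: le_trans (psum_le (G := fun w => 2 * (complex.Re (a * Num.conj a) * n2 (f w)) + 2 * n2 (g w)) _ _) _.
  by move=> w; rewrite !fctE -aE -mulrDr; exact: n2D_le.
rewrite psumD !psumZ; apply: lerD; rewrite ler_pM2l//.
by rewrite ler_wpM2l.
Qed.

HB.instance Definition _ :=
  GRing.isSubmodClosed.Build R[i] (seq 'I_n -> V) sqsummable sqsummable_submod.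

Record l2 := L2 { l2_fun :> seq 'I_n -> V ; l2_subproof : l2_fun \in sqsummable }.

HB.instance Definition _ := [isSub for @l2_fun].
HB.instance Definition _ := [Choice of l2 by <:].
HB.instance Definition _ := [SubChoice_isSubLmodule of l2 by <:].

Implicit Types u v : l2.

Lemma l2_ext u v : u =1 v -> u = v.
Proof. by move=> uv; apply: val_inj; apply/funext. Qed.
Lemma l2D u v w : (u + v) w = u w + v w. Proof. by []. Qed.
Lemma l2Z a u w : (a *: u) w = a *: u w. Proof. by []. Qed.
Lemma l2N u w : (- u) w = - u w. Proof. by []. Qed.
Lemma l2_mk f (M : R) : (forall N, psum N (fun w => n2 (f w)) <= M) -> exists u : l2, u =1 f.
Proof.
move=> h; have fP : f \in sqsummable by apply/asboolP; exists M.
by exists (L2 fP).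
Qed.

Lemma l2_n2_cvg u : cvgn (fun N => psum N (fun w => n2 (u w))).
Proof.
have /asboolP[M uM] := l2_subproof u.
apply: nondecreasing_is_cvgn; first by apply: psum_mono => w; exact: n2_ge0.
by exists M => _ [N _ <-].
Qed.

Definition l2_rdot u v : R := limn (fun N => psum N (fun w => rin (u w) (v w))).

(** By polarization the partial sums are, up to the factor [1/4], a difference of two bounded
    nondecreasing sequences. *)
Lemma l2_rdotP u v : (fun N => psum N (fun w => rin (u w) (v w))) @ \oo --> l2_rdot u v.
Proof.
suff : cvgn (fun N => psum N (fun w => rin (u w) (v w))) by [].
have -> : (fun N => psum N (fun w => rin (u w) (v w))) =
  (fun N => 4^-1 * (psum N (fun w => n2 ((u + v) w)) - psum N (fun w => n2 ((u - v) w)))).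
  apply/funext => N; rewrite -[X in _ - X]mul1r -mulNr -psumZ -psumD -psumZ.
  by apply: eq_psum => w _; rewrite !l2D l2N n2D n2B; lra.
by apply: is_cvgM; [exact: is_cvg_cst|apply: is_cvgB; exact: l2_n2_cvg].
Qed.

Arguments l2_rdotP : clear implicits.

Lemma l2_rdot_eq u v (l : R) :
  (fun N => psum N (fun w => rin (u w) (v w))) @ \oo --> l -> l2_rdot u v = l.
Proof. by move=> h; exact: (cvg_uniq (V := R^o) (l2_rdotP u v) h). Qed.

Lemma l2_rdotC u v : l2_rdot u v = l2_rdot v u.
Proof.
apply: l2_rdot_eq; have -> : (fun N => psum N (fun w => rin (u w) (v w))) =
  (fun N => psum N (fun w => rin (v w) (u w))).
  by apply/funext => N; apply: eq_psum => w _; rewrite rinC.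
exact: l2_rdotP.
Qed.

Lemma l2_rdotDl u v z : l2_rdot (u + v) z = l2_rdot u z + l2_rdot v z.
Proof.
apply: l2_rdot_eq; have -> : (fun N => psum N (fun w => rin ((u + v) w) (z w))) =
  (fun N => psum N (fun w => rin (u w) (z w)) + psum N (fun w => rin (v w) (z w))).
  by apply/funext => N; rewrite -psumD; apply: eq_psum => w _; rewrite l2D rinDl.
by apply: cvgD; exact: l2_rdotP.
Qed.

Lemma l2_rdotZl (r : R) u z : l2_rdot (r%:C *: u) z = r * l2_rdot u z.
Proof.
apply: l2_rdot_eq; have -> : (fun N => psum N (fun w => rin ((r%:C *: u) w) (z w))) =
  (fun N => r * psum N (fun w => rin (u w) (z w))).
  by apply/funext => N; rewrite -psumZ; apply: eq_psum => w _; rewrite l2Z rinZl.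
by apply: cvgM; [exact: cvg_cst|exact: l2_rdotP].
Qed.

Lemma l2_rdot_i u v : l2_rdot u ('i *: v) = - l2_rdot ('i *: u) v.
Proof.
apply: l2_rdot_eq; have -> : (fun N => psum N (fun w => rin (u w) (('i *: v) w))) =
  (fun N => - 1 * psum N (fun w => rin (('i *: u) w) (v w))).
  by apply/funext => N; rewrite -psumZ; apply: eq_psum => w _; rewrite l2Z rin_i mulN1r.
rewrite -[X in _ --> X]mulN1r; apply: cvgM; [exact: cvg_cst|exact: l2_rdotP].
Qed.

(** The identity [Im_inner] dictates the imaginary part, so only real limits have to be taken. *)
Definition l2_dot u v : R[i] := (l2_rdot u v +i* l2_rdot u ('i *: v))%C.

Lemma l2_dotDl u v z : l2_dot (u + v) z = l2_dot u z + l2_dot v z.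
Proof. by rewrite /l2_dot !l2_rdotDl. Qed.

Lemma l2_dotC u v : l2_dot u v = Num.conj (l2_dot v u).
Proof.
apply: complex_eq; rewrite ?Re_conj ?Im_conj /=; first exact: l2_rdotC.
by rewrite l2_rdot_i l2_rdotC.
Qed.

Lemma mulii : ('i * 'i : R[i]) = -1.
Proof. by rewrite -expr2 sqrCi. Qed.

Lemma l2_dotZl a u z : l2_dot (a *: u) z = a * l2_dot u z.
Proof.
have aE : a = (complex.Re a)%:C + (complex.Im a)%:C * 'i.
  by case: a => x y; rewrite -complexiE; apply: complex_eq => /=; ring.
have iu w : l2_rdot ('i *: u) w = - l2_rdot u ('i *: w) by rewrite l2_rdot_i opprK.
have ii : l2_rdot u ('i *: ('i *: z)) = - l2_rdot u z.
  rewrite scalerA mulii scaleN1r -scaleN1r l2_rdotC.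
  by rewrite -(rmorphN1 (real_complex R)) /= l2_rdotZl l2_rdotC mulN1r.
rewrite {1}aE /l2_dot scalerDl -scalerA !l2_rdotDl !l2_rdotZl !iu ii opprK.
by case: a {aE} => x y; apply: complex_eq => /=; ring.
Qed.

Lemma l2_dot_bilinear :
  bilinear_for ( *%R : R[i] -> R[i] -> R[i]) (Num.conj \; *%R) l2_dot.
Proof.
split=> z a u v /=.
  by rewrite l2_dotDl l2_dotZl.
by rewrite l2_dotC l2_dotDl l2_dotZl rmorphD rmorphM (l2_dotC z u) (l2_dotC z v).
Qed.
HB.instance Definition _ := bilinear_isBilinear.Build R[i] l2 l2 R[i] _ _ l2_dot
  l2_dot_bilinear.
Lemma l2_dot_herm u v : l2_dot u v = (-1) ^+ false * Num.conj (l2_dot v u).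
Proof. by rewrite expr0 mul1r l2_dotC. Qed.
HB.instance Definition _ := isHermitianSesquilinear.Build R[i] l2 false Num.conj
  l2_dot l2_dot_herm.

Lemma psum_le_rdot N u : psum N (fun w => n2 (u w)) <= l2_rdot u u.
Proof.
apply: (cvgr_to_ge (l2_rdotP u u)); exists N => // k /= Nk.
by apply: psum_mono => // w; exact: n2_ge0.
Qed.

Lemma l2_dotE u : l2_dot u u = (l2_rdot u u)%:C.
Proof.
apply: complex_eq => //=; have := l2_rdot_i u u; rewrite l2_rdotC => h.
by apply/eqP; move/eqP: h; rewrite -subr_eq0 opprK -mulr2n mulrn_eq0 => /= /eqP h; rewrite h.
Qed.

Lemma l2_dot_gt0 u : u != 0 -> 0 < l2_dot u u.
Proof.
move=> u0; rewrite l2_dotE ltcR.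
have [w uw] : exists w, u w != 0.
  apply: contrapT => h; move/eqP: u0; apply; apply: l2_ext => w.
  by apply/eqP; apply: contrapT => k; apply: h; exists w; apply/negP.
apply: lt_le_trans (psum_le_rdot (size w).+1 u).
apply: lt_le_trans (le_psum (w := w) _ _) => //; last by move=> ?; exact: n2_ge0.
rewrite lt_def n2_ge0 andbT; apply: contra uw => /eqP h.
by apply/eqP/n2_eq0.
Qed.
HB.instance Definition _ := isDotProduct.Build R[i] l2 l2_dot l2_dot_gt0.
HB.instance Definition _ := Lmodule_hasDot.Build R l2 l2_dot.

Lemma rin_l2E u v : rin u v = l2_rdot u v.
Proof. by []. Qed.
Lemma rin_l2 u v : (fun N => psum N (fun w => rin (u w) (v w))) @ \oo --> rin u v.
Proof. by rewrite rin_l2E; exact: l2_rdotP. Qed.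
Arguments rin_l2 : clear implicits.
Lemma n2_l2_le u (M : R) : (forall N, psum N (fun w => n2 (u w)) <= M) -> n2 u <= M.
Proof. by move=> h; apply: (cvgr_to_le (rin_l2 u u)); apply: nearW. Qed.
Lemma psum_n2_le N u : psum N (fun w => n2 (u w)) <= n2 u.
Proof. exact: psum_le_rdot. Qed.
Lemma n2_coord u w : n2 (u w) <= n2 u.
Proof.
apply: le_trans (psum_n2_le (size w).+1 u).
by apply: (le_psum (F := fun w => n2 (u w))) => // ?; exact: n2_ge0.
Qed.

(** Coordinates converge to a family [f] whose square-summability comes indirectly: for a member
    [x1] of a small set of the filter, [x1 - f] is square-summable, and [f] is [x1] minus it. *)
Lemma l2_complete (F : set_system l2) : ProperFilter F -> cauchy F -> cvg F.
Proof.
move=> FF Fc.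
have near2 (e : R) : 0 < e -> exists2 P : set l2, F P &
    forall x y, P x -> P y -> n2 (x - y) <= e.
  move=> e0; have s0 : 0 < (Num.sqrt e)%:C by rewrite ltcR sqrtr_gt0.
  move/cauchy_ballP: Fc => /(_ _ s0); rewrite !near_simpl => -[[P Q] [/= FP FQ] PQ].
  exists (P `&` Q); first exact: filterI.
  move=> x y [Px _] [_ Qy]; have := PQ (x, y) (conj Px Qy).
  rewrite -ball_normE /= => /(norm_ltP _ (sqrtr_ge0 _)).
  by rewrite (sqr_sqrtr (ltW e0)) => /ltW.
have coord w : exists l : V, (fun u : l2 => u w) @ F --> l.
  apply/cvg_ex; apply: cauchy_cvg; apply/cauchyP => _ /gt0_complex[r r0 ->].
  have r2 : 0 < r ^+ 2 / 2 by rewrite divr_gt0 ?exprn_gt0.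
  have [P FP PP] := near2 _ r2; have [x Px] := filter_ex FP.
  exists (x w); change (F [set y : l2 | ball (x w) r%:C (y w)]).
  apply: filterS (FP) => y Py; rewrite /= -ball_normE /=.
  apply/norm_ltP; first exact: ltW.
  have := n2_coord (x - y) w; rewrite l2D l2N => h.
  apply: le_lt_trans h _; apply: le_lt_trans (PP _ _ Px Py) _.
  by rewrite gtr_pMr ?exprn_gt0// invf_lt1// ltr1n.
have [f fP] := choice coord.
(* Fatou's argument: each partial sum involves finitely many coordinates, so the bound on [x - y]
   survives the limit in [y]. *)
have tail (e : R) (P : set l2) x N : F P -> (forall y, P y -> n2 (x - y) <= e) ->
    psum N (fun w => n2 (x w - f w)) <= e.
  move=> FP xP.
  have h : (fun y : l2 => psum N (fun w => n2 (x w - y w))) @ F -->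
      psum N (fun w => n2 (x w - f w)).
    apply: (cvg_bigsum (f := fun k (y : l2) => wsum k (fun w => n2 (x w - y w)))
      (l := fun k => wsum k (fun w => n2 (x w - f w)))) => k.
    apply: (cvg_bigsum (f := fun (w : k.-tuple 'I_n) (y : l2) => n2 (x w - y w))
      (l := fun w : k.-tuple 'I_n => n2 (x w - f w))) => w.
    by apply: n2_cvg; apply: cvgB; [exact: cvg_cst|exact: fP].
  apply: (cvgr_to_le h); apply: filterS (FP) => y Py.
  apply: le_trans (xP _ Py); apply: le_trans (psum_n2_le N (x - y)).
  by rewrite le_eqVlt; apply/orP; left; apply/eqP; apply: eq_psum.
have [P1 FP1 PP1] := near2 1 ltr01; have [x1 Px1] := filter_ex FP1.
have [d dE] : exists d : l2, d =1 (fun w => x1 w - f w).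
  by apply: (l2_mk (M := 1)) => N; apply: (tail 1 P1) => // y; exact: PP1.
apply/cvg_ex; exists (x1 - d).
have limE w : (x1 - d) w = f w by rewrite l2D l2N dE opprB addrC subrK.
apply/cvgrPdist_lt => _ /gt0_complex[r r0 ->].
have r2 : 0 < r ^+ 2 / 2 by rewrite divr_gt0 ?exprn_gt0.
have [P FP PP] := near2 _ r2.
apply: filterS (FP) => y Py; apply/norm_ltP; first exact: ltW.
apply: (@le_lt_trans _ _ (r ^+ 2 / 2)); last first.
  by rewrite gtr_pMr ?exprn_gt0// invf_lt1// ltr1n.
rewrite -n2N opprB; apply: n2_l2_le => N.
apply: le_trans (tail (r ^+ 2 / 2) P y N FP _); last by move=> z Pz; exact: PP.
rewrite le_eqVlt; apply/orP; left; apply/eqP; apply: eq_psum => w _.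
by rewrite l2D l2N limE.
Qed.
HB.instance Definition _ := Uniform_isComplete.Build l2 l2_complete.
End EllTwo.
Arguments l2 {R} n V.

Section EllTwoOperators.
Context {R : realType} {n : nat} {V : hilbertType R}.
Implicit Types u v : l2 n V.

Lemma sqsummableP (f : seq 'I_n -> V) (M : R) :
  (forall N, psum N (fun w => n2 (f w)) <= M) -> f \in @sqsummable R n V.
Proof. by move=> h; apply/asboolP; exists M. Qed.

Lemma eval_linear w : linear (fun u : l2 n V => u w). Proof. by []. Qed.
Lemma eval_bound w (u : l2 n V) : n2 (u w) <= 1 ^+ 2 * n2 u.
Proof. by rewrite expr1n mul1r n2_coord. Qed.
Definition l2_eval w : bop (l2 n V) V := sval (bop_exists (eval_linear w) ler01 (eval_bound w)).
Lemma l2_evalE w u : l2_eval w u = u w.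
Proof. by rewrite /l2_eval; case: bop_exists => T /= ->. Qed.

Lemma shift_sub j u : (fun w => u (rcons w j)) \in @sqsummable R n V.
Proof.
apply: (sqsummableP (M := n2 u)) => N; apply: le_trans (psum_n2_le N.+1 u).
rewrite psumSr ler_wpDl ?n2_ge0// (bigD1 j)//= lerDl; apply: sumr_ge0 => i _.
by apply: psum_ge0 => w; exact: n2_ge0.
Qed.
Definition shift_fun j u : l2 n V := L2 (shift_sub j u).

(** Sorting the nonempty words by their last letter is exact at each finite stage, and the limit
    keeps the bound. *)
Lemma shift_sum u : \sum_j n2 (shift_fun j u) + n2 (u [::]) <= n2 u.
Proof.
have h : (fun N => \sum_j psum N (fun w => n2 (shift_fun j u w)) + n2 (u [::])) @ \oo -->
    \sum_j n2 (shift_fun j u) + n2 (u [::]).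
  apply: cvgD; last exact: cvg_cst.
  apply: (cvg_bigsum (f := fun j N => psum N (fun w => n2 (shift_fun j u w)))
    (l := fun j => n2 (shift_fun j u))) => j.
  exact: (@rin_l2 _ _ _ (shift_fun j u) (shift_fun j u)).
apply: (cvgr_to_le h); apply: nearW => N.
by apply: le_trans (psum_n2_le N.+1 u); rewrite psumSr addrC.
Qed.

Lemma shift_linear j : linear (shift_fun j).
Proof. by move=> a u v; apply: l2_ext => w. Qed.
Lemma shift_bound j u : n2 (shift_fun j u) <= 1 ^+ 2 * n2 u.
Proof.
rewrite expr1n mul1r; apply: le_trans (shift_sum u).
rewrite (bigD1 j)//= -addrA lerDl addr_ge0 ?n2_ge0//.
by apply: sumr_ge0 => i _; exact: n2_ge0.
Qed.
Definition l2_shift j : bop (l2 n V) (l2 n V) :=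
  sval (bop_exists (shift_linear j) ler01 (shift_bound j)).
Lemma l2_shiftE j u w : l2_shift j u w = u (rcons w j).
Proof. by rewrite /l2_shift; case: bop_exists => T /= ->. Qed.
Lemma l2_shift_sum u : \sum_j n2 (l2_shift j u) + n2 (l2_eval [::] u) <= n2 u.
Proof.
rewrite l2_evalE; apply: le_trans (shift_sum u); rewrite lerD2r; apply: ler_sum => j _.
by rewrite le_eqVlt; apply/orP; left; apply/eqP; congr n2; apply: l2_ext => w; rewrite l2_shiftE.
Qed.

Lemma psum_delta N (w : seq 'I_n) (v : V) : psum N (fun w' => n2 (if w' == w then v else 0)) <= n2 v.
Proof.
rewrite (eq_psum (G := fun w' => if w' == w then n2 v else 0)).
  by rewrite (psum_pick _ (fun=> n2 v)); case: ifP; rewrite ?n2_ge0.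
by move=> w' _; case: ifP; rewrite ?n2_0.
Qed.

Definition delta_fun w (v : V) : l2 n V :=
  L2 (sqsummableP (fun N => psum_delta N w v)).
Lemma delta_linear w : linear (delta_fun w).
Proof.
move=> a x y; apply: l2_ext => w'; rewrite l2D l2Z /=.
by case: eqP => // _; rewrite scaler0 addr0.
Qed.
Lemma delta_bound w (v : V) : n2 (delta_fun w v) <= 1 ^+ 2 * n2 v.
Proof. by rewrite expr1n mul1r; apply: n2_l2_le => N; exact: psum_delta. Qed.
Definition l2_delta w : bop V (l2 n V) :=
  sval (bop_exists (delta_linear w) ler01 (delta_bound w)).
Lemma l2_deltaE w (v : V) w' : l2_delta w v w' = if w' == w then v else 0.
Proof. by rewrite /l2_delta; case: bop_exists => T /= ->. Qed.
Lemma n2_delta w (v : V) : n2 (l2_delta w v) <= n2 v.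
Proof. by apply: n2_l2_le => N; under eq_psum do rewrite l2_deltaE; exact: psum_delta. Qed.

Definition l2_trunc N u : l2 n V := psum N (fun w => l2_delta w (u w)).

Lemma l2_truncE N u w : l2_trunc N u w = if (size w < N)%N then u w else 0.
Proof.
rewrite /l2_trunc -[LHS]l2_evalE raddf_psum.
rewrite (eq_psum (G := fun w' => if w' == w then u w' else 0)) ?psum_pick// => w' _.
by rewrite /= l2_evalE l2_deltaE eq_sym.
Qed.

Lemma l2_trunc_cvg u : (fun N => l2_trunc N u) @ \oo --> u.
Proof.
apply/cvg_n2.
(* The squared distance from [u] to its truncation is this tail. *)
have h : (fun N => n2 u - psum N (fun w => n2 (u w))) @ \oo --> (0 : R).
  rewrite -[X in _ --> X](subrr (n2 u)); apply: cvgB; first exact: cvg_cst.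
  exact: (@rin_l2 _ _ _ u u).
apply: (squeeze0 h (c := 1)); apply: nearW => N; rewrite n2_ge0 mul1r.
apply: n2_l2_le => M; rewrite lerBrDr.
apply: le_trans (psum_n2_le (M + N) u).
apply: (@le_trans _ _ (psum (M + N) (fun w => n2 ((l2_trunc N u - u) w)) +
    psum N (fun w => n2 (u w)))).
  by rewrite lerD2r; apply: psum_mono; [move=> w; exact: n2_ge0|exact: leq_addr].
have tE w : n2 ((l2_trunc N u - u) w) = if (size w < N)%N then 0 else n2 (u w).
  by rewrite l2D l2N l2_truncE; case: ifP; rewrite ?subrr ?n2_0// sub0r n2N.
rewrite /psum [in leRHS](big_cat_nat (n := N)) ?leq_addl//= addrC lerD2l.
rewrite (big_cat_nat (n := N)) ?leq_addl//= big_nat big1 ?add0r.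
  rewrite le_eqVlt; apply/orP; left; apply/eqP; apply: eq_big_nat => k /andP[Nk _].
  by apply: eq_wsum => w wk; rewrite tE wk ltnNge Nk.
move=> k /andP[_ kN]; rewrite (eq_wsum (G := fun=> 0)) /wsum ?big1// => w wk.
by rewrite tE wk kN.
Qed.

Lemma l2_op_exists (E : hilbertType R) (A : seq 'I_n -> bop E V) :
  (forall N x, psum N (fun w => n2 (A w x)) <= n2 x) ->
  exists O : bop E (l2 n V), (forall x w, O x w = A w x) /\ forall x, n2 (O x) <= n2 x.
Proof.
move=> hA; pose f x : l2 n V := L2 (sqsummableP (fun N => hA N x)).
have fl : linear f by move=> a x y; apply: l2_ext => w; rewrite /= linearP.
have fb x : n2 (f x) <= 1 ^+ 2 * n2 x by rewrite expr1n mul1r; apply: n2_l2_le => N; exact: hA.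
have [T TE] := bop_exists fl ler01 fb.
exists T; split=> [x w|x]; first by rewrite TE.
by apply: n2_l2_le => N; under eq_psum do rewrite TE; exact: hA.
Qed.
End EllTwoOperators.

(** * Tensor product of square-summable families with a Hilbert space *)

Section EllTwoTensor.
Context {R : realType} (n : nat) {V H : hilbertType R} (VH : hilbert_tensor V H).

Lemma n2_tens (v : V) (h : H) : n2 (tens VH v h) = n2 v * n2 h.
Proof. by rewrite /n2 {1}/rin inner_tens !n2C -rmorphM. Qed.

Lemma l2_tens_sub (u : l2 n V) (h : H) : (fun w => tens VH (u w) h) \in @sqsummable R n VH.
Proof.
apply: (sqsummableP (M := n2 h * n2 u)) => N.
have -> : psum N (fun w => n2 (tens VH (u w) h)) = n2 h * psum N (fun w => n2 (u w)).
  by rewrite -psumZ; apply: eq_psum => w _; rewrite n2_tens mulrC.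
by rewrite ler_wpM2l ?n2_ge0// psum_n2_le.
Qed.
Definition l2_tens (u : l2 n V) (h : H) : l2 n VH := L2 (l2_tens_sub u h).

Lemma l2_tensE u h w : l2_tens u h w = tens VH (u w) h.
Proof. by []. Qed.

Lemma l2_tens_bilinear : bilinear_for *:%R *:%R l2_tens.
Proof.
split=> z a u v; apply: l2_ext => w.
  exact: linearPl.
exact: linearPr.
Qed.
HB.instance Definition _ := bilinear_isBilinear.Build R[i] (l2 n V) H (l2 n VH) _ _
  l2_tens l2_tens_bilinear.

Lemma rin_l2_tens u h v k : rin (l2_tens u h) (l2_tens v k) =
  complex.Re (inner u v * inner h k).
Proof.
apply: (cvg_uniq (V := R^o) (F := \oo) (u := fun N => psum N (fun w => rin (l2_tens u h w) (l2_tens v k w)))).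
  exact: (@rin_l2 _ _ _ (l2_tens u h) (l2_tens v k)).
have -> : (fun N => psum N (fun w => rin (l2_tens u h w) (l2_tens v k w))) =
  (fun N => complex.Re (inner h k) * psum N (fun w => rin (u w) (v w)) +
    - complex.Im (inner h k) * psum N (fun w => rin (u w) (('i *: v) w))).
  apply/funext => N; rewrite -!psumZ -psumD; apply: eq_psum => w _.
  rewrite !l2_tensE {1}/rin inner_tens l2Z -Im_inner /rin.
  by case: (inner (u w) (v w)) => a b; case: (inner h k) => c d /=; ring.
have -> : complex.Re (inner u v * inner h k) = complex.Re (inner h k) * rin u v +
    - complex.Im (inner h k) * rin u ('i *: v).
  rewrite -Im_inner /rin.
  by case: (inner u v) => a b; case: (inner h k) => c d /=; ring.
apply: cvgD; apply: cvgM; (try exact: cvg_cst).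
  exact: (@rin_l2 _ _ _ u v).
exact: (@rin_l2 _ _ _ u ('i *: v)).
Qed.

Lemma l2_inner_tens u h v k : inner (l2_tens u h) (l2_tens v k) = inner u v * inner h k.
Proof.
apply: complex_eq; first exact: rin_l2_tens.
rewrite Im_inner.
have -> : 'i *: l2_tens v k = l2_tens v ('i *: k) by rewrite linearZr_LR.
rewrite rin_l2_tens innerZr conjCi.
by case: (inner u v) => a b; case: (inner h k) => c d; rewrite -complexiE /=; ring.
Qed.

Definition l2_tsum (s : seq (l2 n V * H)) : l2 n VH := \sum_(x <- s) l2_tens x.1 x.2.
Definition approximable (u : l2 n VH) := forall e : R, 0 < e -> exists s, n2 (u - l2_tsum s) < e.

Lemma approximableD u v : approximable u -> approximable v -> approximable (u + v).
Proof.
(* [n2D_le] costs a factor [2] on the sum of two errors, hence [e / 4] for each. *)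
move=> ua va e e0; have e4 : 0 < e / 4 by rewrite divr_gt0.
have [s us] := ua _ e4; have [t vt] := va _ e4.
exists (s ++ t); rewrite /l2_tsum big_cat opprD addrACA.
by apply: le_lt_trans (n2D_le _ _) _; move: us vt; rewrite /l2_tsum; lra.
Qed.

Lemma approximable0 : approximable 0.
Proof. by move=> e e0; exists [::]; rewrite /l2_tsum big_nil subr0 n2_0. Qed.

Lemma approximable_delta w (v : VH) : approximable (l2_delta w v).
Proof.
move=> e e0; have [s vs] := tsum_dense v e0.
exists [seq (l2_delta w x.1, x.2) | x <- s].
have -> : l2_tsum [seq (l2_delta w x.1, x.2) | x <- s] = l2_delta w (tsum VH s).
  rewrite /l2_tsum big_map /tsum raddf_sum; apply: eq_bigr => x _.
  apply: l2_ext => w' /=; rewrite !l2_deltaE; case: eqP => // _.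
  by rewrite linear0l.
by rewrite -linearB; apply: le_lt_trans (n2_delta _ _) vs.
Qed.

Lemma approximable_all u : approximable u.
Proof.
move=> e e0; have e4 : 0 < e / 4 by rewrite divr_gt0.
have tr N : approximable (l2_trunc N u).
  rewrite /l2_trunc /psum; apply: (big_ind approximable); first exact: approximable0.
    exact: approximableD.
  move=> k _; apply: (big_ind approximable); first exact: approximable0.
    exact: approximableD.
  by move=> w _; exact: approximable_delta.
have /cvg_n2/cvgrPdist_lt/(_ _ e4)[N _ NP] := @l2_trunc_cvg _ _ _ u.
have := NP N (leqnn N); rewrite /= sub0r normrN ger0_norm ?n2_ge0// => h1.
have [s h2] := tr N _ e4.
exists s; have -> : u - l2_tsum s = (u - l2_trunc N u) + (l2_trunc N u - l2_tsum s).
  by rewrite addrA subrK.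
apply: le_lt_trans (n2D_le _ _) _; rewrite -n2N opprB in h1.
by move: h1 h2; lra.
Qed.

Lemma l2_tens_dense : dense [set u : l2 n VH |
    exists (k : nat) (e : 'I_k -> l2 n V) (h : 'I_k -> H), u = \sum_i l2_tens (e i) (h i)].
Proof.
move=> O [u Ou] oO.
have /nbhs_ballP[_ /gt0_complex[r r0 ->] rO] : nbhs u O by apply: open_nbhs_nbhs.
have r2 : 0 < r ^+ 2 by rewrite exprn_gt0.
have [s us] := approximable_all u r2.
exists (l2_tsum s); split.
  by apply: rO; rewrite -ball_normE /=; apply/norm_ltP; rewrite ?ltW.
exists (size s), (fun i => (tnth (in_tuple s) i).1), (fun i => (tnth (in_tuple s) i).2).
by rewrite /l2_tsum big_tnth.
Qed.

(** Tensor products are given for [E], [Y] and the column space only. The state space of the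
    realization also needs one, and families with values in [VH], tensored coordinatewise, provide
    it. *)
Definition l2_tensor : hilbert_tensor (l2 n V) H :=
  @HilbertTensor R (l2 n V) H (l2 n VH) l2_tens l2_inner_tens l2_tens_dense.
End EllTwoTensor.

(** * Realizations *)

Section HomogeneousParts.
Context {R : realType} {n : nat} {E Y H : hilbertType R}.
Variables (EH : hilbert_tensor E H) (YH : hilbert_tensor Y H).
Implicit Types (A : seq 'I_n -> bop E Y) (X : 'I_n -> bop H H).

Definition homog A X k : bop EH YH := wsum k (fun w => otens EH YH (A w) (word_eval X w)).

Lemma rin_gram A k x y : rin (gram A k x) y = wsum k (fun w => rin (A w x) (A w y)).
Proof.
rewrite /gram bop_sum rin_suml; apply: eq_bigr => w _.
by rewrite /= [LHS]rinC -rin_adj rinC.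
Qed.

(** For the Gram operator [G], [2 t Re <A_w x, A_w G x> <= t^2 |A_w x|^2 + |A_w G x|^2] summed over
    words, taken at [t = c], gives [|G x|^2 <= c^2 |x|^2] up to a factor [c]. *)
Lemma opnorm_gram A k (c : R) : 0 <= c -> (forall x, wsum k (fun w => n2 (A w x)) <= c * n2 x) ->
  opnorm (gram A k) <= c.
Proof.
move=> c0 h; apply: opnorm_le_n2 => // x.
set G := gram A k.
have key (t : R) : 2 * t * n2 (G x) <= t ^+ 2 * (c * n2 x) + c * n2 (G x).
  have -> : n2 (G x) = wsum k (fun w => rin (A w x) (A w (G x))) by rewrite -rin_gram.
  rewrite -[X in _ + c * X]rin_gram -/(n2 (G x)).
  apply: (@le_trans _ _ (wsum k (fun w => t ^+ 2 * n2 (A w x) + n2 (A w (G x))))).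
    rewrite -wsumZ; apply: ler_sum => w _.
    by have := n2_ge0 (t%:C *: A w x - A w (G x)); rewrite n2B n2ZR rinZl; lra.
  by rewrite wsumD wsumZ lerD// ler_wpM2l// sqr_ge0.
have [e|cn0] := eqVneq c 0; first by have := key 1; rewrite e; lra.
have cp : 0 < c by rewrite lt_def cn0.
by rewrite -(ler_pM2l cp); have := key c; lra.
Qed.

Lemma limsup_gram A : (forall k, opnorm (gram A k) <= 1) ->
  (limn_esup (fun k => (opnorm (gram A k) `^ (2 * k%:R)^-1)%:E) <= 1)%E.
Proof.
move=> h; rewrite limn_esup_lim; apply: lime_le; first exact: is_cvg_esups.
apply: nearW => N; apply: ge_ereal_sup => _ [k /= _ <-].
(* At [k = 0] the exponent is [0^-1 = 0], still nonnegative, so monotonicity of the power covers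
   every [k]. *)
have -> : 1%E = (1 `^ (2 * k%:R)^-1)%:E :> \bar R by rewrite powR1.
rewrite lee_fin.
by apply: ge0_ler_powR; rewrite ?nnegrE ?invr_ge0 ?mulr_ge0 ?opnorm_ge0.
Qed.
End HomogeneousParts.

Section ColumnParts.
Context {R : realType} {n : nat} {E Y H : hilbertType R}.
Variables (EH : hilbert_tensor E H) (YH : hilbert_tensor Y H).
Variable CH : hilbert_tensor (hsum Y (hpow n E)) H.

Definition in_fst : bop Y (hsum Y (hpow n E)) := hsum_inl Y (hpow n E).
Definition in_snd i : bop E (hsum Y (hpow n E)) :=
  bop_comp (hsum_inr Y (hpow n E)) (hpow_in E i).
Definition pr_fst : bop (hsum Y (hpow n E)) Y := hsum_fstb Y (hpow n E).
Definition pr_snd i : bop (hsum Y (hpow n E)) E :=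
  bop_comp (hpow_projb E i) (hsum_sndb Y (hpow n E)).

Lemma pr_fst_in : bop_comp pr_fst in_fst = bop_id Y.
Proof. exact: bop_ext. Qed.
Lemma pr_fst_in_snd i : bop_comp pr_fst (in_snd i) = 0.
Proof. exact: bop_ext. Qed.
Lemma pr_snd_in_fst i : bop_comp (pr_snd i) in_fst = 0.
Proof. by apply: bop_ext => x; rewrite /= /hpow_proj ffunE. Qed.
Lemma pr_snd_in i j : bop_comp (pr_snd i) (in_snd j) = if i == j then bop_id E else 0.
Proof. by apply: bop_ext => x; rewrite /= /hpow_proj ffunE; case: ifP. Qed.

Lemma adj_uniq (U V : hilbertType R) (S : bop U V) (T : bop V U) :
  (forall x y, rin (S x) y = rin x (T y)) -> adj S = T.
Proof.
by move=> h; apply: bop_ext => y; apply: rin_ext => z; rewrite -h rin_adj.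
Qed.

Lemma inner_hsum (W Z : hilbertType R) (u v : hsum W Z) :
  inner u v = inner u.1 v.1 + inner u.2 v.2.
Proof. by []. Qed.

Lemma adj_in_fst : adj in_fst = pr_fst.
Proof.
apply: adj_uniq => x y; rewrite /rin inner_hsum /=.
by rewrite inner0l addr0.
Qed.

Lemma adj_in_snd i : adj (in_snd i) = pr_snd i.
Proof.
apply: adj_uniq => x y; rewrite /rin inner_hsum /= inner0l add0r inner_hpow (bigD1 i)//= big1 ?addr0.
  by rewrite ffunE eqxx.
by move=> j ji; rewrite ffunE (negPf ji) inner0l.
Qed.

Definition tcol (y : YH) (z : 'I_n -> EH) : CH :=
  otens YH CH in_fst (bop_id H) y + \sum_i otens EH CH (in_snd i) (bop_id H) (z i).

Lemma tcol_fst y z : otens CH YH pr_fst (bop_id H) (tcol y z) = y.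
Proof.
have h (W : hilbertType R) (WH : hilbert_tensor W H) (J : bop W (hsum Y (hpow n E))) x :
    otens CH YH pr_fst (bop_id H) (otens WH CH J (bop_id H) x) =
    otens WH YH (bop_comp pr_fst J) (bop_id H) x.
  by rewrite -[LHS]/(bop_comp (otens CH YH pr_fst (bop_id H)) (otens WH CH J (bop_id H)) x) otens_comp bop_comp1l.
rewrite /tcol linearD /= h pr_fst_in otens_id raddf_sum big1 ?addr0// => i _.
by rewrite /= h pr_fst_in_snd otens0l.
Qed.

Lemma tcol_snd y z i : otens CH EH (pr_snd i) (bop_id H) (tcol y z) = z i.
Proof.
have h (W : hilbertType R) (WH : hilbert_tensor W H) (J : bop W (hsum Y (hpow n E))) x :
    otens CH EH (pr_snd i) (bop_id H) (otens WH CH J (bop_id H) x) =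
    otens WH EH (bop_comp (pr_snd i) J) (bop_id H) x.
  by rewrite -[LHS]/(bop_comp (otens CH EH (pr_snd i) (bop_id H)) (otens WH CH J (bop_id H)) x) otens_comp bop_comp1l.
rewrite /tcol linearD /= h pr_snd_in_fst otens0l add0r raddf_sum (bigD1 i)//= big1 ?addr0.
  by rewrite h pr_snd_in eqxx otens_id.
by move=> j ji; rewrite h pr_snd_in eq_sym (negPf ji) otens0l.
Qed.

(** [CH] is an arbitrary tensor product of the direct sum with [H]; that it splits into orthogonal
    components follows from the adjoints of the coordinate inclusions, which are the projections. *)
Lemma n2_tcol y z : n2 (tcol y z) = n2 y + \sum_i n2 (z i).
Proof.
rewrite {1}/n2 {2}/tcol rinDr rin_sumr; congr (_ + _).
  by rewrite rinC otens_adj adj_in_fst tcol_fst.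
by apply: eq_bigr => i _; rewrite rinC otens_adj adj_in_snd tcol_snd.
Qed.

Lemma columnE (L : opball n H -> bop EH YH) (M : 'I_n -> opball n H -> bop EH EH) X x :
  column EH YH CH L M X x = tcol (L X x) (fun i => M i X x).
Proof. by rewrite /column /tcol bopD bop_sum. Qed.
End ColumnParts.

Section Realization.
Context {R : realType} {n : nat} {E Y K H : hilbertType R}.
Variables (EH : hilbert_tensor E H) (YH : hilbert_tensor Y H) (KH : hilbert_tensor K H).
Variable CH : hilbert_tensor (hsum Y (hpow n E)) H.
Variables (T : 'I_n -> bop K K) (P : bop K Y) (V : bop E K).
Hypothesis T_col : forall u, \sum_j n2 (T j u) + n2 (P u) <= n2 u.
Hypothesis V_contr : forall x, n2 (V x) <= n2 x.

Local Notation ampl A := (otens _ _ A (bop_id H)).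

Lemma T_sum_le u : \sum_j n2 (T j u) <= n2 u.
Proof. by apply: le_trans (T_col u); rewrite lerDl n2_ge0. Qed.

Lemma Vadj_contr k : n2 (adj V k) <= n2 k.
Proof.
by rewrite -[leRHS]mul1r; apply: n2_adj => // x; rewrite mul1r.
Qed.

Definition codefect : bop K K := bop_id K - bop_comp V (adj V).

Lemma codefect_contr k : n2 (codefect k) <= n2 k.
Proof.
rewrite /codefect bopB /= n2B [rin k _]rinC rin_adj -/(n2 (adj V k)).
by have := V_contr (adj V k); have := n2_ge0 (adj V k); lra.
Qed.

Definition feedback j : bop K K := bop_comp codefect (T j).

Lemma feedback_sum_le u : \sum_j n2 (feedback j u) <= n2 u.
Proof.
by apply: le_trans (T_sum_le u); apply: ler_sum => j _; exact: codefect_contr.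
Qed.

Definition output : bop K (hsum Y (hpow n E)) :=
  bop_comp (@in_fst R n E Y) P + \sum_j bop_comp (@in_snd R n E Y j) (bop_comp (adj V) (T j)).

(** The coefficient at [w] of the column [[L; M]]: the words in [feedback] come from the Neumann
    expansion of [R], and [output] stacks [P] with the [V^* T_j]. *)
Definition transfer w : bop E (hsum Y (hpow n E)) :=
  bop_comp output (bop_comp (word_eval feedback w) V).

Lemma n2_output u : n2 (output u) = n2 (P u) + \sum_j n2 (adj V (T j u)).
Proof.
have e1 : (output u).1 = P u.
  rewrite -[LHS]/(pr_fst (output u)) /output bopD bop_sum linearD raddf_sum /= big1 ?addr0//.
have e2 j : (output u).2 j = adj V (T j u).
  rewrite -[LHS]/(pr_snd j (output u)) /output bopD bop_sum linearD raddf_sum /=.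
  rewrite -[X in X + _]/(bop_comp (pr_snd j) (@in_fst R n E Y) (P u)) pr_snd_in_fst bop0 add0r.
  rewrite (bigD1 j)//= big1 ?addr0; first by rewrite /hpow_proj ffunE eqxx.
  by move=> i ij; rewrite /hpow_proj ffunE eq_sym (negPf ij).
by rewrite n2_hsum n2_hpow e1; under eq_bigr do rewrite e2.
Qed.

Lemma output_contr u : n2 (output u) <= n2 u.
Proof.
rewrite n2_output addrC; apply: le_trans (T_col u); rewrite lerD2r.
by apply: ler_sum => j _; exact: Vadj_contr.
Qed.

Lemma word_sum_le (S : 'I_n -> bop K K) : (forall u, \sum_j n2 (S j u) <= n2 u) ->
  forall k u, wsum k (fun w => n2 (word_eval S w u)) <= n2 u.
Proof.
move=> S_le; elim=> [|k IH] u; first by rewrite wsum0.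
rewrite wsumS /= -wsum_big; apply: le_trans (IH u).
by apply: ler_sum => w _; exact: S_le.
Qed.

Lemma transfer_gram k x : wsum k (fun w => n2 (transfer w x)) <= 1 * n2 x.
Proof.
rewrite mul1r; apply: le_trans (V_contr x).
apply: le_trans (word_sum_le feedback_sum_le k (V x)).
by apply: ler_sum => w _; exact: output_contr.
Qed.

Variables (X : 'I_n -> bop H H) (rho : R).
Hypothesis rho01 : 0 <= rho < 1.
Hypothesis X_row : row_bound X (rho ^+ 2).

Definition pencil (S : 'I_n -> bop K K) : bop KH KH := \sum_j otens KH KH (S j) (X j).

Lemma pencilE S u : pencil S u =
  \sum_j otens KH KH (bop_id K) (X j) (otens KH KH (S j) (bop_id H) u).
Proof.
rewrite bop_sum; apply: eq_bigr => j _.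
by rewrite -[RHS]/(bop_comp (otens KH KH (bop_id K) (X j)) (otens KH KH (S j) (bop_id H)) u) otens_comp bop_comp1l bop_comp1r.
Qed.

Lemma pencil_feedback : pencil feedback = bop_comp (otens KH KH codefect (bop_id H)) (pencil T).
Proof.
rewrite /pencil bop_comp_sumr; apply: eq_bigr => j _.
by rewrite otens_comp bop_comp1l.
Qed.

Lemma T_tensor u : \sum_j n2 (otens KH KH (T j) (bop_id H) u) +
  n2 (otens KH YH P (bop_id H) u) <= n2 u.
Proof.
rewrite -[leRHS]mul1r; apply: column_tensor => x; by rewrite mul1r.
Qed.

(** The pencil is the row of the [I (x) X_j], of norm at most [rho], after the column of the
    [S_j (x) I], of norm at most [1]. *)
Lemma opnorm_pencil (S : 'I_n -> bop K K) : (forall u : K, \sum_j n2 (S j u) <= n2 u) -> opnorm (pencil S) <= rho.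
Proof.
move=> S_le; have [r0 r1] := andP rho01; apply: opnorm_le_n2 => // u.
rewrite pencilE; apply: le_trans (row_tensor_le X_row _) _.
apply: ler_wpM2l; first by rewrite exprn_ge0.
have h (x : K) : \sum_j n2 (S j x) + n2 ((0 : bop K K) x) <= 1 * n2 x.
  by rewrite bop0 n2_0 addr0 mul1r.
have := @column_tensor _ _ _ _ _ _ KH KH KH _ _ _ h u.
by rewrite otens0l bop0 n2_0 addr0 mul1r.
Qed.

Lemma pencil_pow S k : bop_pow (pencil S) k = homog KH KH (word_eval S) X k.
Proof.
elim: k => [|k IH]; first by rewrite /homog wsum0 /= otens_id.
rewrite /= IH /homog wsumS /pencil bop_comp_suml; apply: eq_bigr => j _.
rewrite /wsum bop_comp_sumr; apply: eq_bigr => w _.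
by rewrite otens_comp.
Qed.

Lemma pencil_pow_comp (W : hilbertType R) (WH : hilbert_tensor W H) S (G : bop K W) k :
  bop_comp (otens KH WH G (bop_id H)) (bop_comp (bop_pow (pencil S) k) (otens EH KH V (bop_id H))) =
  homog EH WH (fun w => bop_comp G (bop_comp (word_eval S w) V)) X k.
Proof.
rewrite pencil_pow /homog /wsum bop_comp_suml bop_comp_sumr; apply: eq_bigr => w _.
by rewrite !otens_comp bop_comp1l bop_comp1r.
Qed.

Lemma pencil_series (W : hilbertType R) (WH : hilbert_tensor W H) S (G : bop K W) (Q : bop KH KH) :
  series (bop_pow (pencil S)) @ \oo --> Q ->
  series (homog EH WH (fun w => bop_comp G (bop_comp (word_eval S w) V)) X) @ \oo -->
  bop_comp (otens KH WH G (bop_id H)) (bop_comp Q (otens EH KH V (bop_id H))).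
Proof.
move=> SQ.
have -> : series (homog EH WH (fun w => bop_comp G (bop_comp (word_eval S w) V)) X) =
   (fun N => bop_comp (otens KH WH G (bop_id H))
     (bop_comp (series (bop_pow (pencil S)) N) (otens EH KH V (bop_id H)))).
  apply/funext => N; rewrite /series /= bop_comp_suml bop_comp_sumr.
  by apply: eq_bigr => k _; rewrite pencil_pow_comp.
by apply: bop_cvg_comp; apply: bop_cvg_compr.
Qed.

(* Energy balance: [v = Vx + y - VV*y] with [y = sum_j X_j T_j v], and
   [|y|^2 - |V*y|^2 <= sum_j (|T_j v|^2 - |V*T_j v|^2)] since [I - VV* >= 0]. *)
Lemma transfer_energy (x : EH) (v : KH) :
  v = otens EH KH V (bop_id H) x + pencil feedback v ->
  n2 (otens KH YH P (bop_id H) v) +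
    \sum_j n2 (otens KH EH (adj V) (bop_id H) (otens KH KH (T j) (bop_id H) v)) <= n2 x.
Proof.
move=> ve; have [r0 r1] := andP rho01.
set VH := otens EH KH V (bop_id H) in ve *; set VHa := otens KH EH (adj V) (bop_id H).
pose yj j := otens KH KH (T j) (bop_id H) v.
pose y := \sum_j otens KH KH (bop_id K) (X j) (yj j).
have vE : v = y + VH (x - VHa y).
  rewrite {1}ve pencil_feedback /= pencilE -/y /codefect otensBl otens_id bopB /=.
  have -> : otens KH KH (bop_comp V (adj V)) (bop_id H) y = VH (VHa y).
    by rewrite -[RHS]/(bop_comp VH VHa y) otens_comp bop_comp1l.
  by rewrite linearB addrCA.
have c1 : \sum_j n2 (yj j) + n2 (otens KH YH P (bop_id H) v) <= n2 v := T_tensor v.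
have c2 := @row_tensor _ _ _ _ _ KH EH _ _ _ Vadj_contr X_row yj y erefl.
rewrite -/y -/VHa in c2.
have VHc (u : EH) : n2 (VH u) <= n2 u.
  by rewrite -[leRHS]mul1r; apply: contraction_tensor => z; rewrite mul1r.
have VHac (u : KH) : n2 (VHa u) <= n2 u.
  by rewrite -[leRHS]mul1r; apply: contraction_tensor => z; rewrite mul1r Vadj_contr.
have c3 : n2 v <= n2 y + n2 x - n2 (VHa y).
  (* The cross term [2 Re <V^* y, x - V^* y>] cancels the mixed term of [|x - V^* y|^2] and leaves
     [- |V^* y|^2]. *)
  rewrite vE n2D; have := VHc (x - VHa y); rewrite n2B.
  rewrite (rinC y) otens_adj -/VHa rinBl -/(n2 (VHa y)); lra.
have c4 : rho ^+ 2 * (\sum_j (n2 (yj j) - n2 (VHa (yj j)))) <=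
    \sum_j (n2 (yj j) - n2 (VHa (yj j))).
  rewrite ler_piMl//; last by rewrite exprn_ile1// ltW.
  by apply: sumr_ge0 => j _; rewrite subr_ge0.
rewrite sumrB in c4; rewrite sumrB in c2.
by move: c1 c2 c3 c4; rewrite /yj; lra.
Qed.
End Realization.

Section SquareSummableCoefficients.
Context {R : realType} {n : nat} {E Y : hilbertType R}.
Implicit Types A : seq 'I_n -> bop E Y.

(** The partial sums are the quadratic forms of the partial Gram sums; they increase to
    [<S x, x>]. *)
Lemma H2norm_le1_psum A : (H2norm A <= 1)%E ->
  forall N x, psum N (fun w => n2 (A w x)) <= n2 x.
Proof.
rewrite /H2norm; case: asboolP => [exS|_]; last by rewrite leNgt ltry.
case: xgetP => [S _ SP|/(_ _)]; last by case: exS => S SP /(_ S).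
rewrite lee_fin => S1 N x.
have S1' : opnorm S <= 1.
  have := opnorm_ge0 S; rewrite -[opnorm S]sqr_sqrtr ?opnorm_ge0// => _.
  by rewrite exprn_ile1// sqrtr_ge0.
have sE k : rin (series (fun k => gram A k x) k) x = psum k (fun w => n2 (A w x)).
  by rewrite /series /= rin_suml; apply: eq_bigr => i _; rewrite rin_gram.
have h : (fun k => psum k (fun w => n2 (A w x))) @ \oo --> rin (S x) x.
  have -> : (fun k => psum k (fun w => n2 (A w x))) =
    (fun k => rin (series (fun k => gram A k x) k) x) by apply/funext => k; rewrite sE.
  exact: rin_cvg (SP x).
apply: (@le_trans _ _ (rin (S x) x)).
  apply: (cvgr_to_ge h); exists N => // k /= Nk.
  by apply: psum_mono => // w; exact: n2_ge0.
rewrite -[leRHS](sqr_sqrtr (n2_ge0 x)) expr2; apply: rin_le; rewrite ?sqrtr_ge0//.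
  by rewrite sqr_sqrtr ?n2_ge0// n2_bop1.
by rewrite sqr_sqrtr ?n2_ge0.
Qed.
End SquareSummableCoefficients.

(* Shifts append letters on the right, so that [l2_eval [::]] after
   [word_eval l2_shift v] reads off the coefficient at [v] itself. *)
Lemma word_eval_shift (R : realType) n (Y : hilbertType R) (v : seq 'I_n) (u : l2 n Y) w :
  word_eval (@l2_shift R n Y) v u w = u (w ++ v).
Proof.
elim: v w => [|j v IH] w; first by rewrite cats0.
by rewrite /= l2_shiftE IH cat_rcons.
Qed.

(** * From a realization of the coefficients to a Schur class column *)

Section Forward.
Context {R : realType} {n : nat} {E Y K H : hilbertType R}.
Variables (EH : hilbert_tensor E H) (YH : hilbert_tensor Y H) (KH : hilbert_tensor K H).
Variable CH : hilbert_tensor (hsum Y (hpow n E)) H.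
Variables (T : 'I_n -> bop K K) (P : bop K Y) (V : bop E K).
Hypothesis T_col : forall u, \sum_j n2 (T j u) + n2 (P u) <= n2 u.
Hypothesis V_contr : forall x, n2 (V x) <= n2 x.

Local Notation VH := (otens EH KH V (bop_id H)).
Local Notation VHa := (otens KH EH (adj V) (bop_id H)).
Local Notation fb X := (pencil KH X (feedback T V)).

Lemma output_tensor v : otens KH CH (output T P V) (bop_id H) v =
  tcol CH (otens KH YH P (bop_id H) v)
    (fun i => VHa (otens KH KH (T i) (bop_id H) v)).
Proof.
rewrite /output otensDl otens_suml bopD bop_sum /tcol; congr (_ + _).
  by rewrite -[RHS]/(bop_comp (otens YH CH _ (bop_id H)) (otens KH YH P (bop_id H)) v) otens_comp bop_comp1l.
apply: eq_bigr => i _.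
rewrite -[RHS]/(bop_comp (otens EH CH (@in_snd R n E Y i) (bop_id H))
  (bop_comp VHa (otens KH KH (T i) (bop_id H))) v).
by rewrite !otens_comp !bop_comp1l.
Qed.

Section AtPoint.
Variables (X : 'I_n -> bop H H) (Q Q0 : bop KH KH).
Hypothesis Q_inv : bop_inverse (bop_id KH - fb X) Q.
Hypothesis Q0_inv : bop_inverse (bop_id KH - pencil KH X T) Q0.

Local Notation Z := (pencil KH X T).

Lemma fbE v : fb X v = Z v - VH (VHa (Z v)).
Proof.
rewrite pencil_feedback /codefect otensBl otens_id bop_compBl bop_comp1l bopB; congr (_ - _).
by rewrite -[RHS]/(bop_comp VH VHa (Z v)) otens_comp bop_comp1l.
Qed.

Let Qr v : Q v - fb X (Q v) = v.
Proof. by have [h _] := Q_inv; rewrite -[LHS]/(bop_comp (bop_id KH - fb X) Q v) h. Qed.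
Let Ql v : Q (v - fb X v) = v.
Proof. by have [_ h] := Q_inv; rewrite -[LHS]/(bop_comp Q (bop_id KH - fb X) v) h. Qed.
Let Q0r v : Q0 v - Z (Q0 v) = v.
Proof. by have [h _] := Q0_inv; rewrite -[LHS]/(bop_comp (bop_id KH - Z) Q0 v) h. Qed.
Let Q0l v : Q0 (v - Z v) = v.
Proof. by have [_ h] := Q0_inv; rewrite -[LHS]/(bop_comp Q0 (bop_id KH - Z) v) h. Qed.

(* With [F := Z - VV* Z], [loop = V* Z (1 - F)^-1 V] is [sum_i X_i M_i], and
   [1 + V* Z (1 - Z)^-1 V] inverts [1 - loop]. *)
Definition loop_inverse : bop EH EH :=
  bop_id EH + bop_comp VHa (bop_comp Z (bop_comp Q0 VH)).
Definition loop : bop EH EH := bop_comp VHa (bop_comp Z (bop_comp Q VH)).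

Lemma loop_inverseE x : loop_inverse x = x + VHa (Z (Q0 (VH x))).
Proof. by []. Qed.
Lemma loopE x : loop x = VHa (Z (Q (VH x))).
Proof. by []. Qed.

(** Feeding [loop_inverse x] to the closed loop reproduces the open-loop state, since the additional
    input [V V^* Z y] compensates the feedback term. This yields both the right inverse of
    [1 - loop] and the factorization of [Theta]. *)
Lemma Q_loop_inverse x : Q (VH (loop_inverse x)) = Q0 (VH x).
Proof.
rewrite -[RHS]Ql; congr (Q _); set y := Q0 (VH x).
have -> : VH (loop_inverse x) = VH x + VH (VHa (Z y)) by rewrite loop_inverseE linearD.
by rewrite fbE opprB addrA -{1}(Q0r (VH x)) -/y addrAC.
Qed.

Lemma loop_inverseP : bop_inverse (bop_id EH - loop) loop_inverse.
Proof.
split; apply: bop_ext => x.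
  rewrite bop_compBl bop_comp1l bopB -[X in _ - X]/(loop (loop_inverse x)) loopE.
  by rewrite Q_loop_inverse loop_inverseE addrK.
rewrite bop_compBr bop_comp1r bopB -[X in _ - X]/(loop_inverse (loop x)).
transitivity (loop_inverse (x - loop x)); first by rewrite linearB.
set v := Q (VH x).
have e : VH (x - loop x) = v - Z v.
  have -> : VH (x - loop x) = VH x - VH (loop x) by rewrite linearB.
  by rewrite loopE -/v -{1}(Qr (VH x)) -/v fbE opprB addrA addrAC addrK.
by rewrite loop_inverseE e Q0l loopE -/v subrK.
Qed.

Lemma sum_loopE : \sum_i bop_comp (otens EH EH (bop_id E) (X i))
   (bop_comp (bop_comp VHa (otens KH KH (T i) (bop_id H))) (bop_comp Q VH)) = loop.
Proof.
rewrite /loop /pencil bop_comp_suml bop_comp_sumr; apply: eq_bigr => i _.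
by rewrite !bop_compA !otens_comp !bop_comp1l !bop_comp1r.
Qed.
End AtPoint.

(** Any [K] with the column inequality for [T] and [P] and a contraction [V] will do: [Theta] enters
    only through its coefficients [P T_w V], so the concrete shift model can wait. *)
Lemma realized_representation (Theta : opball n H -> bop EH YH) :
  has_expansion EH YH (fun w => bop_comp P (bop_comp (word_eval T w) V)) Theta ->
  exists (L : opball n H -> bop EH YH) (M : 'I_n -> opball n H -> bop EH EH),
     schur_class EH CH (column EH YH CH L M) /\
     forall X : opball n H, exists S : bop EH EH,
       bop_inverse
         (bop_id EH - \sum_i bop_comp (otens EH EH (bop_id E) (set_val X i))
                                      (M i X)) S /\
       Theta X = bop_comp (L X) S.
Proof.
move=> [_ Theta_exp].
have rho_ex (X : opball n H) := opball_row_bound (set_valP X).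
have Q_ex (X : opball n H) : exists Q : bop KH KH,
    bop_inverse (bop_id KH - fb (set_val X)) Q /\ series (bop_pow (fb (set_val X))) @ \oo --> Q.
  have [rho r01 Xr] := rho_ex X.
  exact: (neumann r01 (opnorm_pencil KH r01 Xr (feedback_sum_le T_col V_contr))).
have Q0_ex (X : opball n H) : exists Q : bop KH KH,
    bop_inverse (bop_id KH - pencil KH (set_val X) T) Q /\
    series (bop_pow (pencil KH (set_val X) T)) @ \oo --> Q.
  have [rho r01 Xr] := rho_ex X.
  exact: (neumann r01 (opnorm_pencil KH r01 Xr (T_sum_le T_col))).
have [Q QP] := choice Q_ex.
pose L X := bop_comp (otens KH YH P (bop_id H)) (bop_comp (Q X) VH).
pose M i X := bop_comp (bop_comp VHa (otens KH KH (T i) (bop_id H))) (bop_comp (Q X) VH).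
have colE X : column EH YH CH L M X =
    bop_comp (otens KH CH (output T P V) (bop_id H)) (bop_comp (Q X) VH).
  by apply: bop_ext => x; rewrite columnE /= output_tensor.
exists L, M; split; first split.
- exists (transfer T P V); split.
    apply: limsup_gram => k; apply: opnorm_gram => // x.
    exact: (transfer_gram T_col V_contr).
  move=> X; rewrite colE; have [_ QX] := QP X.
  exact: (pencil_series QX).
- apply: ge_ereal_sup => _ [X _ <-]; rewrite lee_fin.
  apply: opnorm_le_n2 => // x; rewrite expr1n mul1r columnE n2_tcol.
  have [rho r01 Xr] := rho_ex X.
  apply: (transfer_energy YH T_col V_contr r01 Xr (x := x) (v := Q X (VH x))).
  have [[h _] _] := QP X.
  have h2 : Q X (VH x) - fb (set_val X) (Q X (VH x)) = VH x.
    by rewrite -[LHS]/(bop_comp (bop_id KH - fb (set_val X)) (Q X) (VH x)) h.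
  by apply/eqP; rewrite -subr_eq h2.
move=> X; have [Q0 [Q0inv Q0s]] := Q0_ex X; have [Qinv _] := QP X.
exists (loop_inverse (set_val X) Q0).
rewrite /M sum_loopE; split; first exact: loop_inverseP.
(* Both sides are the sum of the series of the [P Z^k V]. *)
apply: (cvg_uniq (F := \oo) (Theta_exp X)).
have -> : bop_comp (L X) (loop_inverse (set_val X) Q0) =
    bop_comp (otens KH YH P (bop_id H)) (bop_comp Q0 VH).
  by apply: bop_ext => x; rewrite /= (Q_loop_inverse Qinv Q0inv).
exact: (pencil_series Q0s).
Qed.
End Forward.

Lemma schur_representation_exists (R : realType) (n : nat) (E Y H : hilbertType R)
    (EH : hilbert_tensor E H) (YH : hilbert_tensor Y H)
    (CH : hilbert_tensor (hsum Y (hpow n E)) H)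
    (Theta : opball n H -> bop EH YH) (A : seq 'I_n -> bop E Y) :
  has_expansion EH YH A Theta -> (H2norm A <= 1)%E ->
  exists (L : opball n H -> bop EH YH) (M : 'I_n -> opball n H -> bop EH EH),
     schur_class EH CH (column EH YH CH L M) /\
     forall X : opball n H, exists S : bop EH EH,
       bop_inverse
         (bop_id EH - \sum_i bop_comp (otens EH EH (bop_id E) (set_val X i))
                                      (M i X)) S /\
       Theta X = bop_comp (L X) S.
Proof.
move=> Aexp /H2norm_le1_psum/l2_op_exists [V [VE V_contr]].
apply: (@realized_representation _ _ _ _ _ _ EH YH (l2_tensor n YH) CH (@l2_shift R n Y)
  (l2_eval [::]) V) => //; first exact: l2_shift_sum.
have -> : (fun w => bop_comp (l2_eval [::]) (bop_comp (word_eval (@l2_shift R n Y) w) V)) = A => //.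
apply/funext => w; apply: bop_ext => x.
by rewrite /= l2_evalE word_eval_shift VE.
Qed.

(** * Compressed creation operators *)

Section Convolution.
Variables (n : nat) (V : nmodType).
Implicit Types F : seq 'I_n -> seq 'I_n -> V.

(** The sum over all factorizations [c = a b]: the coefficient at [c] of a product of power series
    in noncommuting variables. *)
Definition wconv F (c : seq 'I_n) : V := \sum_(k < (size c).+1) F (take k c) (drop k c).

Lemma wsum_conv m F :
  wsum m (wconv F) = \sum_(k < m.+1) wsum k (fun a => wsum (m - k) (fun b => F a b)).
Proof.
rewrite (eq_wsum (G := fun c => \sum_(k < m.+1) F (take k c) (drop k c))).
  by rewrite wsum_big; apply: eq_bigr => k _; rewrite wsum_split// -ltnS.
by move=> w wm; rewrite /wconv wm.
Qed.

End Convolution.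

Lemma psum_conv n (V : zmodType) N (F : seq 'I_n -> seq 'I_n -> V) :
  psum N (wconv F) = \sum_(j < N) \sum_(0 <= k < N - j) wsum k (fun a => wsum j (fun b => F a b)).
Proof.
rewrite -(triangle_sum (fun k j => wsum k (fun a => wsum j (fun b => F a b)))).
by apply: eq_bigr => m _; rewrite wsum_conv.
Qed.

Lemma raddf_conv n (U V : zmodType) (f : {additive U -> V}) (F : seq 'I_n -> seq 'I_n -> U) c :
  f (wconv F c) = wconv (fun a b => f (F a b)) c.
Proof. by rewrite /wconv raddf_sum. Qed.

Section OrthonormalFamilies.
Context {R : realType} {H : hilbertType R}.
Hypothesis H_inf : infinite_dimensional H.

(** Gram-Schmidt, with infinite dimension supplying a vector outside the span of the first [m].
    Values of [e] past the bound are arbitrary. *)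
Lemma orthonormal_exists m : exists e : nat -> H, forall i j, (i < m)%N -> (j < m)%N ->
  inner (e i) (e j) = (i == j)%:R.
Proof.
elim: m => [|m [e eP]]; first by exists (fun=> 0).
have [x xP] : exists x : H, forall c : 'I_m -> R[i], x <> \sum_i c i *: e i.
  apply: contrapT => h; apply: H_inf; exists m, (fun i : 'I_m => e i) => x.
  apply: contrapT => k; apply: h; exists x => c xc; apply: k; by exists c.
pose y := x - \sum_(i < m) inner x (e i) *: e i.
have y0 : n2 y != 0.
  apply/eqP => /n2_eq0/eqP; rewrite subr_eq0 => /eqP yx.
  exact: (xP (fun i => inner x (e i)) yx).
have ye j : (j < m)%N -> inner y (e j) = 0.
  move=> jm; rewrite /y linearBl/= inner_suml (bigD1 (Ordinal jm))//= big1 ?addr0.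
    by rewrite innerZl eP// eqxx mulr1 subrr.
  move=> i /negPf ij; rewrite innerZl eP//.
  have -> : (i == j :> nat) = false by rewrite -ij.
  by rewrite mulr0.
pose z := (Num.sqrt (n2 y))^-1%:C *: y.
have zz : inner z z = 1.
  rewrite n2C n2ZR exprVn sqr_sqrtr ?n2_ge0// mulVf//.
have ze j : (j < m)%N -> inner z (e j) = 0 by move=> jm; rewrite innerZl ye// mulr0.
exists (fun i => if i == m then z else e i) => i j.
rewrite !ltnS (leq_eqVlt i) (leq_eqVlt j) => /orP[/eqP ->|im] /orP[/eqP ->|jm].
- by rewrite !eqxx zz.
- by rewrite eqxx (ltn_eqF jm) ze// eq_sym (ltn_eqF jm).
- by rewrite eqxx (ltn_eqF im) inner_conj ze// rmorph0.
- by rewrite (ltn_eqF im) (ltn_eqF jm) eP.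
Qed.

Lemma orthonormal_words n N : exists e : seq 'I_n -> H, forall v w,
  (size v <= N)%N -> (size w <= N)%N -> inner (e v) (e w) = (v == w)%:R.
Proof.
have [e eP] := orthonormal_exists #|{bseq N of 'I_n}|.
(* Words longer than [N] are sent to a default by [insub_bseq]; no claim is made about them. *)
exists (fun w => e (enum_rank (insub_bseq N w))) => v w vN wN.
rewrite eP//; congr (_%:R); congr nat_of_bool.
apply/eqP/eqP => [/val_inj/enum_rank_inj h|->//].
have vE u (uN : (size u <= N)%N) : insub_bseq N u = u :> seq 'I_n by exact: insubdK.
by rewrite -(vE v vN) -(vE w wN) h.
Qed.
End OrthonormalFamilies.

Section Creation.
Context {R : realType} {n N : nat} {H : hilbertType R} (e : seq 'I_n -> H).
Hypothesis e_ortho : forall v w, (size v <= N)%N -> (size w <= N)%N ->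
  inner (e v) (e w) = (v == w)%:R.

Definition abs2 (c : R[i]) : R := complex.Re (c * Num.conj c).

Lemma psum_suml (V : hilbertType R) M (F : seq 'I_n -> V) y :
  rin (psum M F) y = psum M (fun w => rin (F w) y).
Proof. by rewrite /psum rin_suml; apply: eq_bigr => k _; rewrite rin_suml. Qed.

Lemma n2_ortho_psum M (V : hilbertType R) (F : seq 'I_n -> V) :
  (forall v w, (size v < M)%N -> (size w < M)%N -> v != w -> rin (F v) (F w) = 0) ->
  n2 (psum M F) = psum M (fun w => n2 (F w)).
Proof.
move=> F0; rewrite /n2 psum_suml; apply: eq_psum => w wM.
rewrite rinC psum_suml (eq_psum (G := fun v => if v == w then rin (F v) (F w) else 0)).
  by rewrite psum_pick wM.
by move=> v vM; case: eqP => // /eqP vw; rewrite F0.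
Qed.

Lemma n2_scale_e (c : R[i]) w : (size w <= N)%N -> n2 (c *: e w) = abs2 c.
Proof. by move=> wN; rewrite /n2 /rin innerZl innerZr e_ortho// eqxx mulr1. Qed.

Lemma n2_psum_e (c : seq 'I_n -> R[i]) :
  n2 (psum N.+1 (fun w => c w *: e w)) = psum N.+1 (fun w => abs2 (c w)).
Proof.
rewrite n2_ortho_psum; first by apply: eq_psum => w; rewrite ltnS; exact: n2_scale_e.
move=> v w; rewrite !ltnS => vN wN vw.
by rewrite /rin innerZl innerZr e_ortho// (negPf vw) !mulr0.
Qed.

Lemma abs2_ge0 c : 0 <= abs2 c.
Proof. by rewrite /abs2 -normCK; apply: ge0_ReE; rewrite exprn_ge0. Qed.

Lemma abs2_0 : abs2 0 = 0. Proof. by rewrite /abs2 mul0r. Qed.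

Lemma bessel (h : H) : psum N (fun w => abs2 (inner h (e w))) <= n2 h.
Proof.
pose c w := inner h (e w).
apply: (@le_trans _ _ (psum N.+1 (fun w => abs2 (c w)))).
  by apply: psum_mono => // w; exact: abs2_ge0.
pose p := psum N.+1 (fun w => c w *: e w).
have hp : rin h p = psum N.+1 (fun w => abs2 (c w)).
  rewrite rinC psum_suml; apply: eq_psum => w _.
  by rewrite /rin innerZl (inner_conj (e w)).
have := n2_ge0 (h - p); rewrite n2B hp n2_psum_e; lra.
Qed.

Variable r : R.

(* Creation operator of the Fock space spanned by the [e w], cut off at word
   length [N] and scaled by [r] so as to lie in the open ball. *)
Definition creation_fun i (h : H) : H :=
  psum N (fun w => (r%:C * inner h (e w)) *: e (i :: w)).

(** Different [i] produce words with different first letters, so the images are orthogonal, and each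
    of them is bounded by Bessel's inequality. *)
Lemma sum_creation (h : 'I_n -> H) :
  n2 (\sum_i creation_fun i (h i)) <= r ^+ 2 * \sum_i n2 (h i).
Proof.
pose c w := if w is i :: w' then r%:C * inner (h i) (e w') else 0.
have -> : \sum_i creation_fun i (h i) = psum N.+1 (fun w => c w *: e w).
  by rewrite psumSl /= scale0r add0r.
rewrite n2_psum_e psumSl /= abs2_0 add0r mulr_sumr; apply: ler_sum => i _.
have -> : psum N (fun w => abs2 (r%:C * inner (h i) (e w))) =
    r ^+ 2 * psum N (fun w => abs2 (inner (h i) (e w))).
  rewrite -psumZ; apply: eq_psum => w _; rewrite /abs2 rmorphM /= conj_real.
  by rewrite mulrACA -rmorphM /= Re_realM expr2.
by rewrite ler_wpM2l ?sqr_ge0// bessel.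
Qed.

Lemma creation_linear i : linear (creation_fun i).
Proof.
move=> a x y; rewrite /creation_fun /psum scaler_sumr -big_split; apply: eq_bigr => k _.
rewrite /wsum scaler_sumr -big_split; apply: eq_bigr => w _ /=.
by rewrite innerDl innerZl scalerA -scalerDl; congr (_ *: _); ring.
Qed.

Lemma creation_bound i h : n2 (creation_fun i h) <= `|r| ^+ 2 * n2 h.
Proof.
have := sum_creation (fun j => if j == i then h else 0).
rewrite (bigD1 i)//= eqxx big1 ?addr0; last first.
  move=> j /negPf ->; rewrite /creation_fun /psum big1// => k _; rewrite /wsum big1// => w _.
  by rewrite inner0l mulr0 scale0r.
rewrite (bigD1 i)//= eqxx big1 ?addr0 ?real_normK ?num_real// => j /negPf ->.
exact: n2_0.
Qed.

Definition creation i : bop H H :=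
  sval (bop_exists (creation_linear i) (normr_ge0 r) (creation_bound i)).

Lemma creationE i h : creation i h = creation_fun i h.
Proof. by rewrite /creation; case: bop_exists => T /= ->. Qed.

Lemma creation_row_bound : row_bound creation (r ^+ 2).
Proof.
move=> u; rewrite rowopE n2_hpow; under eq_bigr do rewrite creationE.
exact: sum_creation.
Qed.

Lemma creation_e i w : (size w <= N)%N ->
  creation i (e w) = if (size w < N)%N then r%:C *: e (i :: w) else 0.
Proof.
move=> wN; rewrite creationE /creation_fun.
rewrite (eq_psum (G := fun v => if v == w then r%:C *: e (i :: v) else 0)); first exact: psum_pick.
move=> v vN; rewrite e_ortho//; last exact: ltnW.
by rewrite eq_sym; case: eqP => _; rewrite ?mulr1// mulr0 scale0r.
Qed.

Lemma creation_word v w : (size w <= N)%N -> word_eval creation v (e w) =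
  if (size v + size w <= N)%N then (r ^+ size v)%:C *: e (v ++ w) else 0.
Proof.
move=> wN; elim: v => [|i v IH] /=; first by rewrite add0n wN expr0 scale1r.
rewrite IH; case: ifP => vw; last first.
  rewrite linear0 ifN// addSn; apply: contraFN vw; exact: ltnW.
rewrite linearZ /= creation_e size_cat// addSn; case: ifP => _.
  by rewrite scalerA -rmorphM /= -exprSr.
by rewrite scaler0.
Qed.
End Creation.

Section ToeplitzContraction.
Context {R : realType} {n : nat} {E W H : hilbertType R}.
Variables (EH : hilbert_tensor E H) (WH : hilbert_tensor W H).
Variables (C : seq 'I_n -> bop E W).

Section Fock.
Variables (N : nat) (e : seq 'I_n -> H) (r : R).
Hypothesis e_ortho : forall v w, (size v <= N)%N -> (size w <= N)%N ->
  inner (e v) (e w) = (v == w)%:R.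

(** Embeds families on words of length at most [N] isometrically into [V (x) H]; coefficients of an
    operator on [V (x) H] become matrix entries on words. *)
Definition fock (V : hilbertType R) (VH : hilbert_tensor V H) (x : seq 'I_n -> V) : VH :=
  psum N.+1 (fun w => tens VH (x w) (e w)).

Lemma n2_fock (V : hilbertType R) (VH : hilbert_tensor V H) (x : seq 'I_n -> V) :
  n2 (fock VH x) = psum N.+1 (fun w => n2 (x w)).
Proof.
rewrite /fock n2_ortho_psum.
  apply: eq_psum => w; rewrite ltnS => wN.
  by rewrite /n2 {1}/rin inner_tens e_ortho// eqxx mulr1.
move=> v w; rewrite !ltnS => vN wN vw.
by rewrite /rin inner_tens e_ortho// (negPf vw) mulr0.
Qed.

Lemma homog_fock k x : homog EH WH C (creation (N := N) e_ortho r) k (fock EH x) =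
  psum N.+1 (fun w => if (k + size w <= N)%N then
     wsum k (fun v => tens WH ((r ^+ k)%:C *: C v (x w)) (e (v ++ w))) else 0).
Proof.
rewrite /fock raddf_psum; apply: eq_psum => w; rewrite ltnS => wN /=.
rewrite /homog bop_sum.
rewrite (eq_bigr (fun v : k.-tuple 'I_n => if (k + size w <= N)%N then
    tens WH ((r ^+ k)%:C *: C v (x w)) (e (v ++ w)) else 0)) => [|v _].
  by case: ifP => // _; rewrite big1.
rewrite otensE creation_word// size_tuple; case: ifP => _; last by rewrite linear0r.
by rewrite linearZr_LR linearZl_LR.
Qed.

(** Every degree above [N] kills the truncated Fock space, so the series stops at once and acts
    there as the Toeplitz matrix of [C], weighted by powers of [r]. *)
Lemma series_fock M x : (N < M)%N ->
  series (homog EH WH C (creation (N := N) e_ortho r)) M (fock EH x) =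
  fock WH (wconv (fun v w => (r ^+ size v)%:C *: C v (x w))).
Proof.
move=> NM.
have -> : fock WH (wconv (fun v w => (r ^+ size v)%:C *: C v (x w))) =
    psum N.+1 (wconv (fun v w => tens WH ((r ^+ size v)%:C *: C v (x w)) (e (v ++ w)))).
  apply: eq_psum => c _; rewrite /wconv linear_sumlz; apply: eq_bigr => k _.
  by rewrite cat_take_drop.
rewrite psum_conv /series /= bop_sum.
rewrite (eq_bigr _ (fun k _ => homog_fock k x)).
rewrite exchange_big /= big_mkord; apply: eq_bigr => j _.
(* On words of length [j] the cutoff annihilates the degrees [k > N - j], which leaves the triangle
   of indices of the convolution. *)
rewrite (big_cat_nat (n := N.+1 - j)) ?leq_subLR//=; last first.
  by rewrite (leq_trans NM)// leq_addl.
rewrite [X in _ + X]big_nat [X in _ + X]big1 ?addr0; last first.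
  move=> k /andP[kj _]; rewrite /wsum big1// => w _; rewrite size_tuple ifN//.
  by rewrite -ltnNge addnC -leq_subLR.
apply: eq_big_nat => k /andP[_ kj].
rewrite /wsum [RHS]exchange_big; apply: eq_bigr => w _; rewrite size_tuple ifT.
  by apply: eq_bigr => v _; rewrite size_tuple.
by move: kj; rewrite ltn_subRL addnC ltnS.
Qed.
End Fock.

Hypothesis H_inf : infinite_dimensional H.
Variable F : opball n H -> bop EH WH.
Hypothesis F_exp : forall X : opball n H,
  series (fun k => \sum_(w : k.-tuple 'I_n) otens EH WH (C w) (word_eval (set_val X) w)) @ \oo --> F X.
Hypothesis F_le1 : forall X, opnorm (F X) <= 1.

Lemma toeplitz_contr_r N (r : R) (x : seq 'I_n -> E) : 0 <= r < 1 ->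
  psum N.+1 (fun c => n2 (wconv (fun v w => (r ^+ size v)%:C *: C v (x w)) c)) <=
  psum N.+1 (fun w => n2 (x w)).
Proof.
move=> r01; have [e e_ortho] := orthonormal_words H_inf n N.
have Xb := row_bound_opball r01 (creation_row_bound e_ortho r).
pose X : opball n H := @exist _ (fun Z => Z \in opball n H) (creation e_ortho r) (mem_set Xb).
rewrite -(n2_fock e_ortho WH) -(n2_fock e_ortho EH).
have FX : F X (fock N e EH x) = fock N e WH (wconv (fun v w => (r ^+ size v)%:C *: C v (x w))).
  have h : (fun M => series (homog EH WH C (creation e_ortho r)) M (fock N e EH x)) @ \oo -->
    F X (fock N e EH x) .
    have h0 : series (homog EH WH C (creation e_ortho r)) @ \oo --> F X by exact: (@F_exp X).
    by apply: opnorm_cvg_pt.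
  apply: (cvg_uniq h).
  apply/cvg_n2; apply: (squeeze0 (d := fun=> 0) (c := 1)); first exact: cvg_cst.
  exists N.+1 => // M /= NM.
  by rewrite (@series_fock N e r e_ortho M x NM) subrr n2_0 mulr0 lexx.
by rewrite -FX; apply: n2_bop1.
Qed.

Lemma le_expr_limit (a b : R) m : 0 <= b -> (forall r : R, 0 <= r < 1 -> r ^+ m * a <= b) -> a <= b.
Proof.
move=> b0 h.
have h1 : (fun k => (1 - k.+2%:R^-1) ^+ m * a) @ \oo --> (1 - 0) ^+ m * a.
  apply: cvgM; last exact: cvg_cst.
  apply: (@cvg_comp _ _ _ (fun k => 1 - k.+2%:R^-1) (fun y : R => y ^+ m) \oo (nbhs (1 - 0 : R))).
    apply: cvgB; first exact: cvg_cst.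
    apply: (squeeze0 (cvg_invS 1) (c := 1)); apply: nearW => k.
    by rewrite !mul1r invr_ge0 ler0n lef_pV2 ?posrE ?ltr0n// ler_nat leqnSn.
  exact: exprn_continuous.
rewrite subr0 expr1n mul1r in h1.
apply: (cvgr_to_le h1); apply: nearW => k; apply: h.
rewrite subr_ge0 ltrBlDr ltrDl invr_gt0 ltr0n andbT.
by rewrite invf_le1 ?ltr0n// ler1n.
Qed.

(* The scaling [r ^+ size w] of the input turns the coefficients [r ^+ size v]
   into an overall factor [r ^+ size c], which disappears as [r] tends to 1. *)
Lemma toeplitz_contr N (x : seq 'I_n -> E) :
  psum N.+1 (fun c => n2 (wconv (fun v w => C v (x w)) c)) <= psum N.+1 (fun w => n2 (x w)).
Proof.
(* The overall factor is squared by [n2], and [size c <= N], so the exponent of [r] is at most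
   [2 * N]. *)
apply: (@le_expr_limit _ _ (2 * N)); first by apply: psum_ge0 => w; exact: n2_ge0.
move=> r /[dup] r01 /andP[r0 r1].
have r1' : r <= 1 by exact: ltW.
have := toeplitz_contr_r N (fun w => (r ^+ size w)%:C *: x w) r01 => h.
apply: (@le_trans _ _ (psum N.+1 (fun w => n2 ((r ^+ size w)%:C *: x w)))); last first.
  apply: psum_le => w; rewrite n2ZR ler_piMl ?n2_ge0// exprn_ile1 ?exprn_ge0//.
  by rewrite exprn_ile1.
apply: le_trans h; rewrite -psumZ /psum; apply: ler_sum_nat => k /andP[_ kN].
apply: ler_sum => w _.
have -> : wconv (fun v w => (r ^+ size v)%:C *: C v ((r ^+ size w)%:C *: x w)) w =
    (r ^+ size w)%:C *: wconv (fun v w => C v (x w)) w.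
  rewrite /wconv scaler_sumr; apply: eq_bigr => j _.
  by rewrite linearZ scalerA -rmorphM -exprD -size_cat cat_take_drop.
rewrite n2ZR ler_wpM2r ?n2_ge0// size_tuple -exprM mulnC.
by apply: ler_wiXn2l => //; rewrite leq_mul2r -ltnS kN orbT.
Qed.
End ToeplitzContraction.

(** * Coefficients of a Schur class column *)

Section HomogeneousBounds.
Context {R : realType} {n : nat} {H : hilbertType R}.
Variables (X : 'I_n -> bop H H) (rho : R).
Hypothesis rho01 : 0 <= rho < 1.
Hypothesis X_row : row_bound X (rho ^+ 2).

Lemma word_eval_cat a b : word_eval X (a ++ b) = bop_comp (word_eval X a) (word_eval X b).
Proof. by elim: a => [|i a IH] /=; rewrite ?bop_comp1l// IH bop_compA. Qed.

(** The words of length [k] index the [k]-fold iterate of the row of the [X i], so each letter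
    contributes one factor [rho]. *)
Lemma word_row (K : hilbertType R) (KH : hilbert_tensor K H) k (v : seq 'I_n -> KH) :
  n2 (wsum k (fun w => otens KH KH (bop_id K) (word_eval X w) (v w))) <=
  (rho ^+ k) ^+ 2 * wsum k (fun w => n2 (v w)).
Proof.
elim: k v => [|k IH] v; first by rewrite !wsum0 /= otens_id expr0 expr1n mul1r.
rewrite !wsumS.
have -> : \sum_(i < n) wsum k (fun w => otens KH KH (bop_id K) (word_eval X (i :: w)) (v (i :: w))) =
  \sum_(i < n) otens KH KH (bop_id K) (X i)
    (wsum k (fun w => otens KH KH (bop_id K) (word_eval X w) (v (i :: w)))).
  apply: eq_bigr => i _; rewrite raddf_wsum; apply: eq_wsum => w _ /=.
  by rewrite -[RHS]/(bop_comp (otens KH KH (bop_id K) (X i)) (otens KH KH (bop_id K) (word_eval X w)) _) otens_comp bop_comp1l.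
apply: le_trans (row_tensor_le X_row _) _.
rewrite (exprS rho k) exprMn -[leRHS]mulrA; apply: ler_wpM2l; first exact: sqr_ge0.
by rewrite mulr_sumr; apply: ler_sum => i _; exact: IH.
Qed.

(** The homogeneous part is the row of the [I (x) X_w] after the column of the [A_w (x) I]. All the
    decay comes from the row, so the coefficients only need a bound uniform in the degree. *)
Lemma opnorm_homog (E Y : hilbertType R) (EH : hilbert_tensor E H) (YH : hilbert_tensor Y H)
  (A : seq 'I_n -> bop E Y) k : (forall x, wsum k (fun w => n2 (A w x)) <= n2 x) ->
  opnorm (homog EH YH A X k) <= 1 * rho ^+ k.
Proof.
move=> hA; have [r0 _] := andP rho01.
rewrite mul1r; apply: opnorm_le_n2; first by rewrite exprn_ge0.
move=> u.
have -> : homog EH YH A X k u =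
   wsum k (fun w => otens YH YH (bop_id Y) (word_eval X w) (otens EH YH (A w) (bop_id H) u)).
  rewrite /homog bop_sum; apply: eq_bigr => w _.
  by rewrite -[RHS]/(bop_comp (otens YH YH (bop_id Y) (word_eval X w)) (otens EH YH (A w) (bop_id H)) u) otens_comp bop_comp1l bop_comp1r.
apply: le_trans (word_row _ _) _; rewrite ler_wpM2l ?sqr_ge0//.
have h x : \sum_(w : k.-tuple 'I_n) n2 (A w x) + n2 ((0 : bop E Y) x) <= 1 * n2 x.
  by rewrite bop0 n2_0 addr0 mul1r; exact: hA.
have := @column_tensor _ _ _ _ _ _ EH YH YH _ _ _ h u.
by rewrite otens0l bop0 n2_0 addr0 mul1r.
Qed.

Lemma homog_conv (E Y Z : hilbertType R) (EH : hilbert_tensor E H) (YH : hilbert_tensor Y H)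
  (ZH : hilbert_tensor Z H) (A : seq 'I_n -> bop Y Z) (B : seq 'I_n -> bop E Y) m :
  homog EH ZH (wconv (fun a b => bop_comp (A a) (B b))) X m =
  \sum_(k < m.+1) bop_comp (homog YH ZH A X k) (homog EH YH B X (m - k)).
Proof.
have -> : homog EH ZH (wconv (fun a b => bop_comp (A a) (B b))) X m =
  wsum m (wconv (fun a b => bop_comp (otens YH ZH (A a) (word_eval X a))
                                    (otens EH YH (B b) (word_eval X b)))).
  apply: eq_wsum => w _; rewrite /wconv otens_suml; apply: eq_bigr => k _.
  by rewrite otens_comp -word_eval_cat cat_take_drop.
rewrite wsum_conv; apply: eq_bigr => k _.
rewrite /homog /wsum bop_comp_suml; apply: eq_bigr => a _.
by rewrite bop_comp_sumr.
Qed.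
End HomogeneousBounds.

Section Coefficients.
Context {R : realType} {n : nat} {E Y : hilbertType R}.
Variable C : seq 'I_n -> bop E (hsum Y (hpow n E)).
Hypothesis C_contr : forall N (x : seq 'I_n -> E),
  psum N.+1 (fun c => n2 (wconv (fun v w => C v (x w)) c)) <= psum N.+1 (fun w => n2 (x w)).

Definition Lcoef w : bop E Y := bop_comp (@pr_fst R n E Y) (C w).
Definition Mcoef i w : bop E E := bop_comp (@pr_snd R n E Y i) (C w).

(* Coefficients of [(1 - sum_i X_i M_i)^-1]; the fuel [N] only has to reach the
   length of the word. *)
Fixpoint inv_fuel N (c : seq 'I_n) : bop E E :=
  match c, N with
  | [::], _ => bop_id E
  | i :: c', N'.+1 => wconv (fun a b => bop_comp (Mcoef i a) (inv_fuel N' b)) c'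
  | _ :: _, 0 => 0
  end.

Definition Gcoef c := inv_fuel (size c) c.
Definition Acoef : seq 'I_n -> bop E Y := wconv (fun a b => bop_comp (Lcoef a) (Gcoef b)).

Lemma inv_fuelE N M c : (size c <= N)%N -> (size c <= M)%N -> inv_fuel N c = inv_fuel M c.
Proof.
elim: N M c => [|N IH] [|M] [|i c] //=; rewrite !ltnS => cN cM.
apply: eq_bigr => k _; congr bop_comp.
by apply: IH; rewrite size_drop (leq_trans (leq_subr _ _)).
Qed.

Lemma Gcoef_cons i c : Gcoef (i :: c) = wconv (fun a b => bop_comp (Mcoef i a) (Gcoef b)) c.
Proof.
rewrite {1}/Gcoef /=; apply: eq_bigr => k _; congr bop_comp.
by apply: inv_fuelE; rewrite ?size_drop ?leq_subr.
Qed.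

Lemma conv_app (U V W : hilbertType R) (A : seq 'I_n -> bop V W) (B : seq 'I_n -> bop U V) c x :
  wconv (fun a b => bop_comp (A a) (B b)) c x = wconv (fun a b => A a (B b x)) c.
Proof. by rewrite /wconv bop_sum. Qed.

(** By the recursion [Gcoef_cons], the [E^(n)] part of the Toeplitz image of [g] at [c] is again
    [g], at the words one letter longer. *)
Lemma n2_conv_C c x : n2 (wconv (fun v w => C v (Gcoef w x)) c) =
  n2 (Acoef c x) + \sum_(i < n) n2 (Gcoef (i :: c) x).
Proof.
set u := wconv _ c.
have e1 : Acoef c x = pr_fst u by rewrite conv_app /u raddf_conv.
have e2 i : Gcoef (i :: c) x = pr_snd i u by rewrite Gcoef_cons conv_app /u raddf_conv.
by rewrite n2_hsum n2_hpow e1; congr (_ + _); apply: eq_bigr => i _; rewrite e2.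
Qed.

Lemma coef_energy N x :
  psum N.+1 (fun c => n2 (Acoef c x)) + wsum N.+1 (fun c => n2 (Gcoef c x)) <= n2 x.
Proof.
have := C_contr N (fun w => Gcoef w x).
rewrite (eq_psum (G := fun c => n2 (Acoef c x) + \sum_(i < n) n2 (Gcoef (i :: c) x))); last first.
  by move=> c _; rewrite n2_conv_C.
rewrite psumD psum_big.
(* The sums of [g] on both sides now telescope up to the words of length [N.+1]; the empty word
   accounts for [n2 x], as [Gcoef [::]] is the identity. *)
have := psumSl N.+1 (fun c => n2 (Gcoef c x)).
by rewrite psumS /= /Gcoef /= -/Gcoef; lra.
Qed.

Lemma Acoef_le N x : psum N (fun c => n2 (Acoef c x)) <= n2 x.
Proof.
case: N => [|N]; first by rewrite psum0 n2_ge0.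
apply: le_trans (coef_energy N x); rewrite lerDl; apply: wsum_ge0 => w; exact: n2_ge0.
Qed.

Lemma Gcoef_le k x : wsum k (fun c => n2 (Gcoef c x)) <= n2 x.
Proof.
case: k => [|k]; first by rewrite wsum0.
apply: le_trans (coef_energy k x); rewrite lerDr; apply: psum_ge0 => w; exact: n2_ge0.
Qed.

(** This reads the column of the Toeplitz matrix indexed by the empty word. *)
Lemma C_le k x : wsum k (fun w => n2 (C w x)) <= n2 x.
Proof.
have := C_contr k (fun w => if w == [::] then x else 0).
rewrite (eq_psum (G := fun c => n2 (C c x))) => [h|c _]; last first.
  rewrite /wconv big_ord_recr /= take_size drop_size eqxx big1 ?add0r// => i _.
  by rewrite -size_eq0 size_drop subn_eq0 leqNgt ltn_ord /= linear0.
apply: le_trans (wsum_le_psum k _) _; first by move=> w; exact: n2_ge0.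
apply: le_trans h _.
rewrite (eq_psum (G := fun w => if w == [::] then n2 x else 0)).
  by rewrite (psum_pick _ (fun=> n2 x)).
by move=> w _; case: ifP; rewrite ?n2_0.
Qed.

Lemma Lcoef_le k x : wsum k (fun w => n2 (Lcoef w x)) <= n2 x.
Proof.
apply: le_trans (C_le k x); apply: ler_sum => w _.
by rewrite [leRHS]n2_hsum lerDl n2_ge0.
Qed.

Lemma Mcoef_le i k x : wsum k (fun w => n2 (Mcoef i w x)) <= n2 x.
Proof.
apply: le_trans (C_le k x); apply: ler_sum => w _.
rewrite [leRHS]n2_hsum n2_hpow (bigD1 i)//= addrCA lerDl addr_ge0 ?n2_ge0//.
by apply: sumr_ge0 => j _; exact: n2_ge0.
Qed.
End Coefficients.

Section GramSum.
Context {R : realType} {n : nat} {E Y : hilbertType R}.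
Variable A : seq 'I_n -> bop E Y.
Hypothesis A_le : forall N x, psum N (fun w => n2 (A w x)) <= n2 x.

Lemma rin_delta (u : l2 n Y) w y : rin (l2_delta w y) u = rin y (u w).
Proof.
apply: (cvg_uniq (V := R^o) (F := \oo) (u := fun N => psum N (fun v => rin (l2_delta w y v) (u v)))).
  exact: (@rin_l2 _ _ _ (l2_delta w y) u).
apply: (sq_cvg (d := fun=> 0) (c := 0)); first exact: cvg_cst.
exists (size w).+1 => // N /= wN.
rewrite (eq_psum (G := fun v => if v == w then rin y (u v) else 0)).
  by rewrite (psum_pick _ (fun v => rin y (u v))) wN subrr expr0n mul0r.
by move=> v _; rewrite l2_deltaE; case: ifP => _; rewrite ?rin0l.
Qed.

(** [S = V^* V]: the partial Gram sums at [x] are [V^*] applied to truncations of [V x], which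
    converge to [V x]. *)
Lemma gram_sum_exists : exists S : bop E E, is_gram_sum A S /\ opnorm S <= 1.
Proof.
have [V [VE V_contr]] := l2_op_exists A_le.
exists (bop_comp (adj V) V); split; last first.
  apply: opnorm_le_n2 => // x; rewrite expr1n mul1r /=.
  by apply: le_trans (Vadj_contr V_contr _) (V_contr x).
move=> x; have -> : series (fun k => gram A k x) = (fun N => adj V (l2_trunc N (V x))).
  apply/funext => N; apply: rin_ext => z; rewrite -rin_adj.
  rewrite [RHS]rinC /l2_trunc psum_suml rinC /series /= rin_suml; apply: eq_bigr => k _.
  by rewrite rin_gram; apply: eq_wsum => w _; rewrite rin_delta !VE.
by apply: bop_cvg; exact: (@l2_trunc_cvg _ _ _ (V x)).
Qed.

Lemma H2norm_le1 : (H2norm A <= 1)%E.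
Proof.
have [S [SP S1]] := gram_sum_exists.
rewrite /H2norm; case: asboolP => [_|k]; last by case: k; exists S.
have -> : xget 0 (is_gram_sum A) = S.
  case: xgetP => [S' _ S'P|/(_ S)//]; apply: bop_ext => x.
  exact: (cvg_uniq (F := \oo) (S'P x) (SP x)).
by rewrite lee_fin -sqrtr1 ler_sqrt.
Qed.
End GramSum.

(** * From a Schur class column to square-summable coefficients *)

Section Backward.
Context {R : realType} {n : nat} {E Y H : hilbertType R}.
Variables (EH : hilbert_tensor E H) (YH : hilbert_tensor Y H).
Variable CH : hilbert_tensor (hsum Y (hpow n E)) H.
Hypothesis H_inf : infinite_dimensional H.
Variables (L : opball n H -> bop EH YH) (M : 'I_n -> opball n H -> bop EH EH).
Variable Theta : opball n H -> bop EH YH.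
Hypothesis Schur : schur_class EH CH (column EH YH CH L M).
Hypothesis Theta_rep : forall X : opball n H, exists S : bop EH EH,
  bop_inverse (bop_id EH - \sum_i bop_comp (otens EH EH (bop_id E) (set_val X i)) (M i X)) S /\
  Theta X = bop_comp (L X) S.

(** The coefficients are those of the formal product [L G]. At a point [X] the series of [L],
    [sum_i X_i M_i] and [G] are dominated by geometric ones, so formal identities can be summed
    through Cauchy products. *)
Lemma schur_representation_H2 : exists A : seq 'I_n -> bop E Y,
  [/\ has_expansion EH YH A Theta, (H2norm A < +oo)%E & (H2norm A <= 1)%E].
Proof.
have [[C [_ C_exp]] C_sup] := Schur.
have C_le1 X : opnorm (column EH YH CH L M X) <= 1.
  rewrite -lee_fin; apply: le_trans C_sup; apply: ereal_sup_ubound; by exists X.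
have C_contr := toeplitz_contr H_inf C_exp C_le1.
have A_le := Acoef_le C_contr.
have A_H2 := H2norm_le1 A_le.
exists (Acoef C); split => //; last exact: le_lt_trans A_H2 (ltry _).
split.
  apply: limsup_gram => k; apply: opnorm_gram => // x; rewrite mul1r.
  by apply: le_trans (A_le k.+1 x); apply: wsum_le_psum => w; exact: n2_ge0.
move=> X; have [rho r01 Xr] := opball_row_bound (set_valP X).
have [S [[_ SZ] ->]] := Theta_rep X.
set x := set_val X in Xr SZ *.
pose l := homog EH YH (Lcoef C) x; pose m i := homog EH EH (Mcoef C i) x.
pose g := homog EH EH (Gcoef C) x.
have l_le k : opnorm (l k) <= 1 * rho ^+ k := opnorm_homog r01 Xr EH YH (Lcoef_le C_contr k).
have m_le i k : opnorm (m i k) <= 1 * rho ^+ k := opnorm_homog r01 Xr EH EH (Mcoef_le C_contr i k).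
have g_le k : opnorm (g k) <= 1 * rho ^+ k := opnorm_homog r01 Xr EH EH (Gcoef_le C_contr k).
have colX : series (homog EH CH C x) @ \oo --> column EH YH CH L M X := @C_exp X.
have proj (W : hilbertType R) (WH : hilbert_tensor W H) (p : bop (hsum Y (hpow n E)) W) :
    series (homog EH WH (fun w => bop_comp p (C w)) x) @ \oo -->
    bop_comp (otens CH WH p (bop_id H)) (column EH YH CH L M X).
  have -> : series (homog EH WH (fun w => bop_comp p (C w)) x) =
    (fun N => bop_comp (otens CH WH p (bop_id H)) (series (homog EH CH C x) N)).
    apply/funext => N; rewrite /series /= bop_comp_sumr; apply: eq_bigr => k _.
    by rewrite /homog /wsum bop_comp_sumr; apply: eq_bigr => w _; rewrite otens_comp bop_comp1l.
  exact: bop_cvg_comp.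
(* No separate expansion of [L] or the [M i] is assumed; projecting the expansion of the column
   gives them. *)
have lX : series l @ \oo --> L X.
  have -> : L X = bop_comp (otens CH YH (@pr_fst R n E Y) (bop_id H)) (column EH YH CH L M X).
    apply: bop_ext => u; rewrite -[RHS]/(otens CH YH (@pr_fst R n E Y) (bop_id H) (column EH YH CH L M X u)).
    by rewrite columnE tcol_fst.
  exact: proj.
have mX i : series (m i) @ \oo --> M i X.
  have -> : M i X = bop_comp (otens CH EH (@pr_snd R n E Y i) (bop_id H)) (column EH YH CH L M X).
    apply: bop_ext => u; rewrite -[RHS]/(otens CH EH (@pr_snd R n E Y i) (bop_id H) (column EH YH CH L M X u)).
    by rewrite columnE tcol_snd.
  exact: proj.
have [G gG] := geo_series_cvg ler01 r01 g_le.
set Z := \sum_i _ in SZ.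
pose z k := \sum_i bop_comp (otens EH EH (bop_id E) (x i)) (m i k).
pose D := \sum_i opnorm (otens EH EH (bop_id E) (x i)).
have D0 : 0 <= D by apply: sumr_ge0 => i _; exact: opnorm_ge0.
have z_le k : opnorm (z k) <= D * rho ^+ k.
  rewrite /D mulr_suml; apply: (big_rec2 (fun a b => opnorm a <= b)); first by rewrite opnorm0.
  move=> i a b _ h; apply: le_trans (opnormD _ _) _; apply: lerD => //.
  apply: le_trans (opnorm_comp _ _) _; rewrite ler_wpM2l ?opnorm_ge0//.
  by have := m_le i k; rewrite mul1r.
have zZ : series z @ \oo --> Z.
  have -> : series z = (fun N => \sum_i bop_comp (otens EH EH (bop_id E) (x i)) (series (m i) N)).
    apply/funext => N; rewrite /series /= exchange_big; apply: eq_bigr => i _.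
    by rewrite bop_comp_sumr.
  apply: (cvg_bigsum (f := fun i N => bop_comp (otens EH EH (bop_id E) (x i)) (series (m i) N))
    (l := fun i => bop_comp (otens EH EH (bop_id E) (x i)) (M i X))) => i.
  by apply: bop_cvg_comp; exact: mX.
(* The equation [G = 1 + Z G] degree by degree, which [Gcoef_cons] encodes on words. *)
have gS k : g k.+1 = \sum_(j < k.+1) bop_comp (z j) (g (k - j)%N).
  rewrite /g /homog wsumS.
  transitivity (\sum_i bop_comp (otens EH EH (bop_id E) (x i))
      (homog EH EH (wconv (fun a b => bop_comp (Mcoef C i a) (Gcoef C b))) x k)).
    apply: eq_bigr => i _; rewrite /homog /wsum bop_comp_sumr; apply: eq_bigr => w _.
    by rewrite otens_comp bop_comp1l Gcoef_cons.
  under eq_bigr do rewrite (homog_conv x EH EH EH) bop_comp_sumr.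
  rewrite exchange_big; apply: eq_bigr => j _.
  by rewrite /z bop_comp_suml; apply: eq_bigr => i _; rewrite bop_compA.
have g0 : g 0 = bop_id EH by rewrite /g /homog wsum0 /= otens_id.
have ZG : G - bop_comp Z G = bop_id EH.
  have h := cauchy_product D0 ler01 r01 z_le g_le zZ gG.
  have h2 : (fun N => series g N.+1 - bop_id EH) @ \oo --> G - bop_id EH.
    apply: cvgB; last exact: cvg_cst.
    by rewrite (cvg_shiftS (series g)).
  have e : (fun N => series g N.+1 - bop_id EH) =
      series (fun m => \sum_(k < m.+1) bop_comp (z k) (g (m - k)%N)).
    apply/funext => N; rewrite /series /= big_nat_recl//= g0 addrC addrA addNr add0r.
    by apply: eq_bigr => k _; rewrite gS.
  rewrite e in h2; have := cvg_uniq (F := \oo) h h2 => ->.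
  by rewrite opprB addrC subrK.
(* [S] is a left inverse and [G] a right inverse of [1 - Z], so they coincide. *)
have SG : S = G.
  rewrite -[S]bop_comp1r -ZG -{1}[G]bop_comp1l -bop_compBl bop_compA SZ.
  exact: bop_comp1l.
rewrite SG.
have -> : series (fun k => \sum_(w : k.-tuple 'I_n) otens EH YH (Acoef C w) (word_eval x w)) =
    series (fun m => \sum_(k < m.+1) bop_comp (l k) (g (m - k)%N)).
  apply/funext => N; apply: eq_bigr => k _.
  exact: (homog_conv x EH EH YH (Lcoef C) (Gcoef C) k).
exact: (cauchy_product ler01 ler01 r01 l_le g_le lX gG).
Qed.
End Backward.

Theorem corollary3p4 (R : realType) (n : nat) (E Y H : hilbertType R)
    (EH : hilbert_tensor E H) (YH : hilbert_tensor Y H)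
    (CH : hilbert_tensor (hsum Y (hpow n E)) H)
    (n_ge1 : (1 <= n)%N) (E_sep : separable E)
    (H_inf : infinite_dimensional H)
    (Theta : opball n H -> bop EH YH)
    (Theta_min : forall X : opball n H, min_tensor EH YH (Theta X)) :
  (exists A : seq 'I_n -> bop E Y,
     [/\ has_expansion EH YH A Theta, (H2norm A < +oo)%E & (H2norm A <= 1)%E])
  <->
  (exists (L : opball n H -> bop EH YH) (M : 'I_n -> opball n H -> bop EH EH),
     schur_class EH CH (column EH YH CH L M) /\
     forall X : opball n H, exists S : bop EH EH,
       bop_inverse
         (bop_id EH - \sum_i bop_comp (otens EH EH (bop_id E) (set_val X i))
                                      (M i X)) S /\
       Theta X = bop_comp (L X) S).
Proof.
split=> [[A [A_exp _ A_le1]]|[L [M [Schur Theta_rep]]]].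
  exact: schur_representation_exists A_exp A_le1.
by apply: (schur_representation_H2 H_inf Schur).
Qed.
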